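(* The resolution-based proof system R and the Frege-based proof system F (both defined in the context) are p-equivalent, i.e. each p-simulates the other.
   Context: Work with S-form DQBFs $\forall U \exists E\, \phi$: every existential variable $x$ carries an explicit dependency set $D_x \subseteq U$; for a universal variable $u$, $D_u=\{u\}$; for an assignment or set of literals $\alpha$, $D_\alpha$ is the union of the dependency sets of its variables. Both systems are refutation systems: a refutation derives a contradiction ($0$, respectively the empty clause). Both systems also allow weakening the prefix by adding a new variable that does not occur in the matrix. The Frege-based system F (extended Frege with universal reduction and ''independent extension'', for S-form DQBF) has the rules: (i) all rules and axioms of any fixed Frege system; (ii) Axiom: derive any conjunct $L$ of the matrix $\phi$; (iii) Independent extension: derive $\alpha \rightarrow (v \leftrightarrow \bigwedge_{y\in Y} y)$ or $\alpha \rightarrow (v \leftrightarrow \bigvee_{y\in Y} y)$, where $v$ is a fresh existential variable, $\alpha$ is a conjunction of universal literals, $Y$ is a set of (existential or universal) literals, and $D_v = (\bigcup_{y\in Y} D_{\mathrm{var}(y)}) \setminus D_\alpha$; (iv) Universal reduction: from $L(u)$ derive $L(0)$ or $L(1)$, where $u$ is universal and no existential variable $x$ occurring in $L$ has $u \in D_x$. The resolution-based system R has the rules: (i) Axiom: derive any clause $L$ of the matrix $\phi$; (ii) Reduction: from $C \vee u$ derive $C$, where $u$ is a universal literal, no existential literal $l$ in $C$ has $\mathrm{var}(u) \in D_{\mathrm{var}(l)}$, and $\bar u \notin C$; (iii) Resolution: from $E \vee \neg x$ and $F \vee x$ derive $E \vee F$; (iv) Independent extension: derive the three clauses $\bar\alpha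 \vee v \vee y_1$, $\bar\alpha \vee \bar v \vee y_2$, $\bar\alpha \vee \bar v \vee \bar y_1 \vee \bar y_2$, where $v$ is a fresh existential variable, $\alpha$ is a conjunction of universal literals (and $\bar\alpha$ the clause of their negations), and $D_v = (D_{y_1} \cup D_{y_2}) \setminus D_\alpha$.
   Formalization: In R's independent extension the second clause is taken as ᾱ∨v∨y₂, not ᾱ∨v̄∨y₂ as printed; with the printed clauses, y₁=y₂=u universal yields u and then the empty clause, so R would refute every DQBF and the sound system F could not simulate it. *)

(* Defs.v *)
From Corelib Require Import PosDef.
From HB Require Import structures.
From mathcomp Require Import all_boot.

Set Implicit Arguments.
Unset Strict Implicit.
Unset Printing Implicit Defensive.

(** * Polynomial-time computable functions

   The machine model is N. Jones' first-order functional language on binary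
   trees ("Computability and Complexity from a Programming Perspective"), with
   several mutually recursive one-argument functions.  Every evaluation step
   takes constant time on a pointer machine (trees are shared, never copied),
   so that, for outputs of polynomial size, polynomially many steps here are
   the same as polynomial time on a Turing machine. *)

Inductive tree := Leaf | Node (l r : tree).

Fixpoint tsize (t : tree) : nat :=
  if t is Node l r then (tsize l + tsize r).+1 else 1.

Inductive exp :=
| EArg
| ELeaf
| ENode (e1 e2 : exp)
| ELeft (e : exp)
| ERight (e : exp)
| EIf (e e1 e2 : exp)
| ECall (f : nat) (e : exp).

(* The i-th entry is the body of function number i; function 0 is the entry
   point, and an undefined function has the body [ELeaf]. *)
Definition program := seq exp.

(* [evals p x e v t]: in program [p], with argument [x], the expression [e]
   has value [v] and is evaluated (call by value) in [t] steps. *)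
Inductive evals (p : program) : tree -> exp -> tree -> nat -> Prop :=
| EvArg x : evals p x EArg x 1
| EvLeaf x : evals p x ELeaf Leaf 1
| EvNode x e1 e2 v1 v2 t1 t2 :
    evals p x e1 v1 t1 -> evals p x e2 v2 t2 ->
    evals p x (ENode e1 e2) (Node v1 v2) (t1 + t2).+1
| EvLeft x e v t :
    evals p x e v t ->
    evals p x (ELeft e) (if v is Node l _ then l else Leaf) t.+1
| EvRight x e v t :
    evals p x e v t ->
    evals p x (ERight e) (if v is Node _ r then r else Leaf) t.+1
| EvIf x e e1 e2 v w t t' :
    evals p x e v t ->
    evals p x (if v is Node _ _ then e1 else e2) w t' ->
    evals p x (EIf e e1 e2) w (t + t').+1
| EvCall x f e v w t t' :
    evals p x e v t ->
    evals p v (nth ELeaf p f) w t' ->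
    evals p x (ECall f e) w (t + t').+1.

(* The bound on the size of the output is not implied by the time bound,
   because a shared tree can be exponentially larger than its graph. *)
Definition polytime (f : tree -> tree) : Prop :=
  exists (p : program) (k : nat), forall x : tree,
    (exists2 t, evals p x (nth ELeaf p 0) (f x) t & t <= tsize x ^ k + k)
    /\ tsize (f x) <= tsize x ^ k + k.

(** * Encodings as trees (numbers in binary) *)

Fixpoint enc_pos (n : positive) : tree :=
  match n with
  | xH => Node Leaf Leaf
  | xO n' => Node Leaf (enc_pos n')
  | xI n' => Node (Node Leaf Leaf) (enc_pos n')
  end.

Definition enc_nat (n : nat) : tree :=
  if bin_of_nat n is Npos m then enc_pos m else Leaf.

Definition enc_bool (b : bool) : tree := if b then Node Leaf Leaf else Leaf.

Definition enc_pair A B (ea : A -> tree) (eb : B -> tree) (ab : A * B) : tree :=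
  Node (ea ab.1) (eb ab.2).

Definition enc_seq A (ea : A -> tree) (s : seq A) : tree :=
  foldr (fun a => Node (ea a)) Leaf s.

Definition enc_tagged (tag : nat) (args : seq tree) : tree :=
  Node (enc_nat tag) (enc_seq id args).

(** * S-form DQBFs with a matrix in CNF *)

(* The literal [(x, true)] is x, and [(x, false)] is its negation. *)
Definition lit : eqType := (nat * bool)%type.
Definition neg (l : lit) : lit := (l.1, ~~ l.2).

(* A clause is the set of the members of the sequence, see [derived_clause]. *)
Definition clause : eqType := seq lit.

Record prefix := Prefix {
  univ : seq nat;
  exis : seq (nat * seq nat)   (* variables with their dependency sets *)
}.

Definition exvars (P : prefix) : seq nat := [seq xD.1 | xD <- exis P].
Definition declared (P : prefix) : seq nat := univ P ++ exvars P.

Definition dep (P : prefix) (x : nat) : seq nat :=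
  if x \in univ P then [:: x]
  else flatten [seq xD.2 | xD <- exis P & xD.1 == x].

Definition deps (P : prefix) (ls : seq lit) : seq nat :=
  flatten [seq dep P l.1 | l <- ls].

Definition add_univ (P : prefix) (u : nat) : prefix :=
  Prefix (u :: univ P) (exis P).
Definition add_exis (P : prefix) (x : nat) (D : seq nat) : prefix :=
  Prefix (univ P) ((x, D) :: exis P).

Record dqbf := DQBF { pre : prefix; matrix : seq clause }.

Definition wf_prefix (P : prefix) : Prop :=
  uniq (declared P) /\
  (forall xD, xD \in exis P -> {subset xD.2 <= univ P}).

Definition wf_dqbf (Phi : dqbf) : Prop :=
  wf_prefix (pre Phi) /\
  (forall C l, C \in matrix Phi -> l \in C -> l.1 \in declared (pre Phi)).

Definition enc_lit : lit -> tree := enc_pair enc_nat enc_bool.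
Definition enc_clause : clause -> tree := enc_seq enc_lit.
Definition enc_prefix (P : prefix) : tree :=
  Node (enc_seq enc_nat (univ P))
       (enc_seq (enc_pair enc_nat (enc_seq enc_nat)) (exis P)).
Definition enc_dqbf (Phi : dqbf) : tree :=
  Node (enc_prefix (pre Phi)) (enc_seq enc_clause (matrix Phi)).

(** * Refutation systems and p-simulation *)

Record refutation_system := RefutationSystem {
  proof : Type;
  enc_proof : proof -> tree;
  refutation : dqbf -> proof -> Prop
}.

Definition enc_refutation (P : refutation_system) (Phi : dqbf) (pi : proof P)
  : tree := Node (enc_dqbf Phi) (enc_proof pi).

Definition p_simulates (P Q : refutation_system) : Prop :=
  exists2 f : tree -> tree, polytime f &
    forall (Phi : dqbf) (pi : proof Q), refutation Phi pi ->
      exists2 pi' : proof P, refutation Phi pi' &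
        f (enc_refutation Phi pi) = enc_refutation Phi pi'.

Definition p_equivalent (P Q : refutation_system) : Prop :=
  p_simulates P Q /\ p_simulates Q P.

(* Derivations in both systems: a step may extend the prefix [P] and adds the
   lines [new] to the lines [G] derived so far.  Steps spell out their premises
   and parameters, so the size of a derivation accounts for its lines. *)
Inductive refutes (line : eqType) (step : Type)
    (rule : prefix -> seq line -> step -> prefix -> seq line -> Prop)
    (bot : line) : prefix -> seq line -> seq step -> Prop :=
| RefDone P G : bot \in G -> refutes rule bot P G [::]
| RefStep P G s pi P' new :
    rule P G s P' new -> refutes rule bot P' (new ++ G) pi ->
    refutes rule bot P G (s :: pi).

Definition fresh (P : prefix) (v : nat) : Prop := v \notin declared P.

(* Since the matrix of a well-formed DQBF only has declared variables, a fresh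
   variable does not occur in the matrix. *)
Inductive weakening :=
| WeakUniv (u : nat)
| WeakExis (x : nat) (D : seq nat).

Inductive weakens (P : prefix) : weakening -> prefix -> Prop :=
| WUniv u : fresh P u -> weakens P (WeakUniv u) (add_univ P u)
| WExis x D : fresh P x -> {subset D <= univ P} ->
    weakens P (WeakExis x D) (add_exis P x D).

Definition enc_weakening (w : weakening) : tree :=
  match w with
  | WeakUniv u => enc_tagged 0 [:: enc_nat u]
  | WeakExis x D => enc_tagged 1 [:: enc_nat x; enc_seq enc_nat D]
  end.

Definition ext_deps (P : prefix) (alpha Y : seq lit) : seq nat :=
  undup [seq u <- deps P Y | u \notin deps P alpha].

Definition ext_ok (P : prefix) (v : nat) (alpha Y : seq lit) : Prop :=
  [/\ fresh P v,
      (forall l, l \in alpha -> l.1 \in univ P) &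
      (forall y, y \in Y -> y.1 \in declared P)].

(** * The resolution-based system R *)

Definition derived_clause (G : seq clause) (C : clause) : Prop :=
  exists2 C', C' \in G & C' =i C.

Inductive rstep :=
| RAxiom (C : clause)
| RReduce (C : clause) (u : lit)
| RResolve (E F : clause) (x : nat)
| RExtend (v : nat) (alpha : seq lit) (y1 y2 : lit)
| RWeaken (w : weakening).

(* The extension clauses say that, under [alpha], v is the negation of the
   conjunction of y1 and y2. *)
Inductive rrule (M : seq clause) (P : prefix) (G : seq clause) :
    rstep -> prefix -> seq clause -> Prop :=
| RR_axiom C :
    derived_clause M C -> rrule M P G (RAxiom C) P [:: C]
| RR_reduce C u :
    derived_clause G (u :: C) ->
    u.1 \in univ P ->
    (forall l, l \in C -> l.1 \in exvars P -> u.1 \notin dep P l.1) ->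
    neg u \notin C ->
    rrule M P G (RReduce C u) P [:: C]
| RR_resolve E F x :
    derived_clause G ((x, false) :: E) ->
    derived_clause G ((x, true) :: F) ->
    rrule M P G (RResolve E F x) P [:: E ++ F]
| RR_extend v alpha y1 y2 :
    ext_ok P v alpha [:: y1; y2] ->
    let na := [seq neg l | l <- alpha] in
    rrule M P G (RExtend v alpha y1 y2)
      (add_exis P v (ext_deps P alpha [:: y1; y2]))
      [:: na ++ [:: (v, true); y1];
          na ++ [:: (v, true); y2];
          na ++ [:: (v, false); neg y1; neg y2]]
| RR_weaken w P' :
    weakens P w P' -> rrule M P G (RWeaken w) P' [::].

Definition enc_rstep (s : rstep) : tree :=
  match s with
  | RAxiom C => enc_tagged 0 [:: enc_clause C]
  | RReduce C u => enc_tagged 1 [:: enc_clause C; enc_lit u]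
  | RResolve E F x => enc_tagged 2 [:: enc_clause E; enc_clause F; enc_nat x]
  | RExtend v alpha y1 y2 =>
      enc_tagged 3 [:: enc_nat v; enc_seq enc_lit alpha; enc_lit y1; enc_lit y2]
  | RWeaken w => enc_tagged 4 [:: enc_weakening w]
  end.

Definition R_system : refutation_system :=
  @RefutationSystem (seq rstep) (enc_seq enc_rstep)
    (fun Phi pi => wf_dqbf Phi /\
       refutes (rrule (matrix Phi)) ([::] : clause) (pre Phi) [::] pi).

(** * Propositional formulas and Frege systems *)

Inductive form :=
| FVar (x : nat)
| FFalse
| FTrue
| FNot (A : form)
| FAnd (A B : form)
| FOr (A B : form)
| FImp (A B : form)
| FIff (A B : form).

Lemma form_comparable : comparable form.
Proof. by move=> A B; rewrite /decidable; decide equality; apply: eq_comparable. Qed.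
HB.instance Definition _ := hasDecEq.Build form (compareP form_comparable).

Fixpoint feval (rho : nat -> bool) (A : form) : bool :=
  match A with
  | FVar x => rho x
  | FFalse => false
  | FTrue => true
  | FNot B => ~~ feval rho B
  | FAnd B C => feval rho B && feval rho C
  | FOr B C => feval rho B || feval rho C
  | FImp B C => feval rho B ==> feval rho C
  | FIff B C => feval rho B == feval rho C
  end.

Fixpoint fsubst (sigma : nat -> form) (A : form) : form :=
  match A with
  | FVar x => sigma x
  | FFalse => FFalse
  | FTrue => FTrue
  | FNot B => FNot (fsubst sigma B)
  | FAnd B C => FAnd (fsubst sigma B) (fsubst sigma C)
  | FOr B C => FOr (fsubst sigma B) (fsubst sigma C)
  | FImp B C => FImp (fsubst sigma B) (fsubst sigma C)
  | FIff B C => FIff (fsubst sigma B) (fsubst sigma C)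
  end.

Fixpoint fvars (A : form) : seq nat :=
  match A with
  | FVar x => [:: x]
  | FFalse | FTrue => [::]
  | FNot B => fvars B
  | FAnd B C | FOr B C | FImp B C | FIff B C => fvars B ++ fvars C
  end.

Fixpoint big_and (s : seq form) : form :=
  match s with
  | [::] => FTrue
  | [:: A] => A
  | A :: s' => FAnd A (big_and s')
  end.

Fixpoint big_or (s : seq form) : form :=
  match s with
  | [::] => FFalse
  | [:: A] => A
  | A :: s' => FOr A (big_or s')
  end.

Definition lit_form (l : lit) : form :=
  if l.2 then FVar l.1 else FNot (FVar l.1).
Definition conj_form (ls : seq lit) : form := big_and [seq lit_form l | l <- ls].
Definition disj_form (ls : seq lit) : form := big_or [seq lit_form l | l <- ls].

(* In a rule the variables are metavariables; an axiom has no premises. *)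
Record frule := FRule { premises : seq form; conclusion : form }.

(* Metavariable i is replaced by the i-th formula of [sigma], and by 1 when
   [sigma] is too short. *)
Definition inst (sigma : seq form) (A : form) : form :=
  fsubst (fun i => nth FTrue sigma i) A.

Definition entails (Hs : seq form) (A : form) : Prop :=
  forall rho, (forall H, H \in Hs -> feval rho H) -> feval rho A.

Inductive frege_derives (S : seq frule) (Hs : seq form) : form -> Prop :=
| FD_hyp H : H \in Hs -> frege_derives S Hs H
| FD_rule r sigma :
    r < size S ->
    let R := nth (FRule [::] FTrue) S r in
    (forall A, A \in premises R -> frege_derives S Hs (inst sigma A)) ->
    frege_derives S Hs (inst sigma (conclusion R)).

(* Finitely many sound rules that are implicationally complete. *)
Definition frege_system (S : seq frule) : Prop :=
  (forall r, r < size S ->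
     let R := nth (FRule [::] FTrue) S r in entails (premises R) (conclusion R))
  /\ (forall Hs A, entails Hs A -> frege_derives S Hs A).

(** * The Frege-based system F *)

Inductive fstep :=
| FFrege (r : nat) (sigma : seq form)
| FAxiom (C : clause)
| FExtend (v : nat) (alpha : seq lit) (isand : bool) (Y : seq lit)
| FReduce (L : form) (u : nat) (b : bool)
| FWeaken (w : weakening).

Definition assign_const (u : nat) (b : bool) (L : form) : form :=
  fsubst (fun x => if x == u then (if b then FTrue else FFalse) else FVar x) L.

(* Lines only mention declared variables, so that a variable that is fresh for
   the prefix is also fresh for the derivation. *)
Inductive frule_step (S : seq frule) (M : seq clause)
    (P : prefix) (G : seq form) : fstep -> prefix -> seq form -> Prop :=
| FR_frege r sigma :
    r < size S ->
    let R := nth (FRule [::] FTrue) S r in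
    (forall A, A \in premises R -> inst sigma A \in G) ->
    {subset fvars (inst sigma (conclusion R)) <= declared P} ->
    frule_step S M P G (FFrege r sigma) P [:: inst sigma (conclusion R)]
| FR_axiom C :
    C \in M -> frule_step S M P G (FAxiom C) P [:: disj_form C]
| FR_extend v alpha isand Y :
    ext_ok P v alpha Y ->
    frule_step S M P G (FExtend v alpha isand Y)
      (add_exis P v (ext_deps P alpha Y))
      [:: FImp (conj_form alpha)
            (FIff (FVar v) (if isand then conj_form Y else disj_form Y))]
| FR_reduce L u b :
    L \in G ->
    u \in univ P ->
    (forall x, x \in fvars L -> x \in exvars P -> u \notin dep P x) ->
    frule_step S M P G (FReduce L u b) P [:: assign_const u b L]
| FR_weaken w P' :
    weakens P w P' -> frule_step S M P G (FWeaken w) P' [::].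

Fixpoint enc_form (A : form) : tree :=
  match A with
  | FVar x => enc_tagged 0 [:: enc_nat x]
  | FFalse => enc_tagged 1 [::]
  | FTrue => enc_tagged 2 [::]
  | FNot B => enc_tagged 3 [:: enc_form B]
  | FAnd B C => enc_tagged 4 [:: enc_form B; enc_form C]
  | FOr B C => enc_tagged 5 [:: enc_form B; enc_form C]
  | FImp B C => enc_tagged 6 [:: enc_form B; enc_form C]
  | FIff B C => enc_tagged 7 [:: enc_form B; enc_form C]
  end.

Definition enc_fstep (s : fstep) : tree :=
  match s with
  | FFrege r sigma => enc_tagged 0 [:: enc_nat r; enc_seq enc_form sigma]
  | FAxiom C => enc_tagged 1 [:: enc_clause C]
  | FExtend v alpha isand Y =>
      enc_tagged 2 [:: enc_nat v; enc_seq enc_lit alpha; enc_bool isand;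
                       enc_seq enc_lit Y]
  | FReduce L u b => enc_tagged 3 [:: enc_form L; enc_nat u; enc_bool b]
  | FWeaken w => enc_tagged 4 [:: enc_weakening w]
  end.

Definition F_system (S : seq frule) : refutation_system :=
  @RefutationSystem (seq fstep) (enc_seq enc_fstep)
    (fun Phi pi => wf_dqbf Phi /\
       refutes (frule_step S (matrix Phi)) FFalse (pre Phi) [::] pi).

(* Main.v *)
(* R to F: a clause becomes the disjunction of its literals, and the prefixes of
   both derivations stay equal.  Each step of R is a short sequence of sound
   schematic rules, which have fixed derivations in the complete Frege system.

   F to R: every formula A that occurs is named by an extension variable, a gate
   over the variables of its direct subformulas, so that it depends on the
   variables of A only; a line L becomes the unit clause of its name.  A sound
   schematic rule H1, ..., Hn / C yields the tautology H1 -> ... -> Hn -> C, whose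
   unit clause has a fixed resolution derivation from the gate clauses (resolution
   is complete up to subsumption, and the gate clauses are satisfiable); then
   modus ponens.  For a reduction of L with u := c, the formulas
   u != c \/ (B <-> B[u := c]) follow for all subformulas B of L, which gives the
   clause of u != c and L[u := c], and the name of L[u := c] does not depend on u.
   An empty clause in the matrix is treated apart, since resolution cannot weaken.

   Polynomial time: on trees, the programs are obtained by composition from a
   fold over trees with results of polynomial size and from tree equality. *)

Require Import Defs.
From mathcomp Require Import all_boot.
From Corelib Require Import PosDef.
From HB Require Import structures.
From mathcomp Require Import zify.
Import Defs.

Set Implicit Arguments.
Unset Strict Implicit.
Unset Printing Implicit Defensive.

(** * Programs on trees *)

(** Two needs shape the translations. Derivability is a mere proposition, and a program cannot
    search for derivations; but only finitely many rules are involved, so one derivation with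
    metavariables per rule is fixed beforehand and becomes a constant of the program. [schemas]
    collects these rules; on the way from F to R the rules of the Frege system join the table.

    Names of formulas must be fresh even for variables that later steps of the given refutation
    introduce, and must not depend on the history. So the binary digits of a name spell, from the
    lowest, a prefix code of the formula and then a number beyond all those in the input. Naming is
    injective, and on trees it concatenates bit lists. Each step of F is translated on its own, with
    all definitions that it uses, and repetitions are dropped at the end.

    R has no constants: a fresh z without dependencies and a gate t for the negation of (z and not
    z) give the unit clause t, which serves as 1. Dependency sets in R are only shown to be included
    in those of F, the direction that reduction needs. *)

Fixpoint eqt (a b : tree) : bool :=
  match a, b with
  | Leaf, Leaf => true
  | Node l r, Node l' r' => eqt l l' && eqt r r'
  | _, _ => false
  end.

Lemma eqtP : Equality.axiom eqt.
Proof.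
elim=> [|l IHl r IHr] [|l' r'] /=; try by constructor.
apply: (iffP andP) => [[/IHl-> /IHr->] //|[<- <-]].
by split; [apply/IHl|apply/IHr].
Qed.
HB.instance Definition _ := hasDecEq.Build tree eqtP.

Definition lft (t : tree) : tree := if t is Node l _ then l else Leaf.
Definition rgt (t : tree) : tree := if t is Node _ r then r else Leaf.

Lemma tsize_gt0 t : 0 < tsize t. Proof. by case: t. Qed.
Lemma tsize_lft t : tsize (lft t) <= tsize t. Proof. case: t => //= l r; lia. Qed.
Lemma tsize_rgt t : tsize (rgt t) <= tsize t. Proof. case: t => //= l r; lia. Qed.

(** * Polynomial bounds *)

Definition bnd (c n : nat) : nat := (n + c) ^ c.

(** Monotonicity in both arguments is the reason for the shape of [bnd]: two bounds are brought to a
    common one by adding their constants. *)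
Lemma leq_bnd c c' n n' : c <= c' -> n <= n' -> bnd c n <= bnd c' n'.
Proof.
(* The base vanishes only for n = c = 0, where the value is 0 ^ 0 = 1 and not 0. *)
move=> lc ln; rewrite /bnd; have [E|] := posnP (n + c).
  have -> : c = 0 by lia.
  rewrite expn0; have [->|h] := posnP c'; first by rewrite expn0.
  by rewrite expn_gt0; apply/orP; left; lia.
move=> h; apply: (@leq_trans ((n' + c') ^ c)).
  by case: c lc {h} => [|e] lc; rewrite ?expn0 // leq_exp2r //; apply: leq_add.
by rewrite leq_pexp2l //; lia.
Qed.

Definition poly (q : nat -> nat) : Prop := exists c, forall n, q n <= bnd c n.

Lemma poly_le q q' : (forall n, q n <= q' n) -> poly q' -> poly q.
Proof. by move=> h [c hc]; exists c => n; apply: leq_trans (h n) (hc n). Qed.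

Lemma poly_const k : poly (fun=> k).
Proof.
exists k.+2 => n; rewrite /bnd; have h := @ltn_expl 2 k.+2 isT.
apply: leq_trans (_ : 2 ^ k.+2 <= _); first by rewrite (leq_trans _ (ltnW h)) // ltnW.
by rewrite leq_exp2r //; lia.
Qed.

Lemma poly_id : poly id.
Proof. by exists 1 => n; rewrite /bnd expn1; lia. Qed.

Lemma poly_add q q' : poly q -> poly q' -> poly (fun n => q n + q' n).
Proof.
move=> [a ha] [b hb]; exists (a + b + 2) => n; set m := a + b + 1.
(* One factor is split off from the power: it is at least 2 and so absorbs the sum of two terms,
   each at most the remaining power. *)
have -> : bnd (a + b + 2) n = (n + m.+1) * (n + m.+1) ^ m.
  by rewrite /bnd -expnS; congr (_ ^ _); rewrite /m; lia.
have hm c : c <= m -> bnd c n <= (n + m.+1) ^ m.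
  move=> le_cm; apply: leq_trans (leq_bnd le_cm (leqnn n)) _.
  by rewrite /bnd leq_exp2r; lia.
have := hm a; have := hm b; have := ha n; have := hb n; nia.
Qed.

Lemma poly_mul q q' : poly q -> poly q' -> poly (fun n => q n * q' n).
Proof.
move=> [a ha] [b hb]; exists (a + b) => n.
apply: leq_trans (leq_mul (ha n) (hb n)) _.
rewrite /bnd expnD; apply: leq_mul.
  by case: (a) => [|e]; rewrite ?expn0 ?leq_exp2r //; lia.
by case: (b) => [|e]; rewrite ?expn0 ?leq_exp2r //; lia.
Qed.

Lemma poly_exp q k : poly q -> poly (fun n => q n ^ k).
Proof.
move=> hq; elim: k => [|k IH]; first exact: poly_const.
by apply: (poly_le _ (poly_mul hq IH)) => n; rewrite expnS.
Qed.

Lemma poly_bnd c q : poly q -> poly (fun n => bnd c (q n)).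
Proof. by move=> hq; apply/poly_exp/poly_add => //; apply: poly_const. Qed.

Ltac polyt := repeat first
  [ exact: poly_const | exact: poly_id | apply: poly_add | apply: poly_mul
  | apply: poly_bnd ].

(* Calls out of range evaluate to [Leaf], which relocation would not preserve. *)
Fixpoint calls_lt (n : nat) (e : exp) : bool :=
  match e with
  | EArg | ELeaf => true
  | ENode e1 e2 => calls_lt n e1 && calls_lt n e2
  | ELeft e | ERight e => calls_lt n e
  | EIf e e1 e2 => [&& calls_lt n e, calls_lt n e1 & calls_lt n e2]
  | ECall f e => (f < n) && calls_lt n e
  end.

Definition closed (p : program) : bool := (0 < size p) && all (calls_lt (size p)) p.

(** Needed to place a program behind k other functions in a larger program. *)
Fixpoint reloc (k : nat) (e : exp) : exp :=
  match e with
  | EArg => EArg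
  | ELeaf => ELeaf
  | ENode e1 e2 => ENode (reloc k e1) (reloc k e2)
  | ELeft e => ELeft (reloc k e)
  | ERight e => ERight (reloc k e)
  | EIf e e1 e2 => EIf (reloc k e) (reloc k e1) (reloc k e2)
  | ECall f e => ECall (k + f) (reloc k e)
  end.

Lemma calls_reloc k n m e : k + n <= m -> calls_lt n e -> calls_lt m (reloc k e).
Proof.
move=> le_m; elim: e => //= [e1 IH1 e2 IH2|e IH e1 IH1 e2 IH2|f e IH].
- by case/andP => /IH1-> /IH2->.
- by case/and3P => /IH-> /IH1-> /IH2->.
- case/andP => h /IH->; lia.
Qed.

Lemma evals_reloc p0 p p1 x e v t :
  closed p -> evals p x e v t -> calls_lt (size p) e ->
  evals (p0 ++ map (reloc (size p0)) p ++ p1) x (reloc (size p0) e) v t.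
Proof.
case/andP => _ /(all_nthP ELeaf) cl; elim => {x e v t} /=; try by constructor.
- by move=> x e1 e2 v1 v2 t1 t2 _ IH1 _ IH2 /andP[/IH1 ? /IH2 ?]; constructor.
- by move=> x e v t _ IH /IH ?; constructor.
- by move=> x e v t _ IH /IH ?; constructor.
- move=> x e e1 e2 v w t t' _ IH _ IH' /and3P[/IH h c1 c2].
  by apply: EvIf h _; case: v {IH} IH' => [|l r] IH'; apply: IH'.
- move=> x f e v w t t' _ IH _ IH' /andP[lt_f /IH h].
  apply: EvCall h _.
  rewrite nth_cat ltnNge leq_addr /= addKn nth_cat size_map lt_f.
  by rewrite (nth_map ELeaf) //; apply/IH'/cl.
Qed.

(** * Composition of polynomial-time programs *)

Definition entry (p : program) : exp := nth ELeaf p 0.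

Lemma entry_calls p : closed p -> calls_lt (size p) (entry p).
Proof. by case/andP => h /(all_nthP ELeaf); apply. Qed.

(** A variant of [polytime] that composes: a closed program can be linked into a larger one, and
    bounds of the shape [bnd c] are easily combined. *)
Definition PT (F : tree -> tree) : Prop :=
  exists2 p, closed p & exists c, forall x,
    (exists2 t, evals p x (entry p) (F x) t & t <= bnd c (tsize x))
    /\ tsize (F x) <= bnd c (tsize x).

Lemma PT_ext F G : F =1 G -> PT F -> PT G.
Proof. by move=> E [p cp [c h]]; exists p => //; exists c => x; rewrite -E. Qed.

Lemma PT_intro (F : tree -> tree) p (qt qs : nat -> nat) :
  closed p -> poly qt -> poly qs ->
  (forall x, (exists2 t, evals p x (entry p) (F x) t & t <= qt (tsize x))
     /\ tsize (F x) <= qs (tsize x)) -> PT F.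
Proof.
move=> cp [a ha] [b hb] h; exists p => //; exists (a + b) => x.
have [[t et lt] ls] := h x; split.
  exists t => //; apply: leq_trans lt _; apply: leq_trans (ha _) _.
  by apply: leq_bnd; rewrite ?leq_addr.
apply: leq_trans ls _; apply: leq_trans (hb _) _.
by apply: leq_bnd; rewrite ?leq_addl.
Qed.

(** In the body b, [ECall 1] enters p1 and [ECall (size p1).+1] enters p2. *)
Definition link (b : exp) (p1 p2 : program) : program :=
  [:: b] ++ map (reloc 1) p1 ++ map (reloc (size p1).+1) p2.

Lemma size_link b p1 p2 : size (link b p1 p2) = (size p1 + size p2).+1.
Proof. by rewrite /= size_cat !size_map. Qed.

Lemma closed_link b p1 p2 :
  closed p1 -> closed p2 -> calls_lt (size p1 + size p2).+1 b ->
  closed (link b p1 p2).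
Proof.
case/andP => _ h1 /andP[_ h2] hb.
apply/andP; split; rewrite ?size_link //= hb /= all_cat !all_map.
apply/andP; split.
  by move: h1; apply: sub_all => e ce; apply: calls_reloc ce; lia.
by move: h2; apply: sub_all => e ce; apply: calls_reloc ce; lia.
Qed.

Lemma link_fst b p1 p2 x v t :
  closed p1 -> evals p1 x (entry p1) v t ->
  evals (link b p1 p2) x (nth ELeaf (link b p1 p2) 1) v t.
Proof.
move=> cl ev; have := evals_reloc [:: b] (map (reloc (size p1).+1) p2) cl ev (entry_calls cl).
rewrite /link /= nth_cat size_map; case/andP: (cl) => -> _.
by rewrite (nth_map ELeaf) //; case/andP: cl.
Qed.

Lemma link_snd b p1 p2 x v t :
  closed p2 -> evals p2 x (entry p2) v t ->
  evals (link b p1 p2) x (nth ELeaf (link b p1 p2) (size p1).+1) v t.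
Proof.
move=> cl ev; have := evals_reloc (b :: map (reloc 1) p1) [::] cl ev (entry_calls cl).
rewrite cats0 /link /= nth_cat size_map ltnn subnn.
by rewrite (nth_map ELeaf) //; case/andP: cl.
Qed.

Lemma PT_id : PT id.
Proof.
apply: (@PT_intro _ [:: EArg] (fun=> 1) id) => //; try polyt.
by move=> x; split => //; exists 1 => //; constructor.
Qed.

Lemma PT_comp F G : PT F -> PT G -> PT (F \o G).
Proof.
move=> [p cp [a hF]] [q cq [b hG]].
apply: (@PT_intro _ (link (ECall 1 (ECall (size p).+1 EArg)) p q)
  (fun n => 1 + bnd b n + bnd a (bnd b n) + 2) (fun n => bnd a (bnd b n))).
- by apply: closed_link => //=; move: cp cq => /andP[? _] /andP[? _]; lia.
- by polyt.
- by polyt.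
move=> x; have [[t et lt] ls] := hG x; have [[t' et' lt'] ls'] := hF (G x).
have le_a : bnd a (tsize (G x)) <= bnd a (bnd b (tsize x)) by apply: leq_bnd.
split; last exact: leq_trans ls' le_a.
exists ((1 + t).+1 + t').+1; last lia.
apply: EvCall; last exact: (link_fst _ _ cp et').
by apply: EvCall; [constructor|exact: (link_snd _ _ cq et)].
Qed.

Lemma PT_node F G : PT F -> PT G -> PT (fun x => Node (F x) (G x)).
Proof.
move=> [p cp [a hF]] [q cq [b hG]].
apply: (@PT_intro _ (link (ENode (ECall 1 EArg) (ECall (size p).+1 EArg)) p q)
  (fun n => bnd a n + bnd b n + 5) (fun n => bnd a n + bnd b n + 1)).
- by apply: closed_link => //=; move: cp cq => /andP[? _] /andP[? _]; lia.
- by polyt.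
- by polyt.
move=> x; have [[t et lt] ls] := hG x; have [[t' et' lt'] ls'] := hF x.
split; last by rewrite /=; lia.
exists ((1 + t').+1 + (1 + t).+1).+1; last lia.
apply: EvNode; (apply: EvCall; first by constructor).
  exact: (link_fst _ _ cp et').
exact: (link_snd _ _ cq et).
Qed.

Lemma PT_base F e :
  calls_lt 1 e -> (exists k, forall x, (exists2 t, evals [:: e] x e (F x) t & t <= k)
    /\ tsize (F x) <= tsize x + k) -> PT F.
Proof.
move=> ce [k h]; apply: (@PT_intro _ [:: e] (fun=> k) (fun n => n + k)); try polyt.
  by rewrite /closed /= ce.
exact: h.
Qed.

Lemma PT_const t : PT (fun=> t).
Proof.
elim: t => [|l IHl r IHr]; last exact: PT_node IHl IHr.
apply: (@PT_base _ ELeaf) => //; exists 1 => x; split; last by rewrite /=; lia.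
by exists 1 => //; constructor.
Qed.

Lemma PT_lft : PT lft.
Proof.
apply: (@PT_base _ (ELeft EArg)) => //; exists 2 => x.
split; last by have := tsize_lft x; lia.
by exists 2 => //; apply: (@EvLeft _ x EArg x 1); constructor.
Qed.

Lemma PT_rgt : PT rgt.
Proof.
apply: (@PT_base _ (ERight EArg)) => //; exists 2 => x.
split; last by have := tsize_rgt x; lia.
by exists 2 => //; apply: (@EvRight _ x EArg x 1); constructor.
Qed.

Definition isnode (t : tree) : bool := if t is Node _ _ then true else false.

Lemma PT_if F G H : PT F -> PT G -> PT H ->
  PT (fun x => if isnode (F x) then G x else H x).
Proof.
move=> hF hG hH.
(* Condition and both branches are all computed and [sel] picks from the triple. This only adds up
   the costs, and avoids linking three programs. *)
pose sel t := if isnode (lft t) then lft (rgt t) else rgt (rgt t).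
have hsel : PT sel.
  apply: (@PT_base _ (EIf (ELeft EArg) (ELeft (ERight EArg)) (ERight (ERight EArg)))) => //.
  exists 6 => x; split.
    exists (2 + 3).+1 => //; rewrite /sel.
    apply: (@EvIf _ _ _ _ _ (lft x)); first by apply: (@EvLeft _ x EArg x 1); constructor.
    have ev : evals
        [:: EIf (ELeft EArg) (ELeft (ERight EArg)) (ERight (ERight EArg))]
        x (ERight EArg) (rgt x) 2 by apply: (@EvRight _ x EArg x 1); constructor.
    by case: (lft x) => [|l r] /=; [apply: EvRight ev|apply: EvLeft ev].
  rewrite /sel; have := tsize_rgt x; have := tsize_rgt (rgt x); have := tsize_lft (rgt x).
  by case: isnode; lia.
apply: PT_ext (PT_comp hsel (PT_node hF (PT_node hG hH))) => x.
by rewrite /sel /=; case: isnode.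
Qed.

(** * Structural recursion on trees and tree equality *)

Fixpoint tfold (F : tree -> tree) (p t : tree) : tree :=
  F (Node p (Node t (if t is Node l r then Node (tfold F p l) (tfold F p r)
                     else Node Leaf Leaf))).

(** Function 0 is the recursion, on the pair of p and t, and function 1 is the step function F once
    the body is linked with its program. *)
Definition tfold_body : exp :=
  let p := ELeft EArg in let t := ERight EArg in
  ECall 1 (ENode p (ENode t
    (EIf t (ENode (ECall 0 (ENode p (ELeft t))) (ECall 0 (ENode p (ERight t))))
           (ENode ELeaf ELeaf)))).

(** F is called once per node of t. A polynomial F alone would not do, since iterating it may blow
    up the sizes; the bound q on the values of the fold, which holds at all subtrees too, keeps each
    argument of F polynomial. *)
Lemma PT_tfold F q : PT F -> poly q ->
  (forall p t, tsize (tfold F p t) <= q (tsize p + tsize t)) ->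
  PT (fun x => tfold F (lft x) (rgt x)).
Proof.
move=> [pF cF [c hF]] [d hq] hs.
(* The cost per node: the argument of F consists of p, a subtree and two results of size at most
   [bnd d n]; 40 covers the steps of the body around the call. *)
pose K n := bnd c (n + n + 3 + bnd d n + bnd d n) + 40.
apply: (@PT_intro _ (link tfold_body pF [:: ELeaf]) (fun n => (n + n) * K (n + n))
   (fun n => bnd d (n + n))); try by rewrite /K; polyt.
  by apply: closed_link => //=; move: cF => /andP[? _]; lia.
move=> x.
have le_n : tsize (lft x) + tsize (rgt x) <= tsize x + tsize x.
  by apply: leq_add; [apply: tsize_lft|apply: tsize_rgt].
split; last first.
  apply: leq_trans (hs _ _) _; apply: leq_trans (hq _) _; exact: leq_bnd.
(* Stated for every y with these components, because the initial argument may be [Leaf] instead of a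
   pair. *)
suff ev p t n : tsize p + tsize t <= n -> forall y, lft y = p -> rgt y = t ->
    exists2 s, evals (link tfold_body pF [:: ELeaf]) y tfold_body (tfold F p t) s
      & s <= tsize t * K n.
  have [s es ls] := ev _ _ _ le_n x erefl erefl; exists s => //.
  apply: leq_trans ls _; apply: leq_mul => //.
  exact: leq_trans (tsize_rgt x) (leq_addr _ _).
have bF l p' : tsize p' + tsize l <= n -> tsize (tfold F p' l) <= bnd d n.
  by move=> h; apply: leq_trans (hs _ _) _; apply: leq_trans (hq _) _; apply: leq_bnd.
set pr := link _ _ _.
have evp y : evals pr y (ELeft EArg) (lft y) 2 by apply: (@EvLeft _ y EArg y 1); constructor.
have evt y : evals pr y (ERight EArg) (rgt y) 2 by apply: (@EvRight _ y EArg y 1); constructor.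
have fin y w s' :
    evals pr y (EIf (ERight EArg) (ENode (ECall 0 (ENode (ELeft EArg) (ELeft (ERight EArg)))) (ECall 0 (ENode (ELeft EArg) (ERight (ERight EArg)))))
           (ENode ELeaf ELeaf)) w s' ->
    tsize (lft y) + tsize (rgt y) <= n -> tsize w <= bnd d n + bnd d n + 1 ->
    exists2 s, evals pr y tfold_body (F (Node (lft y) (Node (rgt y) w))) s & s <= s' + 8 + bnd c (n + n + 3 + bnd d n + bnd d n).
  move=> ew ly lw; have [[s es ls] _] := hF (Node (lft y) (Node (rgt y) w)).
  exists ((2 + (2 + s').+1).+1 + s).+1.
    apply: EvCall; last exact: (link_fst _ _ cF es).
    by do 2 (apply: EvNode => //).
  have : bnd c (tsize (Node (lft y) (Node (rgt y) w))) <= bnd c (n + n + 3 + bnd d n + bnd d n).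
    by apply: leq_bnd => //=; lia.
  by lia.
elim: t => [|l IHl r IHr] le_pt y yp yt.
  have := fin y (Node Leaf Leaf) 6; rewrite yp yt => -[|//|/=|s es ls].
  - apply: (@EvIf _ _ _ _ _ (rgt y) _ 2 3) => //; rewrite yt.
    by apply: (@EvNode _ _ _ _ _ _ 1 1); constructor.
  - by have := bF _ _ le_pt; have := tsize_gt0 (tfold F p Leaf); lia.
  by exists s => //; rewrite /K /=; lia.
move: le_pt => /= le_pt.
have [|s1 e1 l1] := IHl _ (Node p l) erefl erefl; first by lia.
have [|s2 e2 l2] := IHr _ (Node p r) erefl erefl; first by lia.
have := fin y (Node (tfold F p l) (tfold F p r))
  (2 + ((((2 + 3).+1 + s1).+1) + (((2 + 3).+1 + s2).+1)).+1).+1.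
rewrite yp yt => -[||/=|s es ls].
- apply: EvIf => //; rewrite yt.
  apply: EvNode; (apply: EvCall; [apply: EvNode|eassumption]); rewrite -?yp //.
    by have := EvLeft (evt y); rewrite yt.
  by have := EvRight (evt y); rewrite yt.
- by rewrite /=; lia.
- by have := bF l p; have := bF r p; lia.
exists s => //; rewrite /= mulSn mulnDl; move: l1 l2 ls; rewrite /K.
by set u := bnd c _; set v1 := _ * _; set v2 := _ * _; lia.
Qed.

Definition tbool (b : bool) : tree := if b then Node Leaf Leaf else Leaf.

(** The recursion descends in both arguments at once, which [tfold] with its fixed parameter does
    not do directly; hence a program of its own, with at most one call per node of the first
    tree. *)
Lemma PT_eqt : PT (fun x => tbool (eqt (lft x) (rgt x))).
Proof.
pose cl f := ECall 0 (ENode (f (ELeft EArg)) (f (ERight EArg))).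
pose one := ENode ELeaf ELeaf.
pose body := EIf (ELeft EArg)
   (EIf (ERight EArg) (EIf (cl ELeft) (cl ERight) ELeaf) ELeaf)
   (EIf (ERight EArg) ELeaf one).
apply: (@PT_intro _ [:: body] (fun n => 40 * n) (fun=> 3)); try polyt; first by [].
move=> x; split; last by case: eqt.
suff ev a y : lft y = a -> exists2 s, evals [:: body] y body (tbool (eqt a (rgt y))) s
      & s <= 40 * tsize a.
  have [s es ls] := ev _ x erefl; exists s => //.
  by have := tsize_lft x; lia.
have evp z : evals [:: body] z (ELeft EArg) (lft z) 2 by apply: (@EvLeft _ z EArg z 1); constructor.
have evt z : evals [:: body] z (ERight EArg) (rgt z) 2 by apply: (@EvRight _ z EArg z 1); constructor.
have evl z : evals [:: body] z ELeaf Leaf 1 by constructor.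
elim: a y => [|l IHl r IHr] y ya.
  case E: (rgt y) => [|l r].
    exists (2 + (2 + 3).+1).+1 => //.
    apply: (EvIf (evp y)); rewrite ya; apply: (EvIf (evt y)); rewrite E.
    by apply: (@EvNode _ _ _ _ _ _ 1 1).
  exists (2 + (2 + 1).+1).+1 => //.
  by apply: (EvIf (evp y)); rewrite ya; apply: (EvIf (evt y)); rewrite E.
case E: (rgt y) => [|l' r'].
  exists (2 + (2 + 1).+1).+1; last by rewrite /=; lia.
  by apply: (EvIf (evp y)); rewrite ya; apply: (EvIf (evt y)); rewrite E.
have [s1 e1 l1] := IHl (Node l l') erefl.
have [s2 e2 l2] := IHr (Node r r') erefl.
have c1 : evals [:: body] y (cl ELeft) (tbool (eqt l l')) ((3 + 3).+1 + s1).+1.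
  apply: EvCall; last exact: e1.
  by apply: EvNode; [have := EvLeft (evp y); rewrite ya|have := EvLeft (evt y); rewrite E].
have c2 : evals [:: body] y (cl ERight) (tbool (eqt r r')) ((3 + 3).+1 + s2).+1.
  apply: EvCall; last exact: e2.
  by apply: EvNode; [have := EvRight (evp y); rewrite ya|have := EvRight (evt y); rewrite E].
move=> /=; case: (eqt l l') c1 => c1 /=.
  exists (2 + (2 + (((3 + 3).+1 + s1).+1 + ((3 + 3).+1 + s2).+1).+1).+1).+1; last by lia.
  apply: (EvIf (evp y)); rewrite ya; apply: (EvIf (evt y)); rewrite E.
  exact: (EvIf c1).
exists (2 + (2 + (((3 + 3).+1 + s1).+1 + 1).+1).+1).+1; last by lia.
apply: (EvIf (evp y)); rewrite ya; apply: (EvIf (evt y)); rewrite E.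
exact: (EvIf c1).
Qed.

Lemma PT_polytime F : PT F -> polytime F.
Proof.
move=> [p _ [c h]].
(* For n >= 2, (n + c) ^ c <= n ^ c * (c + 1) ^ c, and the constant factor is below n to the power
   (c + 1) ^ c. For n = 1 the value (c + 1) ^ c is covered by the summand k. Trees have positive
   size. *)
pose k := c + c.+1 ^ c.
have le_k n : 0 < n -> bnd c n <= n ^ k + k.
  move=> n0; have [|n1] := leqP n 1.
    move=> le1; have -> : n = 1 by lia.
    by rewrite /bnd /k exp1n; have -> : 1 + c = c.+1 by []; lia.
  apply: leq_trans (leq_addr _ _); apply: (@leq_trans ((n * c.+1) ^ c)).
    by case: (c) => [|e]; rewrite ?expn0 // leq_exp2r //; nia.
  rewrite expnMn /k expnD leq_mul2l; apply/orP; right.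
  by apply: ltnW; apply: ltn_expl.
exists p, k => x; have [[t et lt] ls] := h x; split.
  by exists t => //; apply: leq_trans lt _; apply/le_k/tsize_gt0.
by apply: leq_trans ls _; apply/le_k/tsize_gt0.
Qed.

(** * Recursive functions on encoded lists and formulas *)

Lemma PT_app G F : PT G -> PT F -> PT (fun x => G (F x)).
Proof. exact: PT_comp. Qed.

Lemma PT_lfta F : PT F -> PT (fun x => lft (F x)).
Proof. exact/PT_app/PT_lft. Qed.

Lemma PT_rgta F : PT F -> PT (fun x => rgt (F x)).
Proof. exact/PT_app/PT_rgt. Qed.

Lemma PT_ifeq F G H K : PT F -> PT G -> PT H -> PT K ->
  PT (fun x => if eqt (F x) (G x) then H x else K x).
Proof.
move=> hF hG hH hK.
apply: PT_ext (PT_if (PT_app PT_eqt (PT_node hF hG)) hH hK) => x /=.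
by case: eqt.
Qed.

Ltac PTt := repeat first
  [ eassumption | exact: PT_id | exact: PT_const | apply: PT_lfta | apply: PT_rgta
  | apply: PT_ifeq | apply: PT_if | apply: PT_node ].

(** Concatenation of encoded lists with the second list as first argument, since it is the parameter
    of the fold. *)
Fixpoint tapp (p t : tree) : tree := if t is Node x s then Node x (tapp p s) else p.

Lemma tsize_tapp p t : tsize (tapp p t) <= tsize p + tsize t.
Proof. elim: t => //= [|x _ s IH]; lia. Qed.

Lemma PT_tapp F G : PT F -> PT G -> PT (fun x => tapp (F x) (G x)).
Proof.
(* In all step functions h of folds, [lft y] is the parameter, [lft (rgt y)] the current subtree,
   and the components of [rgt (rgt y)] are the results for its children. *)
pose h y := if isnode (lft (rgt y)) then Node (lft (lft (rgt y))) (rgt (rgt (rgt y)))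
            else lft y.
have E p t : tfold h p t = tapp p t by elim: t => //= x _ s ->.
have hh : PT h by rewrite /h; PTt.
move=> hF hG; apply: PT_ext (PT_app (PT_tfold hh poly_id _) (PT_node hF hG)) => [x|p t] /=.
  by rewrite E.
by rewrite E tsize_tapp.
Qed.

(** The tree version of the flat map [ctx]: H receives the parameter and the remaining list, so it
    sees an element together with all later ones. *)
Fixpoint tctx (H : tree -> tree) (p t : tree) : tree :=
  if t is Node x s then tapp (tctx H p s) (H (Node p t)) else Leaf.

Lemma PT_tctx H F G : PT H -> PT F -> PT G -> PT (fun x => tctx H (F x) (G x)).
Proof.
move=> hH hF hG; have [pH clH [c bH]] := hH.
pose h y := if isnode (lft (rgt y))
  then tapp (rgt (rgt (rgt y))) (H (Node (lft y) (lft (rgt y)))) else Leaf.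
have E p t : tfold h p t = tctx H p t by elim: t => //= x _ s ->.
have hh : PT h.
  rewrite /h; apply: PT_if; [by PTt| |by PTt].
  by apply: PT_tapp; [PTt|apply: PT_app => //; PTt].
have b p t n : tsize p + tsize t <= n -> tsize (tctx H p t) <= tsize t * (bnd c n.+1 + 1).
  elim: t => [|x _ s IH] /= le_n; first by lia.
  have le' : tsize p + tsize s <= n by lia.
  apply: leq_trans (tsize_tapp _ _) _; have := IH le'; have := (bH (Node p (Node x s))).2.
  have : bnd c (tsize (Node p (Node x s))) <= bnd c n.+1 by apply: leq_bnd => //=; lia.
  have := tsize_gt0 x; move: {IH le' le_n} (bnd _ _) (bnd _ _) (tsize (H _)) (tsize (tctx _ _ _)) => u v w z h1 h2 h3 h4.
  have : (tsize x + tsize s).+1 * (v + 1) = (v + 1) + tsize x * (v + 1) + tsize s * (v + 1) by rewrite mulSn mulnDl addnA.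
  by lia.
have q : poly (fun n => n * (bnd c (n + 1) + 1)) by polyt.
apply: PT_ext (PT_app (PT_tfold hh q _) (PT_node hF hG)) => [x|p t] /=.
  by rewrite E.
rewrite E; apply: leq_trans (b p t _ (leqnn _)) _.
by apply: leq_mul; [lia|rewrite [tsize p + _ + 1]addn1].
Qed.

(** With tag 4 this is [big_and] and with tag 5 [big_or] on encoded lists of formulas; z encodes the
    value for the empty list. *)
Fixpoint tbig (tag : nat) (z t : tree) : tree :=
  if t is Node x s then
    if isnode s then Node (enc_nat tag) (Node x (Node (tbig tag z s) Leaf)) else x
  else z.

Lemma PT_tbig tag z F : PT F -> PT (fun x => tbig tag z (F x)).
Proof.
pose h y := if isnode (lft (rgt y)) then
  if isnode (rgt (lft (rgt y))) then Node (enc_nat tag)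
    (Node (lft (lft (rgt y))) (Node (rgt (rgt (rgt y))) Leaf))
  else lft (lft (rgt y)) else z.
have E p t : tfold h p t = tbig tag z t by elim: t => //= x _ s ->.
have hh : PT h by rewrite /h; PTt.
pose k := tsize (enc_nat tag) + tsize z + 4.
have b t : tsize (tbig tag z t) <= k * tsize t.
  elim: t => [|x _ s IH] /=; first by rewrite /k; lia.
  have ks : k * (tsize x + tsize s).+1 = k + k * tsize x + k * tsize s by rewrite mulnS mulnDr addnA.
  have kx : tsize x <= k * tsize x by rewrite leq_pmull // /k; lia.
  rewrite ks; move: IH kx; have : tsize (enc_nat tag) + 4 <= k by rewrite /k; lia.
  by case: isnode => /=; move: (k * tsize x) (k * tsize s) (k) => u v w; lia.
have q : poly (fun n => k * n) by polyt.
move=> hF; apply: PT_ext (PT_app (PT_tfold hh q _) (PT_node (PT_const Leaf) hF)) => [x|p t] /=.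
  by rewrite E.
by rewrite E; apply: leq_trans (b t) _; rewrite leq_mul2l leq_addl orbT.
Qed.

(* A formula and a list of arguments cannot be told apart by their trees, so
   both readings are computed: [tsubs] and [tassign] return a pair whose left
   (right) component treats the tree as a formula (as a list of formulas). *)
Fixpoint tsubs (t : tree) : tree :=
  if t is Node l r then
    Node (tapp (Node t Leaf) (if isnode l then rgt (tsubs r) else Leaf))
         (tapp (rgt (tsubs r)) (lft (tsubs l)))
  else Node Leaf Leaf.

Lemma PT_tsubs F : PT F -> PT (fun x => lft (tsubs (F x))).
Proof.
pose h y := if isnode (lft (rgt y)) then
   Node (tapp (Node (lft (rgt y)) Leaf)
           (if isnode (lft (lft (rgt y))) then rgt (rgt (rgt (rgt y))) else Leaf))
        (tapp (rgt (rgt (rgt (rgt y)))) (lft (lft (rgt (rgt y))))) else Node Leaf Leaf.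
have E p t : tfold h p t = tsubs t by elim: t => //= l -> r ->.
have hh : PT h.
  rewrite /h; apply: PT_if; [by PTt| |by PTt].
  by apply: PT_node; apply: PT_tapp; PTt.
have b t : tsize (lft (tsubs t)) <= tsize t * (tsize t + 3)
    /\ tsize (rgt (tsubs t)) <= tsize t * (tsize t + 3).
  elim: t => [|l [IHl IHl'] r [IHr IHr']] //; rewrite [tsubs _]/= [lft _]/= [rgt _]/=.
  have := tsize_gt0 l; have := tsize_gt0 r.
  set t := Node l r; have -> : tsize t = (tsize l + tsize r).+1 by [].
  split; apply: leq_trans (tsize_tapp _ _) _.
    have -> : tsize (Node t Leaf) = (tsize l + tsize r).+3 by rewrite /t /=; lia.
    by case: isnode; [|rewrite [tsize Leaf]/=]; nia.
  by nia.
have q : poly (fun n => n * (n + 3) + n * (n + 3) + 1) by polyt.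
move=> hF; apply: PT_ext (PT_lfta (PT_app (PT_tfold hh q _) (PT_node (PT_const Leaf) hF))) => [x|p t].
  by rewrite E.
rewrite E; have [b1 b2] := b t.
have -> : tsubs t = Node (lft (tsubs t)) (rgt (tsubs t)) by case: (t).
have : tsize t * (tsize t + 3) <= (tsize p + tsize t) * (tsize p + tsize t + 3).
  by apply: leq_mul; lia.
by rewrite /=; lia.
Qed.

(** Here p pairs an encoded variable with the constant that replaces it. Variables have tag 0, which
    is encoded by [Leaf], so [isnode l] separates them from all other formulas, as in [tsubs]. *)
Fixpoint tassign (p t : tree) : tree :=
  if t is Node l r then
    Node (if isnode l then Node l (rgt (tassign p r))
          else if eqt t (lft p) then rgt p else t)
         (Node (lft (tassign p l)) (rgt (tassign p r)))
  else Node Leaf Leaf.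

Lemma PT_tassign F G : PT F -> PT G -> PT (fun x => lft (tassign (F x) (G x))).
Proof.
pose h y := if isnode (lft (rgt y)) then
   Node (if isnode (lft (lft (rgt y))) then Node (lft (lft (rgt y))) (rgt (rgt (rgt (rgt y))))
         else if eqt (lft (rgt y)) (lft (lft y)) then rgt (lft y) else lft (rgt y))
        (Node (lft (lft (rgt (rgt y)))) (rgt (rgt (rgt (rgt y))))) else Node Leaf Leaf.
have E p t : tfold h p t = tassign p t by elim: t => //= l -> r ->.
have hh : PT h by rewrite /h; PTt.
have b p t : tsize (lft (tassign p t)) <= tsize t * (tsize p + 1)
    /\ tsize (rgt (tassign p t)) <= tsize t * (tsize p + 1).
  elim: t => [|l [IHl IHl'] r [IHr IHr']]; first by rewrite /=; lia.
  rewrite [tassign _ _]/= [lft (Node _ _)]/= [rgt (Node _ _)]/=.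
  have := tsize_gt0 l; have := tsize_gt0 r; have := tsize_rgt p.
  move=> hp hr hl; set k := tsize p + 1.
  have -> : tsize (Node l r) * k = k + tsize l * k + tsize r * k.
    by rewrite /= mulSn mulnDl addnA.
  have lk : tsize l <= tsize l * k by rewrite leq_pmulr // /k; lia.
  have rk : tsize r <= tsize r * k by rewrite leq_pmulr // /k; lia.
  split; last by rewrite /=; move: IHl IHr'; rewrite -/k; lia.
  case: isnode => /=; first by move: IHr'; rewrite -/k; lia.
  by case: ifP => _ /=; rewrite /k; lia.
have q : poly (fun n => n * (n + 1) + n * (n + 1) + 1) by polyt.
move=> hF hG; apply: PT_ext (PT_lfta (PT_app (PT_tfold hh q _) (PT_node hF hG))) => [x|p t].
  by rewrite E.
rewrite E; have [b1 b2] := b p t.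
have -> : tassign p t = Node (lft (tassign p t)) (rgt (tassign p t)) by case: (t).
have : tsize t * (tsize p + 1) <= (tsize p + tsize t) * (tsize p + tsize t + 1).
  by apply: leq_mul; lia.
by rewrite /=; lia.
Qed.

(** The preorder bit string of a tree, 1 for a node and 0 for a leaf, in the bit format of
    [enc_nat]. Put in front of the digits of n it encodes [code t n], see [enc_code]. *)
Fixpoint tbits (t : tree) : tree :=
  if t is Node l r then Node (Node Leaf Leaf) (tapp (tbits r) (tbits l))
  else Node Leaf Leaf.

Lemma PT_tbits F : PT F -> PT (fun x => tbits (F x)).
Proof.
pose h y := if isnode (lft (rgt y)) then
   Node (Node Leaf Leaf) (tapp (rgt (rgt (rgt y))) (lft (rgt (rgt y)))) else Node Leaf Leaf.
have E p t : tfold h p t = tbits t by elim: t => //= l -> r ->.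
have hh : PT h.
  rewrite /h; apply: PT_if; [by PTt| |by PTt].
  by apply: PT_node; [PTt|apply: PT_tapp; PTt].
have b t : (tsize (tbits t)).+1 <= 4 * tsize t.
  elim: t => [|l IHl r IHr] //=; have := tsize_tapp (tbits r) (tbits l); lia.
have q : poly (fun n => 4 * n) by polyt.
move=> hF; apply: PT_ext (PT_app (PT_tfold hh q _) (PT_node (PT_const Leaf) hF)) => [x|p t] /=.
  by rewrite E.
rewrite E; have := b t; lia.
Qed.

(** * Polynomial time on encoded data *)

Lemma enc_nat_pos m : enc_nat (nat_of_pos m) = enc_pos m.
Proof.
rewrite /enc_nat; have -> : bin_of_nat (nat_of_pos m) = Npos m by exact: (nat_of_binK (Npos m)).
by [].
Qed.

Lemma nat_pos n : 0 < n -> exists m, n = nat_of_pos m.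
Proof.
move=> n0; have := bin_of_natK n; case: (bin_of_nat n) => [|m] /= E; first by rewrite -E in n0.
by exists m.
Qed.

(** Positivity matters: for n = 0 the right-hand side would be the encoding of 1. *)
Lemma enc_nat_double n : 0 < n -> enc_nat n.*2 = Node Leaf (enc_nat n).
Proof.
case/nat_pos => m ->; rewrite enc_nat_pos.
by have -> : (nat_of_pos m).*2 = nat_of_pos (xO m); rewrite ?enc_nat_pos //= NatTrec.doubleE.
Qed.

Lemma enc_nat_doubleS n : 0 < n -> enc_nat n.*2.+1 = Node (Node Leaf Leaf) (enc_nat n).
Proof.
case/nat_pos => m ->; rewrite enc_nat_pos.
by have -> : (nat_of_pos m).*2.+1 = nat_of_pos (xI m); rewrite ?enc_nat_pos //= NatTrec.doubleE.
Qed.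

Lemma enc_pos_inj : injective enc_pos.
Proof.
have nl m : enc_pos m = Leaf -> False by case: m.
by elim=> [m IH|m IH|] [m'|m'|] //= E; case: E => // E;
  first [rewrite (IH _ E) | case: (nl _ E) | case: (nl _ (esym E))].
Qed.

Lemma enc_nat_inj : injective enc_nat.
Proof.
have nl m : enc_pos m = Leaf -> False by case: m.
move=> m n; rewrite /enc_nat => E; apply: (can_inj bin_of_natK).
by case: (bin_of_nat m) (bin_of_nat n) E => [|p] [|q] //
  => [E|E|/enc_pos_inj->//]; [case: (nl _ (esym E))|case: (nl _ E)].
Qed.

(** With [code_ge] this puts [code t 1] above every number whose encoding is no larger than t;
    freshness of names rests on it. *)
Lemma ltn_enc_nat n : n < 2 ^ tsize (enc_nat n).
Proof.
have [->//|/nat_pos[m ->]] := posnP n; rewrite enc_nat_pos.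
elim: m => [m IH|m IH|] //=; rewrite ?NatTrec.doubleE !expnS ?expn0; move: IH; set k := 2 ^ _; lia.
Qed.

(* The number whose binary digits, from the lowest, spell a prefix code of [t] and then [n]. *)
Fixpoint code (t : tree) (n : nat) : nat :=
  if t is Node l r then (code l (code r n)).*2.+1 else n.*2.

Lemma code_ge t n : 2 ^ tsize t * n <= code t n.
Proof.
elim: t n => [|l IHl r IHr] n /=; first by rewrite expn1; lia.
apply: leq_trans (_ : 2 * (2 ^ tsize l * (2 ^ tsize r * n)) <= _).
  by rewrite expnS expnD !mulnA.
have := IHr n; have := IHl (code r n); set a := 2 ^ tsize l; set b := 2 ^ tsize r * n.
move=> h1 h2; have : a * b <= a * code r n by rewrite leq_mul2l h2 orbT.
by lia.
Qed.

Lemma code_gt0 t n : 0 < n -> 0 < code t n.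
Proof. by move=> n0; apply: leq_trans (code_ge t n); rewrite muln_gt0 expn_gt0 n0. Qed.

(** The parity of the number tells a node from a leaf, and the code is prefix-free, so the parts can
    be read off one after the other. *)
Lemma code_inj2 t t' n n' : code t n = code t' n' -> t = t' /\ n = n'.
Proof.
elim: t t' n n' => [|l IHl r IHr] [|l' r'] n n' /=; try by lia.
- by move=> h; split => //; lia.
- move=> h; have /IHl[-> /IHr[-> ->]] // : code l (code r n) = code l' (code r' n') by lia.
Qed.

Lemma tapp_assoc a b c : tapp a (tapp b c) = tapp (tapp a b) c.
Proof. by elim: c => //= x _ s ->. Qed.

Lemma enc_code t n : 0 < n -> enc_nat (code t n) = tapp (enc_nat n) (tbits t).
Proof.
elim: t n => [|l IHl r IHr] n n0 /=; first by rewrite enc_nat_double.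
by rewrite enc_nat_doubleS ?code_gt0 // IHl ?code_gt0 // IHr // tapp_assoc.
Qed.

(** Polynomial time for functions on data instead of trees. The lemmas below follow the syntax of
    function bodies, so that [ptt] can work by structure. *)
Definition pt A B (eA : A -> tree) (eB : B -> tree) (f : A -> B) : Prop :=
  exists2 F, PT F & forall a, F (eA a) = eB (f a).

Lemma pt_ext A B (eA : A -> tree) (eB : B -> tree) f g : f =1 g -> pt eA eB f -> pt eA eB g.
Proof. by move=> E [F hF h]; exists F => // a; rewrite h E. Qed.

Lemma pt_const A (eA : A -> tree) B (eB : B -> tree) b : pt eA eB (fun=> b).
Proof. by exists (fun=> eB b) => //; apply: PT_const. Qed.

Section Basic.
Context (A : Type) (eA : A -> tree).

Lemma pt_id : pt eA eA (fun a => a).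
Proof. by exists id => //; apply: PT_id. Qed.

Lemma pt_app B C (eB : B -> tree) (eC : C -> tree) g f :
  pt eB eC g -> pt eA eB f -> pt eA eC (fun a => g (f a)).
Proof.
by move=> [G hG g_] [F hF f_]; exists (G \o F) => [|a]; [apply: PT_comp|rewrite /= f_ g_].
Qed.

Lemma pt_pair B C (eB : B -> tree) (eC : C -> tree) f g :
  pt eA eB f -> pt eA eC g -> pt eA (enc_pair eB eC) (fun a => (f a, g a)).
Proof.
move=> [F hF f_] [G hG g_]; exists (fun x => Node (F x) (G x)) => [|a].
  exact: PT_node.
by rewrite f_ g_.
Qed.

Lemma pt_fst B C (eB : B -> tree) (eC : C -> tree) f :
  pt eA (enc_pair eB eC) f -> pt eA eB (fun a => (f a).1).
Proof. by move=> [F hF f_]; exists (fun x => lft (F x)) => [|a]; [PTt|rewrite f_]. Qed.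

Lemma pt_snd B C (eB : B -> tree) (eC : C -> tree) f :
  pt eA (enc_pair eB eC) f -> pt eA eC (fun a => (f a).2).
Proof. by move=> [F hF f_]; exists (fun x => rgt (F x)) => [|a]; [PTt|rewrite f_]. Qed.

Lemma pt_if B (eB : B -> tree) c f g :
  pt eA enc_bool c -> pt eA eB f -> pt eA eB g -> pt eA eB (fun a => if c a then f a else g a).
Proof.
move=> [H hH h_] [F hF f_] [G hG g_].
exists (fun x => if isnode (H x) then F x else G x) => [|a]; first by PTt.
by rewrite h_ f_ g_; case: (c a).
Qed.

Lemma pt_eq (B : eqType) (eB : B -> tree) f g : injective eB ->
  pt eA eB f -> pt eA eB g -> pt eA enc_bool (fun a => f a == g a).
Proof.
move=> inj [F hF f_] [G hG g_].
exists (fun x => if eqt (F x) (G x) then Node Leaf Leaf else Leaf) => [|a]; first by PTt.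
rewrite f_ g_; have [->|ne] := eqVneq (f a) (g a); first by rewrite (introT (eqtP _ _)).
by case: eqtP => // /inj E; rewrite E eqxx in ne.
Qed.

Lemma pt_cons B (eB : B -> tree) f g :
  pt eA eB f -> pt eA (enc_seq eB) g -> pt eA (enc_seq eB) (fun a => f a :: g a).
Proof.
move=> [F hF f_] [G hG g_]; exists (fun x => Node (F x) (G x)) => [|a].
  exact: PT_node.
by rewrite f_ g_.
Qed.

Lemma pt_seq_case B C (eB : B -> tree) (eC : C -> tree) s f g :
  pt eA (enc_seq eB) s -> pt eA eC f ->
  pt (enc_pair eA (enc_pair eB (enc_seq eB))) eC (fun q => g q.1 q.2.1 q.2.2) ->
  pt eA eC (fun a => match s a with [::] => f a | x :: s' => g a x s' end).
Proof.
move=> [H hH h_] [F hF f_] [G hG g_].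
exists (fun x => if isnode (H x) then G (Node x (H x)) else F x) => [|a].
  by apply: PT_if => //; apply: PT_app => //; PTt.
rewrite h_ f_; case: (s a) => [|x s'] //=.
exact: (g_ (a, (x, s'))).
Qed.

Lemma pt_nilp B (eB : B -> tree) s :
  pt eA (enc_seq eB) s -> pt eA enc_bool (fun a => nilp (s a)).
Proof.
move=> hs; apply: pt_ext (pt_seq_case hs (pt_const _ enc_bool true) (pt_const _ enc_bool false)) => a /=.
by case: (s a).
Qed.

Lemma pt_neg f : pt eA enc_bool f -> pt eA enc_bool (fun a => ~~ f a).
Proof.
move=> hf; apply: pt_ext (pt_if hf (pt_const _ enc_bool false) (pt_const _ enc_bool true)) => a /=.
by case: (f a).
Qed.

Lemma pt_and f g : pt eA enc_bool f -> pt eA enc_bool g -> pt eA enc_bool (fun a => f a && g a).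
Proof.
move=> hf hg; have h := pt_if hf hg (pt_const _ enc_bool false).
by apply: pt_ext h => a; case: (f a).
Qed.

End Basic.

Lemma enc_cat A (e : A -> tree) s1 s2 : enc_seq e (s1 ++ s2) = tapp (enc_seq e s2) (enc_seq e s1).
Proof. by elim: s1 => //= x s ->. Qed.

(** The steps made for a disjunct or a conjunct mention the [big_or] or [big_and] of the later ones,
    hence a flat map that also sees the tail. *)
Fixpoint ctx A B (h : A -> seq A -> seq B) (s : seq A) : seq B :=
  if s is x :: s' then h x s' ++ ctx h s' else [::].

Fixpoint rctx A B (h : A -> seq A -> seq B) (s : seq A) : seq B :=
  if s is x :: s' then rctx h s' ++ h x s' else [::].

(** d holds the elements passed so far, the latest first: for a derivation, the history of a
    step. *)
Fixpoint pctx A B (h : seq A -> A -> seq B) (d s : seq A) : seq B :=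
  if s is x :: s' then h d x ++ pctx h (x :: d) s' else [::].

(** What precedes an element in s follows it in the reversed list, so the history becomes a tail
    there. *)
Lemma pctxE A B (h : seq A -> A -> seq B) d s :
  pctx h d s = rctx (fun x t => h (t ++ d) x) (rev s).
Proof.
elim/last_ind: s d => [|s x IH] d //; rewrite rev_rcons /= -IH {IH}.
suff -> : forall s d, pctx h d (rcons s x) = pctx h d s ++ h (rev s ++ d) x by [].
elim=> [|y t IH] {}d /=; first by rewrite cats0.
by rewrite IH rev_cons cat_rcons catA.
Qed.

Section Lists.
Context (A : Type) (eA : A -> tree).

Lemma pt_cat B (eB : B -> tree) f g :
  pt eA (enc_seq eB) f -> pt eA (enc_seq eB) g -> pt eA (enc_seq eB) (fun a => f a ++ g a).
Proof.
move=> [F hF f_] [G hG g_]; exists (fun x => tapp (G x) (F x)) => [|a].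
  exact: PT_tapp.
by rewrite f_ g_ enc_cat.
Qed.

Lemma pt_ctx B C (eB : B -> tree) (eC : C -> tree) s h :
  pt eA (enc_seq eB) s ->
  pt (enc_pair eA (enc_pair eB (enc_seq eB))) (enc_seq eC) (fun q => h q.1 q.2.1 q.2.2) ->
  pt eA (enc_seq eC) (fun a => ctx (h a) (s a)).
Proof.
move=> [F hF f_] [H hH h_]; exists (fun x => tctx H x (F x)) => [|a].
  by apply: PT_tctx => //; apply: PT_id.
rewrite f_; elim: (s a) => //= x s' ->; rewrite enc_cat.
by congr tapp; apply: (h_ (a, (x, s'))).
Qed.

Lemma pt_rev B (eB : B -> tree) s :
  pt eA (enc_seq eB) s -> pt eA (enc_seq eB) (fun a => rev (s a)).
Proof.
move=> hs.
pose h y := if isnode (lft (rgt y)) then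
   tapp (Node (lft (lft (rgt y))) Leaf) (rgt (rgt (rgt y))) else Leaf.
have hh : PT h by rewrite /h; apply: PT_if; [PTt|apply: PT_tapp; PTt|PTt].
have b p t : tsize (tfold h p t) <= 3 * tsize t.
  elim: t => [|x _ s' IH] //=; rewrite /h /= -/h.
  by apply: leq_trans (tsize_tapp _ _) _; rewrite /=; lia.
have q : poly (fun n => 3 * n) by polyt.
case: hs => G hG g_; exists (fun x => tfold h Leaf (G x)).
  apply: PT_ext (PT_app (PT_tfold hh q _) (PT_node (PT_const Leaf) hG)) => [x|p t] //=.
  by apply: leq_trans (b p t) _; rewrite leq_mul2l leq_addl orbT.
move=> a; rewrite g_; elim: (s a) => //= x s' IH; rewrite /h /= -/h IH rev_cons -cats1.
by rewrite enc_cat.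
Qed.

End Lists.

Lemma pt_rctx A (eA : A -> tree) B C (eB : B -> tree) (eC : C -> tree) s h :
  pt eA (enc_seq eB) s ->
  pt (enc_pair eA (enc_pair eB (enc_seq eB))) (enc_seq eC) (fun q => h q.1 q.2.1 q.2.2) ->
  pt eA (enc_seq eC) (fun a => rctx (h a) (s a)).
Proof.
move=> hs hh.
(* Reversing every value and then the whole result of [ctx] emits the values from the back, each in
   its own order. *)
have hh' := pt_rev hh.
apply: pt_ext (pt_rev (@pt_ctx _ _ _ _ _ _ _ (fun a x t => rev (h a x t)) hs hh')) => a.
elim: (s a) => //= x s' <-; rewrite rev_cat revK.
by [].
Qed.

Section More.
Context (A : Type) (eA : A -> tree).

Lemma pt_map B C (eB : B -> tree) (eC : C -> tree) s h :
  pt eA (enc_seq eB) s -> pt (enc_pair eA eB) eC (fun q => h q.1 q.2) ->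
  pt eA (enc_seq eC) (fun a => [seq h a x | x <- s a]).
Proof.
move=> hs [H hH h_]; apply: pt_ext (@pt_ctx _ _ _ _ _ _ _ (fun a x _ => [:: h a x]) hs _) => [a|].
  by elim: (s a) => //= x s' ->.
exists (fun y => Node (H (Node (lft y) (lft (rgt y)))) Leaf) => [|q]; last first.
  by case: q => a [x t]; rewrite /= (h_ (a, x) : H (Node (eA a) (eB x)) = _).
by apply: PT_node; [apply: PT_app => //|]; PTt.
Qed.

Lemma pt_flatten_map B C (eB : B -> tree) (eC : C -> tree) s h :
  pt eA (enc_seq eB) s -> pt (enc_pair eA eB) (enc_seq eC) (fun q => h q.1 q.2) ->
  pt eA (enc_seq eC) (fun a => flatten [seq h a x | x <- s a]).
Proof.
move=> hs [H hH h_]; apply: pt_ext (@pt_ctx _ _ _ _ _ _ _ (fun a x _ => h a x) hs _) => [a|].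
  by elim: (s a) => //= x s' ->.
exists (fun y => H (Node (lft y) (lft (rgt y)))) => [|q]; last first.
  by case: q => a [x t]; rewrite /= (h_ (a, x) : H (Node (eA a) (eB x)) = _).
by apply: PT_app => //; PTt.
Qed.

Lemma pt_filter B (eB : B -> tree) s h :
  pt eA (enc_seq eB) s -> pt (enc_pair eA eB) enc_bool (fun q => h q.1 q.2) ->
  pt eA (enc_seq eB) (fun a => [seq x <- s a | h a x]).
Proof.
move=> hs hh.
have hh' : pt (enc_pair eA eB) (enc_seq eB) (fun q => if h q.1 q.2 then [:: q.2] else [::]).
  apply: pt_if => //; last exact: pt_const.
  by apply: pt_cons; [exact: pt_snd (pt_id _)|exact: pt_const].
apply: pt_ext (@pt_flatten_map _ _ _ _ _ (fun a x => if h a x then [:: x] else [::]) hs hh') => a.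
by elim: (s a) => //= x s' <-; case: (h a x).
Qed.

Lemma pt_all B (eB : B -> tree) s h :
  pt eA (enc_seq eB) s -> pt (enc_pair eA eB) enc_bool (fun q => h q.1 q.2) ->
  pt eA enc_bool (fun a => all (h a) (s a)).
Proof.
move=> hs hh.
have hn := pt_nilp (@pt_filter _ _ _ (fun a x => ~~ h a x) hs (pt_neg hh)).
by apply: pt_ext hn => a; elim: (s a) => //= x s' <-; case: (h a x).
Qed.

Lemma pt_has B (eB : B -> tree) s h :
  pt eA (enc_seq eB) s -> pt (enc_pair eA eB) enc_bool (fun q => h q.1 q.2) ->
  pt eA enc_bool (fun a => has (h a) (s a)).
Proof.
move=> hs hh.
apply: pt_ext (pt_neg (@pt_all _ _ _ (fun a x => ~~ h a x) hs (pt_neg hh))) => a.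
by elim: (s a) => //= x s' <-; case: (h a x).
Qed.

Lemma pt_mem (B : eqType) (eB : B -> tree) x s : injective eB ->
  pt eA eB x -> pt eA (enc_seq eB) s -> pt eA enc_bool (fun a => x a \in s a).
Proof.
move=> inj hx hs.
have h : pt (enc_pair eA eB) enc_bool (fun q => x q.1 == q.2).
  by apply: (pt_eq inj); [apply: (pt_app hx); exact: pt_fst (pt_id _)|exact: pt_snd (pt_id _)].
apply: pt_ext (@pt_has _ _ _ (fun a y => x a == y) hs h) => a.
by elim: (s a) => //= y s' ->.
Qed.

Lemma pt_head B (eB : B -> tree) b s :
  pt eA (enc_seq eB) s -> pt eA eB (fun a => head b (s a)).
Proof.
move=> [F hF f_]; exists (fun x => if isnode (F x) then lft (F x) else eB b) => [|a].
  by PTt.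
by rewrite f_; case: (s a).
Qed.

Lemma pt_behead B (eB : B -> tree) s :
  pt eA (enc_seq eB) s -> pt eA (enc_seq eB) (fun a => behead (s a)).
Proof.
by move=> [F hF f_]; exists (fun x => rgt (F x)) => [|a]; [PTt|rewrite f_; case: (s a)].
Qed.

Lemma pt_nth B (eB : B -> tree) b s i :
  pt eA (enc_seq eB) s -> pt eA eB (fun a => nth b (s a) i).
Proof.
elim: i s => [|i IH] s hs.
  by apply: pt_ext (pt_head b hs) => a; case: (s a).
by apply: pt_ext (IH _ (pt_behead hs)) => a; case: (s a) => //=; rewrite nth_nil.
Qed.

Lemma pt_pctx B C (eB : B -> tree) (eC : C -> tree) s h :
  pt eA (enc_seq eB) s ->
  pt (enc_pair eA (enc_pair eB (enc_seq eB))) (enc_seq eC) (fun q => h q.1 q.2.2 q.2.1) ->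
  pt eA (enc_seq eC) (fun a => pctx (h a) [::] (s a)).
Proof.
move=> hs hh; apply: pt_ext (@pt_rctx _ _ _ _ _ _ _ (fun a x t => h a t x) (pt_rev hs) hh) => a.
rewrite pctxE; elim: (rev (s a)) => //= x t ->.
by rewrite cats0.
Qed.

(** The table T is fixed, so a lookup is a finite chain of tests with a separate program for each
    entry. *)
Lemma pt_select B C (eC : C -> tree) (T : seq B) (b : B) r (f : B -> A -> C) :
  pt eA enc_nat r -> (forall x, pt eA eC (f x)) ->
  pt eA eC (fun a => f (nth b T (r a)) a).
Proof.
move=> hr hf.
have h n : pt eA eC (fun a => if r a < n then f (nth b T (r a)) a else f b a).
  elim: n => [|n IH]; first exact: hf.
  have h' : pt eA enc_bool (fun a => r a == n).
    by apply: (pt_eq enc_nat_inj) => //; exact: pt_const.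
  apply: pt_ext (pt_if h' (hf (nth b T n)) IH) => a /=.
  by rewrite ltnS [r a <= n]leq_eqVlt; case: (r a =P n) => [->|_] /=.
apply: pt_ext (h (size T)) => a.
by case: ltnP => // le; rewrite nth_default.
Qed.

End More.

(** * Injectivity of the encodings *)

Lemma enc_bool_inj : injective enc_bool. Proof. by case=> [] []. Qed.

Lemma enc_pair_inj A B (eA : A -> tree) (eB : B -> tree) :
  injective eA -> injective eB -> injective (enc_pair eA eB).
Proof. by move=> iA iB [a b] [a' b'] [/iA-> /iB->]. Qed.

Lemma enc_seq_inj A (eA : A -> tree) : injective eA -> injective (enc_seq eA).
Proof. by move=> iA; elim=> [|x s IH] [|x' s'] //= [/iA-> /IH->]. Qed.

Lemma enc_lit_inj : injective enc_lit.
Proof. exact: enc_pair_inj enc_nat_inj enc_bool_inj. Qed.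

Lemma enc_tagged_inj k k' s s' :
  enc_tagged k s = enc_tagged k' s' -> k = k' /\ s = s'.
Proof. by case=> /enc_nat_inj-> /(@enc_seq_inj _ id (fun _ _ => id))->. Qed.

Lemma enc_form_inj : injective enc_form.
Proof.
elim=> [x|||B IHB|B IHB C IHC|B IHB C IHC|B IHB C IHC|B IHB C IHC]
  [x'|||B'|B' C'|B' C'|B' C'|B' C'] /enc_tagged_inj[//= _] []; try by [].
- by move/enc_nat_inj->.
- by move/IHB->.
- by move=> /IHB-> /IHC->.
- by move=> /IHB-> /IHC->.
- by move=> /IHB-> /IHC->.
- by move=> /IHB-> /IHC->.
Qed.

Lemma enc_weakening_inj : injective enc_weakening.
Proof.
case=> [u|x D] [u'|x' D'] /enc_tagged_inj[//= _] [].
  by move/enc_nat_inj->.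
by move=> /enc_nat_inj-> /(enc_seq_inj enc_nat_inj)->.
Qed.

Lemma enc_rstep_inj : injective enc_rstep.
Proof.
have iC := enc_seq_inj enc_lit_inj.
case=> [C|C u|E F x|v al y z|w] [C'|C' u'|E' F' x'|v' al' y' z'|w'] /enc_tagged_inj[//= _] [].
- by move/iC->.
- by move=> /iC-> /enc_nat_inj E1 /enc_bool_inj E2; rewrite (surjective_pairing u) E1 E2 -surjective_pairing.
- by move=> /iC-> /iC-> /enc_nat_inj->.
- move=> /enc_nat_inj-> /iC-> /enc_nat_inj E1 /enc_bool_inj E2 /enc_nat_inj E3 /enc_bool_inj E4.
  by rewrite (surjective_pairing y) (surjective_pairing z) E1 E2 E3 E4 -!surjective_pairing.
- by move/enc_weakening_inj->.
Qed.

(** * Case analysis on encoded constructors *)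

Fixpoint tsw (k : nat) (Fs : seq (tree -> tree)) (y : tree) : tree :=
  if Fs is F :: Fs' then if eqt (lft (rgt y)) (enc_nat k) then F y else tsw k.+1 Fs' y
  else Leaf.

Lemma tswE k Fs c i args :
  tsw k Fs (Node c (enc_tagged (k + i) args))
  = nth (fun=> Leaf) Fs i (Node c (enc_tagged (k + i) args)).
Proof.
elim: Fs k i => [|F Fs IH] k [|i] //=.
  by rewrite addn0 (introT (eqtP _ _)).
case: eqtP => [/enc_nat_inj|_]; first by lia.
by rewrite -addSnnS IH.
Qed.

Lemma tsw0E Fs c i args :
  tsw 0 Fs (Node c (enc_tagged i args)) = nth (fun=> Leaf) Fs i (Node c (enc_tagged i args)).
Proof. exact: (tswE 0). Qed.

Fixpoint allPT (Fs : seq (tree -> tree)) : Prop :=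
  if Fs is F :: Fs' then PT F /\ allPT Fs' else True.

Lemma PT_tsw k Fs G : allPT Fs -> PT G -> PT (fun x => tsw k Fs (G x)).
Proof.
move=> hFs hG; elim: Fs k hFs => [|F Fs IH] k /=; first by move=> _; apply: PT_const.
by case=> hF /IH h; apply: PT_ifeq; [PTt|PTt|apply: PT_app|].
Qed.

Definition arg (i : nat) (y : tree) : tree := lft (iter i rgt (rgt (rgt y))).

Lemma PT_arg i F : PT F -> PT (fun x => arg i (F x)).
Proof.
move=> hF; apply: PT_lfta; elim: i => [|i IH]; first by PTt.
exact: PT_rgta.
Qed.

(** These functions turn a context with a list of constructor arguments into the nested pairs that
    the branches of a case analysis expect. *)
Definition shape0 (y : tree) : tree := lft y.
Definition shape1 (y : tree) : tree := Node (lft y) (arg 0 y).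
Definition shape2 (y : tree) : tree := Node (lft y) (Node (arg 0 y) (arg 1 y)).
Definition shape3 (y : tree) : tree :=
  Node (lft y) (Node (arg 0 y) (Node (arg 1 y) (arg 2 y))).
Definition shape4 (y : tree) : tree :=
  Node (lft y) (Node (arg 0 y) (Node (arg 1 y) (Node (arg 2 y) (arg 3 y)))).

Ltac PTs := rewrite /shape0 /shape1 /shape2 /shape3 /shape4;
  repeat first [ exact: PT_id | apply: PT_arg | apply: PT_node | apply: PT_lfta ].

Section Cases.
Context (A B : Type) (eA : A -> tree) (eB : B -> tree).

Lemma pt_form_case s f0 f1 f2 f3 f4 f5 f6 f7 :
  pt eA enc_form s ->
  pt (enc_pair eA enc_nat) eB (fun q => f0 q.1 q.2) ->
  pt eA eB f1 -> pt eA eB f2 ->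
  pt (enc_pair eA enc_form) eB (fun q => f3 q.1 q.2) ->
  pt (enc_pair eA (enc_pair enc_form enc_form)) eB (fun q => f4 q.1 q.2.1 q.2.2) ->
  pt (enc_pair eA (enc_pair enc_form enc_form)) eB (fun q => f5 q.1 q.2.1 q.2.2) ->
  pt (enc_pair eA (enc_pair enc_form enc_form)) eB (fun q => f6 q.1 q.2.1 q.2.2) ->
  pt (enc_pair eA (enc_pair enc_form enc_form)) eB (fun q => f7 q.1 q.2.1 q.2.2) ->
  pt eA eB (fun a => match s a with
    | FVar x => f0 a x | FFalse => f1 a | FTrue => f2 a | FNot C => f3 a C
    | FAnd C D => f4 a C D | FOr C D => f5 a C D | FImp C D => f6 a C D
    | FIff C D => f7 a C D end).
Proof.
move=> [S hS s_] [F0 h0 e0] [F1 h1 e1] [F2 h2 e2] [F3 h3 e3] [F4 h4 e4]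
  [F5 h5 e5] [F6 h6 e6] [F7 h7 e7].
exists (fun x => tsw 0 [:: F0 \o shape1; F1 \o shape0; F2 \o shape0; F3 \o shape1;
   F4 \o shape2; F5 \o shape2; F6 \o shape2; F7 \o shape2] (Node x (S x))) => [|a].
  apply: PT_tsw; last by PTt.
  by do 8 (split; first by apply: PT_comp => //; PTs).
rewrite s_; case: (s a) => [x|||C|C D|C D|C D|C D]; rewrite /enc_form -/enc_form.
- by rewrite tsw0E; apply: (e0 (a, x)).
- by rewrite tsw0E; apply: (e1 a).
- by rewrite tsw0E; apply: (e2 a).
- by rewrite tsw0E; apply: (e3 (a, C)).
- by rewrite tsw0E; apply: (e4 (a, (C, D))).
- by rewrite tsw0E; apply: (e5 (a, (C, D))).
- by rewrite tsw0E; apply: (e6 (a, (C, D))).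
- by rewrite tsw0E; apply: (e7 (a, (C, D))).
Qed.

Lemma pt_rstep_case s f0 f1 f2 f3 f4 :
  pt eA enc_rstep s ->
  pt (enc_pair eA enc_clause) eB (fun q => f0 q.1 q.2) ->
  pt (enc_pair eA (enc_pair enc_clause enc_lit)) eB (fun q => f1 q.1 q.2.1 q.2.2) ->
  pt (enc_pair eA (enc_pair enc_clause (enc_pair enc_clause enc_nat))) eB
     (fun q => f2 q.1 q.2.1 q.2.2.1 q.2.2.2) ->
  pt (enc_pair eA (enc_pair enc_nat (enc_pair (enc_seq enc_lit) (enc_pair enc_lit enc_lit)))) eB
     (fun q => f3 q.1 q.2.1 q.2.2.1 q.2.2.2.1 q.2.2.2.2) ->
  pt (enc_pair eA enc_weakening) eB (fun q => f4 q.1 q.2) ->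
  pt eA eB (fun a => match s a with
    | RAxiom C => f0 a C | RReduce C u => f1 a C u | RResolve E F x => f2 a E F x
    | RExtend v al y z => f3 a v al y z | RWeaken w => f4 a w end).
Proof.
move=> [S hS s_] [F0 h0 e0] [F1 h1 e1] [F2 h2 e2] [F3 h3 e3] [F4 h4 e4].
exists (fun x => tsw 0 [:: F0 \o shape1; F1 \o shape2; F2 \o shape3; F3 \o shape4;
   F4 \o shape1] (Node x (S x))) => [|a].
  apply: PT_tsw; last by PTt.
  by do 5 (split; first by apply: PT_comp => //; PTs).
rewrite s_; case: (s a) => [C|C u|E F x|v al y z|w]; rewrite /enc_rstep.
- by rewrite tsw0E; apply: (e0 (a, C)).
- by rewrite tsw0E; apply: (e1 (a, (C, u))).
- by rewrite tsw0E; apply: (e2 (a, (E, (F, x)))).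
- by rewrite tsw0E; apply: (e3 (a, (v, (al, (y, z))))).
- by rewrite tsw0E; apply: (e4 (a, w)).
Qed.

Lemma pt_fstep_case s f0 f1 f2 f3 f4 :
  pt eA enc_fstep s ->
  pt (enc_pair eA (enc_pair enc_nat (enc_seq enc_form))) eB (fun q => f0 q.1 q.2.1 q.2.2) ->
  pt (enc_pair eA enc_clause) eB (fun q => f1 q.1 q.2) ->
  pt (enc_pair eA (enc_pair enc_nat (enc_pair (enc_seq enc_lit) (enc_pair enc_bool (enc_seq enc_lit))))) eB
     (fun q => f2 q.1 q.2.1 q.2.2.1 q.2.2.2.1 q.2.2.2.2) ->
  pt (enc_pair eA (enc_pair enc_form (enc_pair enc_nat enc_bool))) eB
     (fun q => f3 q.1 q.2.1 q.2.2.1 q.2.2.2) ->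
  pt (enc_pair eA enc_weakening) eB (fun q => f4 q.1 q.2) ->
  pt eA eB (fun a => match s a with
    | FFrege r sg => f0 a r sg | FAxiom C => f1 a C | FExtend v al b Y => f2 a v al b Y
    | FReduce L u b => f3 a L u b | FWeaken w => f4 a w end).
Proof.
move=> [S hS s_] [F0 h0 e0] [F1 h1 e1] [F2 h2 e2] [F3 h3 e3] [F4 h4 e4].
exists (fun x => tsw 0 [:: F0 \o shape2; F1 \o shape1; F2 \o shape4; F3 \o shape3;
   F4 \o shape1] (Node x (S x))) => [|a].
  apply: PT_tsw; last by PTt.
  by do 5 (split; first by apply: PT_comp => //; PTs).
rewrite s_; case: (s a) => [r sg|C|v al b Y|L u b|w]; rewrite /enc_fstep.
- by rewrite tsw0E; apply: (e0 (a, (r, sg))).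
- by rewrite tsw0E; apply: (e1 (a, C)).
- by rewrite tsw0E; apply: (e2 (a, (v, (al, (b, Y))))).
- by rewrite tsw0E; apply: (e3 (a, (L, (u, b)))).
- by rewrite tsw0E; apply: (e4 (a, w)).
Qed.

End Cases.

(** * Constructors and operations on formulas *)

Section Constructors.
Context (A : Type) (eA : A -> tree).

Lemma pt_tagged1 B C (eB : B -> tree) (eC : C -> tree) k c f :
  (forall b, eC (c b) = enc_tagged k [:: eB b]) ->
  pt eA eB f -> pt eA eC (fun a => c (f a)).
Proof.
move=> E [F hF f_]; exists (fun x => Node (enc_nat k) (Node (F x) Leaf)) => [|a]; first by PTt.
by rewrite E f_.
Qed.

Lemma pt_tagged2 B B' C (eB : B -> tree) (eB' : B' -> tree) (eC : C -> tree) k c f f' :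
  (forall b b', eC (c b b') = enc_tagged k [:: eB b; eB' b']) ->
  pt eA eB f -> pt eA eB' f' -> pt eA eC (fun a => c (f a) (f' a)).
Proof.
move=> E [F hF f_] [F' hF' f'_].
exists (fun x => Node (enc_nat k) (Node (F x) (Node (F' x) Leaf))) => [|a]; first by PTt.
by rewrite E f_ f'_.
Qed.

Lemma pt_tagged3 B B' B'' C (eB : B -> tree) (eB' : B' -> tree) (eB'' : B'' -> tree)
    (eC : C -> tree) k c f f' f'' :
  (forall b b' b'', eC (c b b' b'') = enc_tagged k [:: eB b; eB' b'; eB'' b'']) ->
  pt eA eB f -> pt eA eB' f' -> pt eA eB'' f'' -> pt eA eC (fun a => c (f a) (f' a) (f'' a)).
Proof.
move=> E [F hF f_] [F' hF' f'_] [F'' hF'' f''_].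
exists (fun x => Node (enc_nat k) (Node (F x) (Node (F' x) (Node (F'' x) Leaf)))) => [|a].
  by PTt.
by rewrite E f_ f'_ f''_.
Qed.

Lemma pt_tagged4 B B1 B2 B3 C (eB : B -> tree) (eB1 : B1 -> tree) (eB2 : B2 -> tree)
    (eB3 : B3 -> tree) (eC : C -> tree) k c f f1 f2 f3 :
  (forall b b1 b2 b3, eC (c b b1 b2 b3) = enc_tagged k [:: eB b; eB1 b1; eB2 b2; eB3 b3]) ->
  pt eA eB f -> pt eA eB1 f1 -> pt eA eB2 f2 -> pt eA eB3 f3 ->
  pt eA eC (fun a => c (f a) (f1 a) (f2 a) (f3 a)).
Proof.
move=> E [F hF f_] [F1 hF1 f1_] [F2 hF2 f2_] [F3 hF3 f3_].
exists (fun x => Node (enc_nat k) (Node (F x) (Node (F1 x) (Node (F2 x) (Node (F3 x) Leaf))))).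
  by PTt.
by move=> a; rewrite E f_ f1_ f2_ f3_.
Qed.

Definition pt_RExtend f g h k := @pt_tagged4 _ _ _ _ _ enc_nat (enc_seq enc_lit) enc_lit enc_lit
  enc_rstep 3 RExtend f g h k (fun _ _ _ _ => erefl).
Definition pt_FExtend f g h k := @pt_tagged4 _ _ _ _ _ enc_nat (enc_seq enc_lit) enc_bool
  (enc_seq enc_lit) enc_fstep 2 FExtend f g h k (fun _ _ _ _ => erefl).
Definition pt_FVar f := @pt_tagged1 _ _ enc_nat enc_form 0 FVar f (fun=> erefl).
Definition pt_FNot f := @pt_tagged1 _ _ enc_form enc_form 3 FNot f (fun=> erefl).
Definition pt_FAnd f g := @pt_tagged2 _ _ _ enc_form enc_form enc_form 4 FAnd f g (fun _ _ => erefl).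
Definition pt_FOr f g := @pt_tagged2 _ _ _ enc_form enc_form enc_form 5 FOr f g (fun _ _ => erefl).
Definition pt_FImp f g := @pt_tagged2 _ _ _ enc_form enc_form enc_form 6 FImp f g (fun _ _ => erefl).
Definition pt_FIff f g := @pt_tagged2 _ _ _ enc_form enc_form enc_form 7 FIff f g (fun _ _ => erefl).
Definition pt_RAxiom f := @pt_tagged1 _ _ enc_clause enc_rstep 0 RAxiom f (fun=> erefl).
Definition pt_RReduce f g := @pt_tagged2 _ _ _ enc_clause enc_lit enc_rstep 1 RReduce f g (fun _ _ => erefl).
Definition pt_RResolve f g h := @pt_tagged3 _ _ _ _ enc_clause enc_clause enc_nat enc_rstep 2 RResolve f g h (fun _ _ _ => erefl).
Definition pt_RWeaken f := @pt_tagged1 _ _ enc_weakening enc_rstep 4 RWeaken f (fun=> erefl).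
Definition pt_WeakExis f g := @pt_tagged2 _ _ _ enc_nat (enc_seq enc_nat) enc_weakening 1 WeakExis f g (fun _ _ => erefl).
Definition pt_FFrege f g := @pt_tagged2 _ _ _ enc_nat (enc_seq enc_form) enc_fstep 0 FFrege f g (fun _ _ => erefl).
Definition pt_FAxiom f := @pt_tagged1 _ _ enc_clause enc_fstep 1 FAxiom f (fun=> erefl).
Definition pt_FReduce f g h := @pt_tagged3 _ _ _ _ enc_form enc_nat enc_bool enc_fstep 3 FReduce f g h (fun _ _ _ => erefl).
Definition pt_FWeaken f := @pt_tagged1 _ _ enc_weakening enc_fstep 4 FWeaken f (fun=> erefl).

Lemma pt_big_and f : pt eA (enc_seq enc_form) f -> pt eA enc_form (fun a => big_and (f a)).
Proof.
move=> [F hF f_]; exists (fun x => tbig 4 (enc_form FTrue) (F x)) => [|a]; first exact: PT_tbig.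
by rewrite f_; elim: (f a) => //= B [|C s] //= ->.
Qed.

Lemma pt_big_or f : pt eA (enc_seq enc_form) f -> pt eA enc_form (fun a => big_or (f a)).
Proof.
move=> [F hF f_]; exists (fun x => tbig 5 (enc_form FFalse) (F x)) => [|a]; first exact: PT_tbig.
by rewrite f_; elim: (f a) => //= B [|C s] //= ->.
Qed.

(** Postorder: gates are declared inputs first, and congruences are proved from those of the
    parts. *)
Fixpoint subs (B : form) : seq form :=
  match B with
  | FVar _ | FFalse | FTrue => [:: B]
  | FNot C => subs C ++ [:: B]
  | FAnd C D | FOr C D | FImp C D | FIff C D => subs C ++ subs D ++ [:: B]
  end.

Lemma tapp0 t : tapp Leaf t = t.
Proof. by elim: t => //= x _ s ->. Qed.

Lemma pt_subs f : pt eA enc_form f -> pt eA (enc_seq enc_form) (fun a => subs (f a)).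
Proof.
move=> [F hF f_]; exists (fun x => lft (tsubs (F x))) => [|a]; first exact: PT_tsubs.
rewrite f_; elim: (f a) => [x|||C IHC|C IHC D IHD|C IHC D IHD|C IHC D IHD|C IHC D IHD] //;
  by rewrite /subs -/subs !enc_cat -?IHC -?IHD -?tapp_assoc -[in RHS](tapp0 (lft _)).
Qed.

Lemma pt_assign_const u b f :
  pt eA enc_nat u -> pt eA enc_bool b -> pt eA enc_form f ->
  pt eA enc_form (fun a => assign_const (u a) (b a) (f a)).
Proof.
move=> [U hU u_] [B hB b_] [F hF f_].
pose c x := if isnode (B x) then enc_form FTrue else enc_form FFalse.
pose V x := Node (enc_nat 0) (Node (U x) Leaf).
exists (fun x => lft (tassign (Node (V x) (c x)) (F x))) => [|a].
  by rewrite /V /c; apply: PT_tassign; PTt.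
rewrite f_; have -> : c (eA a) = enc_form (if b a then FTrue else FFalse).
  by rewrite /c b_; case: (b a).
have -> : V (eA a) = enc_form (FVar (u a)) by rewrite /V u_.
rewrite /assign_const; elim: (f a) => [x|||C IHC|C IHC D IHD|C IHC D IHD|C IHC D IHD|C IHC D IHD] //;
  try by rewrite [fsubst _ _]/= [in RHS]/= -?IHC -?IHD.
have tv P : lft (tassign P (enc_form (FVar x)))
  = if eqt (enc_form (FVar x)) (lft P) then rgt P else enc_form (FVar x) by [].
rewrite tv [fsubst _ _]/=; have [->|ne] := eqVneq x (u a).
  by case: eqtP => // -[].
case: eqtP => // /= E; have {}E : FVar x = FVar (u a) by apply: enc_form_inj.
by case: E => E; rewrite E eqxx in ne.
Qed.

Lemma pt_code n t : (forall a, 0 < n a) -> pt eA enc_nat n -> pt eA id t ->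
  pt eA enc_nat (fun a => code (t a) (n a)).
Proof.
move=> n0 [N hN n_] [T hT t_]; exists (fun x => tapp (N x) (tbits (T x))) => [|a].
  by apply: PT_tapp => //; apply: PT_tbits.
by rewrite n_ t_ enc_code.
Qed.

Lemma pt_enc B (eB : B -> tree) f : pt eA eB f -> pt eA id (fun a => eB (f a)).
Proof. by move=> [F hF f_]; exists F. Qed.

End Constructors.

Ltac pt_user := fail.

Ltac pt1 := first
  [ exact: pt_id | eassumption | exact: pt_const | pt_user
  | apply: pt_fst | apply: pt_snd
  | apply: pt_if | apply: pt_cons | apply: pt_cat
  | apply: pt_flatten_map | apply: pt_map | apply: pt_filter
  | apply: pt_seq_case | apply: pt_ctx | apply: pt_rctx | apply: pt_pctx | apply: pt_form_case
  | apply: pt_rstep_case | apply: pt_fstep_case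
  | apply: pt_nilp | apply: pt_neg | apply: pt_and | apply: pt_all | apply: pt_has
  | apply: (pt_eq enc_nat_inj) | apply: (pt_eq enc_bool_inj)
  | apply: (pt_mem enc_lit_inj) | apply: pt_rev
  | apply: pt_FVar | apply: pt_FNot | apply: pt_FAnd | apply: pt_FOr | apply: pt_FImp
  | apply: pt_FIff | apply: pt_RAxiom | apply: pt_RReduce | apply: pt_RResolve
  | apply: pt_RExtend | apply: pt_RWeaken | apply: pt_WeakExis | apply: pt_FFrege
  | apply: pt_FAxiom | apply: pt_FExtend | apply: pt_FReduce | apply: pt_FWeaken
  | apply: pt_big_and | apply: pt_big_or | apply: pt_subs | apply: pt_assign_const
  | apply: pt_pair ].

Ltac ptt := repeat (cbv beta; pt1).

Section Inst.
Context (A : Type) (eA : A -> tree).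

Lemma pt_inst s f : pt eA (enc_seq enc_form) s -> pt eA enc_form (fun a => inst (s a) f).
Proof.
move=> hs; rewrite /inst; elim: f => [i|||B IHB|B IHB C IHC|B IHB C IHC|B IHB C IHC|B IHB C IHC] /=;
  by [apply: pt_nth|ptt].
Qed.

Lemma pt_neg_lit l : pt eA enc_lit l -> pt eA enc_lit (fun a => neg (l a)).
Proof. by move=> hl; rewrite /neg; ptt. Qed.

Lemma pt_lit_form l : pt eA enc_lit l -> pt eA enc_form (fun a => lit_form (l a)).
Proof. by move=> hl; rewrite /lit_form; ptt. Qed.

End Inst.

Ltac in_seq := rewrite !inE; repeat case/orP; move/eqP->.

(** * Schematic rules *)

Definition frule0 : frule := FRule [::] FTrue.

Notation "A ==> B" := (FImp A B) : form_scope.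
Notation "~~ A" := (FNot A) : form_scope.
Notation "A <=> B" := (FIff A B) (at level 96) : form_scope.
Notation "A || B" := (FOr A B) : form_scope.
Notation "A && B" := (FAnd A B) : form_scope.
Delimit Scope form_scope with F.

(** Rules 0 to 17 serve the translation of R into F, rules 18 to 33 that of F into R, which shares
    the rules 0 to 2. *)
Definition schemas : seq frule :=
  let a := FVar 0 in let b := FVar 1 in let c := FVar 2 in
  let d := FVar 3 in let e := FVar 4 in
  [:: (*0*) FRule [::] (a ==> a)%F;
      FRule [:: (a || b ==> c)%F] (a ==> c)%F;
      FRule [:: (a || b ==> c)%F] (b ==> c)%F;
      FRule [::] (FFalse ==> a)%F;
      FRule [:: a ==> c; b ==> c]%F (a || b ==> c)%F;
      (*5*) FRule [:: a; a ==> b]%F b;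
      FRule [:: a ==> c]%F (a ==> (b ==> c))%F;
      FRule [::] (~~ a ==> (a ==> b))%F;
      FRule [::] (a ==> (~~ a ==> b))%F;
      FRule [:: a ==> b; ~~ a ==> b]%F b;
      (*10*) FRule [::] (~~ FTrue ==> a)%F;
      FRule [:: ~~ a ==> b]%F (~~ b ==> a)%F;
      FRule [:: a ==> b]%F (~~ b ==> ~~ a)%F;
      FRule [::] (a ==> FTrue)%F;
      FRule [:: c ==> a; c ==> b]%F (c ==> a && b)%F;
      (*15*) FRule [:: ~~ e ==> a; a ==> (b <=> c || d); ~~ e ==> ~~ b; ~~ e ==> c]%F e;
      FRule [:: ~~ e ==> a; a ==> (b <=> c || d); ~~ e ==> ~~ b; ~~ e ==> d]%F e;
      FRule [:: ~~ e ==> a; a ==> (b <=> c || d); ~~ e ==> b; c ==> e; d ==> e]%F e;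
      FRule [:: c ==> a && b]%F (c ==> a)%F;
      FRule [:: c ==> a && b]%F (c ==> b)%F;
      (*20*) FRule [:: a ==> b]%F (~~ b ==> (a ==> c))%F;
      FRule [:: a ==> ~~ b]%F (b ==> (a ==> c))%F;
      FRule [::] (a ==> (b ==> (c ==> a)))%F;
      FRule [::] (~~ c ==> (b ==> (c ==> a)))%F;
      FRule [:: a ==> (b ==> c); a ==> (c ==> b)]%F (a ==> (c <=> b))%F;
      (*25*) FRule [::] (a || (b <=> b))%F;
      FRule [::] (a || (a <=> FFalse))%F;
      FRule [::] (~~ a || (a <=> FTrue))%F;
      FRule [:: e || (a <=> b)]%F (e || (~~ a <=> ~~ b))%F;
      FRule [:: e || (a <=> b); e || (c <=> d)]%F (e || (a && c <=> b && d))%F;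
      (*30*) FRule [:: e || (a <=> b); e || (c <=> d)]%F (e || ((a || c) <=> (b || d)))%F;
      FRule [:: e || (a <=> b); e || (c <=> d)]%F (e || ((a ==> c) <=> (b ==> d)))%F;
      FRule [:: e || (a <=> b); e || (c <=> d)]%F (e || ((a <=> c) <=> (b <=> d)))%F;
      FRule [:: a; e || (a <=> b)]%F (e || b)%F].

Definition sound_rule (R : frule) : Prop := entails (premises R) (conclusion R).

Lemma schemas_sound k : sound_rule (nth frule0 schemas k).
Proof.
have all_entails Hs A : (forall rho, all (feval rho) Hs -> feval rho A) -> entails Hs A.
  by move=> h rho hr; apply: h; apply/allP.
(* One truth table in at most five metavariables per rule; beyond the table the default rule
   concludes 1. *)
do 34 (case: k => [|k]; first by apply: all_entails => rho /=;
  case: (rho 0); case: (rho 1); case: (rho 2); case: (rho 3); case: (rho 4)).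
by rewrite nth_default //; apply: all_entails.
Qed.

(** * Scripts: sequences of instances of schematic rules *)

Definition sstep : Type := (nat * seq form)%type.

Definition sconc (RS : seq frule) (k : sstep) : form :=
  inst k.2 (conclusion (nth frule0 RS k.1)).

Fixpoint sout (RS : seq frule) (L : seq form) (s : seq sstep) : seq form :=
  if s is k :: s' then sout RS (sconc RS k :: L) s' else L.

Definition decl_form (V : seq nat) (A : form) : Prop := {subset fvars A <= V}.

Fixpoint sok (RS : seq frule) (V : seq nat) (L : seq form) (s : seq sstep) : Prop :=
  if s is k :: s' then
    [/\ k.1 < size RS, (forall A, A \in k.2 -> decl_form V A),
        (forall A, A \in premises (nth frule0 RS k.1) -> inst k.2 A \in L)
      & sok RS V (sconc RS k :: L) s']
  else True.

Section Scripts.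
Variables (RS : seq frule) (V : seq nat).

Lemma sout_cat L s1 s2 : sout RS L (s1 ++ s2) = sout RS (sout RS L s1) s2.
Proof. by elim: s1 L => //= k s IH L. Qed.

Lemma sok_cat L s1 s2 : sok RS V L (s1 ++ s2) <-> sok RS V L s1 /\ sok RS V (sout RS L s1) s2.
Proof.
elim: s1 L => [|k s IH] L /=; first by split => [|[]].
split; first by case=> h1 h2 h3 /IH[h4 h5]; do 2 split => //.
by case=> -[h1 h2 h3 h4] h5; split => //; apply/IH.
Qed.

Lemma sub_sout L s : {subset L <= sout RS L s}.
Proof. by elim: s L => [|k s IH] L A hA //=; apply: IH; rewrite inE hA orbT. Qed.

Lemma sout_mono L L' s : {subset L <= L'} -> {subset sout RS L s <= sout RS L' s}.
Proof.
elim: s L L' => [|k s IH] L L' h //=; apply: IH => A; rewrite !inE.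
by case/orP => [->//|/h->]; rewrite orbT.
Qed.

Lemma sok_mono L L' s : {subset L <= L'} -> sok RS V L s -> sok RS V L' s.
Proof.
elim: s L L' => //= k s IH L L' h [h1 h2 h3 h4]; split => // [A /h3/h//|].
by apply: IH h4 => A; rewrite !inE => /orP[->//|/h->]; rewrite orbT.
Qed.

(** A Hoare-style triple. Q is asked of every superset of the resulting lines, because an actual
    derivation also contains the intermediate lines of the templates. *)
Definition srun L s (Q : seq form -> Prop) : Prop :=
  sok RS V L s /\ forall L', {subset sout RS L s <= L'} -> Q L'.

Lemma srun_cat L s1 s2 Q :
  srun L s1 (fun L' => srun L' s2 Q) -> srun L (s1 ++ s2) Q.
Proof.
case=> h1 h2; have [h3 h4] := h2 _ (fun _ h => h); split; first by apply/sok_cat.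
by move=> L' hL; apply: h4 => A hA; apply: hL; rewrite sout_cat.
Qed.

Lemma srun_nil L (Q : seq form -> Prop) :
  (forall L', {subset L <= L'} -> Q L') -> srun L [::] Q.
Proof. by move=> h; split. Qed.

Lemma srun_step L k (Q : seq form -> Prop) : k.1 < size RS ->
  (forall A, A \in k.2 -> decl_form V A) ->
  (forall A, A \in premises (nth frule0 RS k.1) -> inst k.2 A \in L) ->
  (forall L', {subset L <= L'} -> sconc RS k \in L' -> Q L') -> srun L [:: k] Q.
Proof.
move=> h1 h2 h3 h4; split => //= L' hL; apply: h4.
  by move=> A hA; apply: hL; rewrite inE hA orbT.
by apply: hL; rewrite mem_head.
Qed.

Lemma srun_imp L s (Q Q' : seq form -> Prop) :
  (forall L', {subset L <= L'} -> Q L' -> Q' L') -> srun L s Q -> srun L s Q'.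
Proof.
move=> h [h1 h2]; split => // L' hL; apply: h; last exact: h2.
by move=> A hA; apply: hL; apply: sub_sout.
Qed.

End Scripts.

Lemma decl_fvars_cat V A B : {subset fvars A ++ fvars B <= V} <-> decl_form V A /\ decl_form V B.
Proof.
split => [h|[hA hB] x]; last by rewrite mem_cat => /orP[/hA|/hB].
by split => x hx; apply: h; rewrite mem_cat hx ?orbT.
Qed.

Lemma decl_FImp V A B : decl_form V A -> decl_form V B -> decl_form V (FImp A B).
Proof. by move=> hA hB; apply/decl_fvars_cat. Qed.

Lemma decl_big_or V fs : (forall f, f \in fs -> decl_form V f) -> decl_form V (big_or fs).
Proof.
elim: fs => [|f [|g fs] IH] h //=; first by apply: h; rewrite mem_head.
apply/decl_fvars_cat; split; first by apply: h; rewrite mem_head.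
by apply: IH => f' hf'; apply: h; rewrite inE hf' orbT.
Qed.

Lemma decl_big_and V fs : (forall f, f \in fs -> decl_form V f) -> decl_form V (big_and fs).
Proof.
elim: fs => [|f [|g fs] IH] h //=; first by apply: h; rewrite mem_head.
apply/decl_fvars_cat; split; first by apply: h; rewrite mem_head.
by apply: IH => f' hf'; apply: h; rewrite inE hf' orbT.
Qed.

Definition s_id A : sstep := (0, [:: A]).
Definition s_orL A B C : sstep := (1, [:: A; B; C]).
Definition s_orR A B C : sstep := (2, [:: A; B; C]).
Definition s_exf A : sstep := (3, [:: A]).
Definition s_orE A B C : sstep := (4, [:: A; B; C]).
Definition s_mp A B : sstep := (5, [:: A; B]).
Definition s_lift A B C : sstep := (6, [:: A; B; C]).
Definition s_neglift A B : sstep := (7, [:: A; B]).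
Definition s_poslift A B : sstep := (8, [:: A; B]).
Definition s_case A B : sstep := (9, [:: A; B]).
Definition s_notT A : sstep := (10, [:: A]).
Definition s_cpos A B : sstep := (11, [:: A; B]).
Definition s_cneg A B : sstep := (12, [:: A; B]).
Definition s_true A : sstep := (13, [:: A]).
Definition s_andI A B C : sstep := (14, [:: A; B; C]).
Definition s_ext1 A V B C Z : sstep := (15, [:: A; V; B; C; Z]).
Definition s_ext2 A V B C Z : sstep := (16, [:: A; V; B; C; Z]).
Definition s_ext3 A V B C Z : sstep := (17, [:: A; V; B; C; Z]).
Definition s_andL A B C : sstep := (18, [:: A; B; C]).
Definition s_andR A B C : sstep := (19, [:: A; B; C]).
Definition s_negpos A B C : sstep := (20, [:: A; B; C]).
Definition s_negneg A B C : sstep := (21, [:: A; B; C]).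
Definition s_K A B C : sstep := (22, [:: A; B; C]).
Definition s_negK A B C : sstep := (23, [:: A; B; C]).
Definition s_iffI A B C : sstep := (24, [:: A; B; C]).
Definition s_refl A B : sstep := (25, [:: A; B]).
Definition s_asg0 A : sstep := (26, [:: A]).
Definition s_asg1 A : sstep := (27, [:: A]).
Definition s_congN A B E : sstep := (28, [:: A; B; FTrue; FTrue; E]).
Definition s_congA A B C D E : sstep := (29, [:: A; B; C; D; E]).
Definition s_congO A B C D E : sstep := (30, [:: A; B; C; D; E]).
Definition s_congI A B C D E : sstep := (31, [:: A; B; C; D; E]).
Definition s_congE A B C D E : sstep := (32, [:: A; B; C; D; E]).
Definition s_trans A B E : sstep := (33, [:: A; B; FTrue; FTrue; E]).

(** From [big_or fs] implies Z, the disjuncts are split off from the left to obtain f implies Z for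
    each. The last one needs no step, as [big_or [:: f]] is f itself. *)
Definition injs (Z : form) (fs : seq form) : seq sstep :=
  ctx (fun f s => if s is _ :: _ then [:: s_orL f (big_or s) Z; s_orR f (big_or s) Z]
                  else [::]) fs.
Definition inj (fs : seq form) : seq sstep := s_id (big_or fs) :: injs (big_or fs) fs.

(** Proof by cases, building [big_or fs] implies Z from the back. The initial 0 implies Z settles
    the empty disjunction. *)
Definition cases (fs : seq form) (Z : form) : seq sstep :=
  (s_exf Z :: rctx (fun f s => if s is _ :: _ then [:: s_orE f (big_or s) Z] else [::]) fs)
  ++ [:: s_mp (big_or fs) Z].

Section ScriptLemmas.
Variables (RS' : seq frule) (V : seq nat).
Notation RS := (schemas ++ RS').
Notation srun := (srun RS V).
Notation decl := (decl_form V).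

Lemma srun_schema L k (Q : seq form -> Prop) : k.1 < size schemas ->
  (forall A, A \in k.2 -> decl A) ->
  (forall A, A \in premises (nth frule0 schemas k.1) -> inst k.2 A \in L) ->
  (forall L', {subset L <= L'} -> sconc schemas k \in L' -> Q L') -> srun L [:: k] Q.
Proof.
move=> h1 h2 h3 h4.
have E : nth frule0 RS k.1 = nth frule0 schemas k.1 by rewrite nth_cat h1.
apply: srun_step => //; first by rewrite size_cat ltn_addr.
  by move=> A; rewrite E; apply: h3.
by move=> L' hL; rewrite /sconc E; apply: h4.
Qed.

Lemma srun_cons L k s (Q : seq form -> Prop) : k.1 < size schemas ->
  (forall A, A \in k.2 -> decl A) ->
  (forall A, A \in premises (nth frule0 schemas k.1) -> inst k.2 A \in L) ->
  (forall L', {subset L <= L'} -> sconc schemas k \in L' -> srun L' s Q) -> srun L (k :: s) Q.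
Proof. by move=> h1 h2 h3 h4; rewrite -cat1s; apply: srun_cat; apply: srun_schema h4. Qed.

Lemma srun_injs L Z (fs : seq form) : decl Z -> (forall f, f \in fs -> decl f) ->
  (fs != [::] -> FImp (big_or fs) Z \in L) ->
  srun L (injs Z fs) (fun L' => forall f, f \in fs -> FImp f Z \in L').
Proof.
move=> dZ; elim: fs L => [|f [|g s] IH] L dfs hL.
- by apply: srun_nil.
- apply: srun_nil => L' sL f'; rewrite inE => /eqP->; apply: sL; exact: hL.
have df : decl f by apply: dfs; rewrite mem_head.
have ds f' : f' \in g :: s -> decl f' by move=> h; apply: dfs; rewrite inE h orbT.
have dB : decl (big_or (g :: s)) by apply: decl_big_or.
have args A : A \in [:: f; big_or (g :: s); Z] -> decl A.
  by in_seq.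
rewrite -[injs _ _]/([:: s_orL f (big_or (g :: s)) Z; s_orR f (big_or (g :: s)) Z] ++ injs Z (g :: s)).
apply: srun_cons => // [A|L1 s1 h1]; first by rewrite inE => /eqP->; apply: hL.
apply: srun_cons => // [A|L2 s2 h2]; first by rewrite inE => /eqP->; apply/s1/hL.
apply: srun_imp (IH L2 ds (fun _ => h2)) => L' sL h f'; rewrite inE => /orP[/eqP->|/h//].
by apply/sL/s2.
Qed.

Lemma srun_inj L (fs : seq form) : (forall f, f \in fs -> decl f) ->
  srun L (inj fs) (fun L' => {subset L <= L'} /\ forall f, f \in fs -> FImp f (big_or fs) \in L').
Proof.
move=> dfs; have dZ := decl_big_or dfs.
apply: srun_cons => // [A|L1 s1 h1]; first by in_seq.
apply: srun_imp (srun_injs dZ dfs (fun _ => h1)) => L' sL h; split => // A hA.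
exact/sL/s1.
Qed.

Lemma srun_cases L (fs : seq form) Z : decl Z -> (forall f, f \in fs -> decl f) ->
  (forall f, f \in fs -> FImp f Z \in L) -> big_or fs \in L ->
  srun L (cases fs Z) (fun L' => {subset L <= L'} /\ Z \in L').
Proof.
move=> dZ dfs hfs hor; apply: srun_cat.
apply: srun_cons => // [A|L1 s1 h1]; first by in_seq.
apply: (@srun_imp _ _ _ _ (fun L' => FImp (big_or fs) Z \in L')).
  move=> L2 s2 h2; apply: srun_schema => //.
  - move=> A; rewrite !inE => /orP[] /eqP-> //; exact: decl_big_or.
  - by move=> A; rewrite !inE => /orP[] /eqP-> //; apply/s2/s1.
  by move=> L3 s3 h3; split => // A hA; apply/s3/s2/s1.
have {hor} hfs1 f : f \in fs -> FImp f Z \in L1 by move/hfs/s1.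
elim: fs dfs hfs1 {hfs} => [|f [|g s] IH] dfs hfs.
- by apply: srun_nil => L' sL; apply: sL.
- by apply: srun_nil => L' sL; apply/sL/hfs/mem_head.
have ds f' : f' \in g :: s -> decl f' by move=> h; apply: dfs; rewrite inE h orbT.
apply: srun_cat; apply: srun_imp (IH ds _) => [L2 s2 h2|f' hf']; last first.
  by apply: hfs; rewrite inE hf' orbT.
apply: srun_schema => //.
- rewrite /s_orE => A; rewrite !inE => /or3P[] /eqP-> //.
    by apply: dfs; rewrite mem_head.
  exact: decl_big_or.
- move=> A; rewrite !inE => /orP[] /eqP-> //; apply/s2/hfs; exact: mem_head.
Qed.

End ScriptLemmas.

(** * From R to F *)

Section Runs.
Variables (line : eqType) (step : Type).
Variable rule : prefix -> seq line -> step -> prefix -> seq line -> Prop.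

Inductive run : prefix -> seq line -> seq step -> prefix -> seq line -> Prop :=
| RunNil P G : run P G [::] P G
| RunCons P G s pi P' new P'' G' :
    rule P G s P' new -> run P' (new ++ G) pi P'' G' -> run P G (s :: pi) P'' G'.

Lemma run_cat P G s1 s2 P' G' P'' G'' :
  run P G s1 P' G' -> run P' G' s2 P'' G'' -> run P G (s1 ++ s2) P'' G''.
Proof.
elim=> // {P G s1 P' G'} P G s pi P' new P1 G1 hs _ IH h.
exact: RunCons hs (IH h).
Qed.

Lemma run1 P G s P' new : rule P G s P' new -> run P G [:: s] P' (new ++ G).
Proof. by move=> h; apply: RunCons h _; apply: RunNil. Qed.

Lemma refutes_run bot P G s P' G' pi :
  run P G s P' G' -> refutes rule bot P' G' pi -> refutes rule bot P G (s ++ pi).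
Proof.
elim=> // {P G s P' G'} P G s pi' P' new P1 G1 hs _ IH h.
exact: RefStep hs (IH h).
Qed.
End Runs.

(** Choice over finitely many indices is provable. It collects templates, known only to exist, in
    the table that the translation programs contain. *)
Lemma finite_choice T (x0 : T) (P : nat -> T -> Prop) n :
  (forall k, k < n -> exists x, P k x) ->
  exists s, forall k, k < n -> P k (nth x0 s k).
Proof.
elim: n P => [|n IH] P h; first by exists [::].
have [x hx] := h 0 isT; have [k hk|s hs] := IH (fun k => P k.+1); first exact: (h k.+1).
by exists (x :: s) => -[|k] //; apply: hs.
Qed.

(** * Templates for the Frege system *)

Lemma fvars_inst sigma f V : (forall g, g \in sigma -> decl_form V g) -> decl_form V (inst sigma f).
Proof.
move=> h; rewrite /inst; elim: f => [i|||B IHB|B IHB C IHC|B IHB C IHC|B IHB C IHC|B IHB C IHC] //=;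
  try by apply/decl_fvars_cat.
have [lt|le] := ltnP i (size sigma); first by apply/h/mem_nth.
by rewrite nth_default.
Qed.

Lemma inst_inst sigma tau f : inst sigma (inst tau f) = inst [seq inst sigma g | g <- tau] f.
Proof.
rewrite /inst; elim: f => [i|||B IHB|B IHB C IHC|B IHB C IHC|B IHB C IHC|B IHB C IHC] //=;
  rewrite -?IHB -?IHC //.
have [lt|le] := ltnP i (size tau); first by rewrite (nth_map FTrue).
by rewrite !nth_default ?size_map.
Qed.

(** A Frege derivation with metavariables, as rule numbers with their substitutions. *)
Definition ftemplate : Type := seq (nat * seq form).

Definition der (T : ftemplate) (sigma : seq form) : seq fstep :=
  [seq FFrege k.1 [seq inst sigma f | f <- k.2] | k <- T].

Section Templates.
Variable S : seq frule.

Definition derives_by (T : ftemplate) (Hs As : seq form) : Prop :=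
  forall M P G sigma, (forall f, f \in sigma -> decl_form (declared P) f) ->
    (forall H, H \in Hs -> inst sigma H \in G) ->
    exists2 G', run (frule_step S M) P G (der T sigma) P G'
      & {subset G <= G'} /\ (forall A, A \in As -> inst sigma A \in G').

(** Substitutions compose ([inst_inst]), so one derivation of a schema, instantiated line by line,
    derives all instances in the same number of steps. *)
Lemma frege_template Hs A : frege_derives S Hs A -> exists T, derives_by T Hs [:: A].
Proof.
elim=> {A} [A hA|r tau lt_r R _ IH].
  exists [::] => M P G sigma _ hG; exists G; first exact: RunNil.
  by split => // B; rewrite inE => /eqP->; apply: hG.
have [T hT] : exists T, derives_by T Hs [seq inst tau B | B <- premises R].
  elim: (premises R) IH => [_|B Bs IHB IH].
    exists [::] => M P G sigma _ hG; exists G; first exact: RunNil.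
    by split.
  have [T1 h1] := IH _ (mem_head _ _).
  have [C hC|T2 h2] := IHB; first by apply: IH; rewrite inE hC orbT.
  exists (T1 ++ T2) => M P G sigma ds hG.
  have [G1 r1 [s1 m1]] := h1 M P G sigma ds hG.
  have [|G2 r2 [s2 m2]] := h2 M P G1 sigma ds; first by move=> H /hG/s1.
  exists G2; first by rewrite /der map_cat; apply: run_cat r1 r2.
  split=> [C /s1/s2//|C]; rewrite inE => /orP[/eqP->|/m2//].
  by apply/s2/m1/mem_head.
exists (T ++ [:: (r, tau)]) => M P G sigma ds hG.
have [G1 r1 [s1 m1]] := hT M P G sigma ds hG.
exists (inst sigma (inst tau (conclusion R)) :: G1).
  rewrite /der map_cat; apply: run_cat r1 _; rewrite inst_inst.
  apply: (@run1 _ _ (frule_step S M) P G1 _ P [:: inst _ (conclusion R)]).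
  apply: (@FR_frege S M P G1 r [seq inst sigma f | f <- tau] lt_r) => [B hB|].
    by rewrite -inst_inst; apply: m1; apply: map_f.
  apply: fvars_inst => g /mapP[f _ ->]; exact: fvars_inst.
split=> [C /s1 h|C]; first by rewrite inE h orbT.
by rewrite inE => /eqP->; apply: mem_head.
Qed.

Definition fder (TT : seq ftemplate) (s : seq sstep) : seq fstep :=
  flatten [seq der (nth [::] TT k.1) k.2 | k <- s].

Definition frege_templates (TT : seq ftemplate) : Prop := forall k, k < size schemas ->
  derives_by (nth [::] TT k) (premises (nth frule0 schemas k)) [:: conclusion (nth frule0 schemas k)].

Lemma exists_templates : frege_system S -> exists TT, frege_templates TT.
Proof.
move=> [_ complete].
apply: (@finite_choice _ _ (fun k T => derives_by T (premises (nth frule0 schemas k))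
  [:: conclusion (nth frule0 schemas k)])) => k _.
by apply/frege_template/complete/schemas_sound.
Qed.

Lemma fder_run TT M P G s (Q : seq form -> Prop) :
  frege_templates TT ->
  srun (schemas ++ [::]) (declared P) G s Q ->
  exists2 G', run (frule_step S M) P G (fder TT s) P G' & {subset G <= G'} /\ Q G'.
Proof.
move=> hTT [ok hQ]; move: hQ ok; rewrite cats0 => hQ ok.
suff [G' r [sG so]] : exists2 G', run (frule_step S M) P G (fder TT s) P G'
    & {subset G <= G'} /\ {subset sout schemas G s <= G'}.
  by exists G' => //; split => //; apply: hQ.
clear Q hQ; elim: s G ok => [|k s IH] G; first by move=> _; exists G; [exact: RunNil|split].
move=> [/= lt_k dk pk ok].
have [G1 r1 [s1 m1]] := hTT _ lt_k M P G _ dk pk.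
have sG1 : {subset sconc schemas k :: G <= G1}.
  by move=> A; rewrite inE => /orP[/eqP->|/s1//]; apply/m1/mem_head.
have [G2 r2 [s2 m2]] := IH G1 (sok_mono sG1 ok).
exists G2; first exact: run_cat r1 r2.
split=> [A /s1/s2//|A hA]; apply: m2; exact: sout_mono hA.
Qed.

End Templates.

(** * Translation of the steps of R *)

Definition lits (C : clause) : seq form := [seq lit_form l | l <- C].

(** R reads premises up to equality as sets, but a line of F is a disjunction in a fixed order; so
    the line actually derived has to be looked up. *)
Definition prem (G : seq clause) (C : clause) : clause :=
  head [::] [seq D <- G | all (fun l => l \in C) D && all (fun l => l \in D) C].

Lemma premP G C : derived_clause G C -> prem G C \in G /\ prem G C =i C.
Proof.
case=> D hD E; rewrite /prem.
set s := filter _ _; have : D \in s.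
  rewrite mem_filter hD andbT; apply/andP; split; apply/allP => l; by rewrite E.
case Es: s => [//|D' s'] _ /=.
have : D' \in s by rewrite Es mem_head.
rewrite mem_filter => /andP[/andP[/allP h1 /allP h2] hD']; split => // l.
by apply/idP/idP; [apply: h1|apply: h2].
Qed.

(** Contraposition whose conclusion is the literal l, never a double negation. *)
Definition contrap (Z : form) (l : lit) : sstep :=
  if l.2 then s_cpos (FVar l.1) Z else s_cneg (FVar l.1) Z.

Definition andI (fs : seq form) (W : form) : seq sstep :=
  s_true W :: rctx (fun f s => if s is _ :: _ then [:: s_andI f (big_and s) W] else [::]) fs.

Definition ext_clauses (v : nat) (al : seq lit) (y z : lit) : seq clause :=
  let na := [seq neg l | l <- al] in
  [:: na ++ [:: (v, true); y]; na ++ [:: (v, true); z]; na ++ [:: (v, false); neg y; neg z]].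

(** An extension clause Z is proved indirectly: not Z refutes all its literals, hence makes [al]
    true, and then the extension axiom gives Z by one of the rules 15 to 17. *)
Definition ext_script (al : seq lit) (C : clause) : seq sstep :=
  inj (lits C) ++ [seq contrap (disj_form C) (neg m) | m <- C]
  ++ andI (lits al) (FNot (disj_form C)).

(** The extension of R, a negated conjunction, is in F the disjunction of [neg y] and [neg z]. *)
Definition r2f_extend (v : nat) (al : seq lit) (y z : lit) : seq sstep :=
  let na := [seq neg l | l <- al] in
  let C1 := na ++ [:: (v, true); y] in
  let C2 := na ++ [:: (v, true); z] in
  let C3 := na ++ [:: (v, false); neg y; neg z] in
  let fin s C := s (conj_form al) (FVar v) (lit_form (neg y)) (lit_form (neg z)) (disj_form C) in
  (ext_script al C1 ++ [:: fin s_ext1 C1]) ++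
  (ext_script al C2 ++ [:: fin s_ext2 C2]) ++
  (ext_script al C3 ++ [:: fin s_ext3 C3]).

(** Case distinction on x: the premise with the negative literal gives x implies Z, the other one
    gives not x implies Z, each by cases on its literals. *)
Definition r2f_resolve (G : seq clause) (E F : clause) (x : nat) : seq sstep :=
  let Z := disj_form (E ++ F) in
  inj (lits (E ++ F)) ++
  flatten [seq [:: s_lift (lit_form l) (FVar x) Z; s_lift (lit_form l) (FNot (FVar x)) Z]
          | l <- E ++ F] ++
  [:: s_neglift (FVar x) Z; s_poslift (FVar x) Z] ++
  cases (lits (prem G ((x, false) :: E))) (FImp (FVar x) Z) ++
  cases (lits (prem G ((x, true) :: F))) (FImp (FNot (FVar x)) Z) ++
  [:: s_case (FVar x) Z].

Definition falsified (u : lit) (l : lit) : form :=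
  if l.1 == u.1 then
    if l.2 then (if u.2 then FFalse else FTrue) else FNot (if u.2 then FFalse else FTrue)
  else lit_form l.

(** After the assignment the disjunct of u is 0 or the negation of 1, which implies anything by
    rules 3 and 10; the other disjuncts are literals of C. *)
Definition r2f_reduce (G : seq clause) (C : clause) (u : lit) : seq sstep :=
  inj (lits C) ++ [:: s_exf (disj_form C); s_notT (disj_form C)] ++
  cases [seq falsified u l | l <- prem G (u :: C)] (disj_form C).

Definition r2f (TT : seq ftemplate) (G : seq clause) (s : rstep) : seq fstep :=
  match s with
  | RAxiom C => fder TT (inj (lits C) ++ cases (lits (prem G C)) (disj_form C))
  | RReduce C u =>
      FReduce (disj_form (prem G (u :: C))) u.1 (~~ u.2) :: fder TT (r2f_reduce G C u)
  | RResolve E F x => fder TT (r2f_resolve G E F x)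
  | RExtend v al y z =>
      FExtend v al false [:: neg y; neg z] :: fder TT (r2f_extend v al y z)
  | RWeaken w => [:: FWeaken w]
  end.

(** Steps spell out their conclusions, so the available lines are a function of the earlier steps
    and the translation can recompute them from the history. *)
Definition rconc (s : rstep) : seq clause :=
  match s with
  | RAxiom C | RReduce C _ => [:: C]
  | RResolve E F _ => [:: E ++ F]
  | RExtend v al y z => ext_clauses v al y z
  | RWeaken _ => [::]
  end.

Definition r2f_all (TT : seq ftemplate) (M : seq clause) (pi : seq rstep) : seq fstep :=
  [seq FAxiom C | C <- M] ++
  pctx (fun d s => r2f TT (flatten [seq rconc t | t <- d] ++ M) s) [::] pi.

Lemma decl_lit V l : l.1 \in V -> decl_form V (lit_form l).
Proof. by move=> h x; rewrite /lit_form; case: (l.2); rewrite /= inE => /eqP->. Qed.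

Definition decl_clause (V : seq nat) (C : clause) : Prop := forall l, l \in C -> l.1 \in V.

Lemma decl_lits V C f : decl_clause V C -> f \in lits C -> decl_form V f.
Proof. by move=> h /mapP[l /h hl ->]; apply: decl_lit. Qed.

Lemma decl_disj V C : decl_clause V C -> decl_form V (disj_form C).
Proof. by move=> h; apply: decl_big_or => f; apply: decl_lits. Qed.

Lemma fvars_lits C : decl_form [seq l.1 | l <- C] (conj_form C) /\ decl_form [seq l.1 | l <- C] (disj_form C).
Proof.
have h f : f \in lits C -> decl_form [seq l.1 | l <- C] f.
  by case/mapP => l hl ->; apply/decl_lit/map_f.
by split; [apply: decl_big_and|apply: decl_big_or].
Qed.

Lemma negK : involutive neg.
Proof. by case=> x b; rewrite /neg /= negbK. Qed.

Lemma assign_falsified u C :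
  assign_const u.1 (~~ u.2) (disj_form C) = big_or [seq falsified u l | l <- C].
Proof.
rewrite /disj_form; elim: C => // l C IH.
have E : assign_const u.1 (~~ u.2) (lit_form l) = falsified u l.
  by rewrite /falsified /lit_form /assign_const; case: (l.2) => /=; case: ifP => //; case: (u.2).
case: C IH => [|l' C] IH; first exact: E.
by rewrite -[RHS]/(FOr (falsified u l) (big_or [seq falsified u m | m <- l' :: C])) -IH -E.
Qed.

(** * Correctness of the translation from R to F *)

Section Scripts.
Variable V : seq nat.
Notation srun := (srun (schemas ++ [::]) V).
Notation decl := (decl_form V).

Lemma srun_contra L Z C : decl Z -> decl_clause V C ->
  (forall m, m \in C -> FImp (lit_form m) Z \in L) ->
  srun L [seq contrap Z (neg m) | m <- C]
    (fun L' => {subset L <= L'} /\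
       forall m, m \in C -> FImp (FNot Z) (lit_form (neg m)) \in L').
Proof.
move=> dZ; elim: C L => [|m C IH] L dC hL; first by apply: srun_nil.
have dm : decl (FVar m.1) by move=> x; rewrite inE => /eqP->; apply/dC/mem_head.
have hm : FImp (lit_form m) Z \in L by apply/hL/mem_head.
rewrite map_cons; apply: (@srun_cons _ _ L (contrap Z (neg m)) _ _ _ _ _ _).
- by rewrite /contrap; case: ifP.
- by rewrite /contrap => A; case: ifP; rewrite !inE => _ /orP[] /eqP->.
- rewrite /contrap => A; case: m hm {dm hL dC} => x [] /=; rewrite inE => hm /eqP->; exact: hm.
move=> L1 s1 h1; have dC' : decl_clause V C by move=> l hl; apply: dC; rewrite inE hl orbT.
have h' n : n \in C -> FImp (lit_form n) Z \in L1 by move=> hn; apply/s1/hL; rewrite inE hn orbT.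
apply: srun_imp (IH L1 dC' h') => L' sL [_ h2]; split => [A /s1/sL//|n].
rewrite inE => /orP[/eqP->|/h2//]; apply: sL; move: h1; rewrite /contrap.
by case: (m) => x [].
Qed.

Lemma srun_andI L (fs : seq form) W : decl W -> (forall f, f \in fs -> decl f) ->
  (forall f, f \in fs -> FImp W f \in L) ->
  srun L (andI fs W) (fun L' => {subset L <= L'} /\ FImp W (big_and fs) \in L').
Proof.
move=> dW dfs hfs.
apply: srun_cons => // [A|L1 s1 h1]; first by in_seq.
apply: (@srun_imp _ _ _ _ (fun L' => FImp W (big_and fs) \in L')).
  by move=> L2 s2 h2; split => // A /s1/s2.
have {} hfs f : f \in fs -> FImp W f \in L1 by move/hfs/s1.
elim: fs dfs hfs => [|f [|g s] IH] dfs hfs.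
- by apply: srun_nil => L' sL; apply: sL.
- by apply: srun_nil => L' sL; apply/sL/hfs/mem_head.
have ds f' : f' \in g :: s -> decl f' by move=> h; apply: dfs; rewrite inE h orbT.
apply: srun_cat; apply: srun_imp (IH ds _) => [L2 s2 h2|f' hf']; last first.
  by apply: hfs; rewrite inE hf' orbT.
apply: srun_schema => //.
- rewrite /s_andI => A; rewrite !inE => /or3P[] /eqP-> //.
    by apply: dfs; rewrite mem_head.
  exact: decl_big_and.
- move=> A; rewrite !inE => /orP[] /eqP-> //; apply/s2/hfs; exact: mem_head.
Qed.

Lemma srun_ext_script L al C : decl_clause V C -> {subset [seq neg l | l <- al] <= C} ->
  srun L (ext_script al C) (fun L' => let Z := disj_form C in
    [/\ {subset L <= L'}, FImp (FNot Z) (conj_form al) \in L',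
       (forall m, m \in C -> FImp (lit_form m) Z \in L') &
       (forall m, m \in C -> FImp (FNot Z) (lit_form (neg m)) \in L')]).
Proof.
move=> dC sC; have dZ := decl_disj dC; have dl f := @decl_lits V C f dC.
apply: srun_cat; apply: srun_imp (srun_inj [::] L dl) => L1 s1 [_ h1].
have {}h1 m : m \in C -> FImp (lit_form m) (disj_form C) \in L1.
  by move=> hm; apply: h1; apply: map_f.
apply: srun_cat; apply: srun_imp (srun_contra dZ dC h1) => L2 s2 [_ h2].
have da l : l \in al -> decl (lit_form l).
  by move=> hl; apply: decl_lit; apply: (dC (neg l)); apply: sC; apply: map_f.
have ha f : f \in lits al -> FImp (FNot (disj_form C)) f \in L2.
  by case/mapP => l hl ->; have := h2 (neg l); rewrite negK; apply; apply: sC; apply: map_f.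
have daf f : f \in lits al -> decl f by case/mapP => l /da h ->.
apply: srun_imp (@srun_andI _ _ (FNot (disj_form C)) dZ daf ha) => L3 s3 [_ h3]; split => //.
- by move=> A /s1/s2/s3.
- by move=> m /h1/s2/s3.
- by move=> m /h2/s3.
Qed.
End Scripts.

Lemma declared_add_exis P v D x : (x \in declared (add_exis P v D)) = (x == v) || (x \in declared P).
Proof. by rewrite /declared /exvars /= !mem_cat inE orbCA. Qed.

Lemma declared_add_univ P u x : (x \in declared (add_univ P u)) = (x == u) || (x \in declared P).
Proof. by rewrite /declared /exvars /= inE. Qed.

Lemma uniq_add_exis P v D : fresh P v -> uniq (declared P) -> uniq (declared (add_exis P v D)).
Proof.
rewrite /fresh /declared /exvars /= mem_cat negb_or => /andP[h1 h2] h.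
by rewrite uniq_catC cons_uniq mem_cat negb_or h1 h2 uniq_catC.
Qed.

Lemma uniq_add_univ P u : fresh P u -> uniq (declared P) -> uniq (declared (add_univ P u)).
Proof. by rewrite /fresh /declared /exvars /= => -> ->. Qed.

Lemma weakens_mono P w P' : weakens P w P' -> {subset declared P <= declared P'}.
Proof. by case=> [u _|v D _ _] x hx; rewrite ?declared_add_univ ?declared_add_exis hx orbT. Qed.

Lemma weakens_uniq P w P' : weakens P w P' -> uniq (declared P) -> uniq (declared P').
Proof. by case=> [u|v D h _]; [exact: uniq_add_univ|exact: uniq_add_exis]. Qed.

Section R2F.
Variables (S : seq frule) (TT : seq ftemplate) (M : seq clause).
Hypothesis hTT : frege_templates S TT.

(** The matrix is included because all its clauses are derived in F at the start. Uniqueness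
    separates universal from existential variables for the reduction step. *)
Record r2f_inv (P : prefix) (GR : seq clause) (GF : seq form) : Prop := R2FInv {
  r2f_uniq : uniq (declared P);
  r2f_decl : forall C, C \in GR ++ M -> decl_clause (declared P) C;
  r2f_line : forall C, C \in GR ++ M -> disj_form C \in GF }.

Lemma r2f_inv1 P GR GF GF' C : r2f_inv P GR GF -> {subset GF <= GF'} ->
  decl_clause (declared P) C -> disj_form C \in GF' -> r2f_inv P (C :: GR) GF'.
Proof.
move=> [h1 h2 h3] sG dC hC; split => // D; rewrite /= inE => /orP[/eqP->//|].
  exact: h2.
by move/h3/sG.
Qed.

Lemma r2f_prem P GR GF C : r2f_inv P GR GF ->
  derived_clause GR C \/ derived_clause M C ->
  [/\ decl_clause (declared P) C, prem (GR ++ M) C =i C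
    & big_or (lits (prem (GR ++ M) C)) \in GF].
Proof.
move=> inv h; have {h}/premP[hin E] : derived_clause (GR ++ M) C.
  by case: h => -[D hD E]; exists D => //; rewrite mem_cat hD ?orbT.
by split => //; [move=> l; rewrite -E; apply: (r2f_decl inv)|apply: (r2f_line inv)].
Qed.

Lemma run_line P GR GF s C : r2f_inv P GR GF -> decl_clause (declared P) C ->
  srun (schemas ++ [::]) (declared P) GF s
    (fun L' => {subset GF <= L'} /\ disj_form C \in L') ->
  exists2 GF', run (frule_step S M) P GF (fder TT s) P GF' & r2f_inv P (C :: GR) GF'.
Proof.
move=> inv dC h; have [GF' r [sG [_ hC]]] := fder_run M hTT h.
by exists GF' => //; apply: r2f_inv1 inv sG dC hC.
Qed.

Lemma r2f_axiom P GR GF C : r2f_inv P GR GF -> derived_clause M C ->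
  exists2 GF', run (frule_step S M) P GF (r2f TT (GR ++ M) (RAxiom C)) P GF'
    & r2f_inv P (C :: GR) GF'.
Proof.
move=> inv hC; have [dC E hor] := r2f_prem inv (or_intror hC).
apply: (run_line inv dC); apply: srun_cat.
apply: srun_imp (srun_inj [::] GF (fun f => @decl_lits _ _ f dC)) => L1 s1 [_ h1].
apply: srun_imp (srun_cases [::] (decl_disj dC) _ _ (s1 _ hor)) => [L2 s2 [_ h2]|f|f].
- by split => // A /s1/s2.
- by case/mapP => l; rewrite E => /dC hl ->; apply: decl_lit.
- by case/mapP => l; rewrite E => hl ->; apply/h1/map_f.
Qed.

Lemma r2f_resolveP P GR GF E F x : r2f_inv P GR GF ->
  derived_clause GR ((x, false) :: E) -> derived_clause GR ((x, true) :: F) ->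
  exists2 GF', run (frule_step S M) P GF (r2f TT (GR ++ M) (RResolve E F x)) P GF'
    & r2f_inv P ((E ++ F) :: GR) GF'.
Proof.
move=> inv hE hF.
have [dE eE oE] := r2f_prem inv (or_introl hE).
have [dF eF oF] := r2f_prem inv (or_introl hF).
have dC : decl_clause (declared P) (E ++ F).
  by move=> l; rewrite mem_cat => /orP[h|h]; [apply: dE|apply: dF]; rewrite inE h orbT.
have dx : decl_form (declared P) (FVar x).
  by move=> y; rewrite inE => /eqP->; apply: (dE (x, false)); rewrite mem_head.
apply: (run_line inv dC); rewrite /r2f_resolve; set Z := disj_form (E ++ F).
have dZ : decl_form (declared P) Z by apply: decl_disj.
apply: srun_cat.
apply: srun_imp (srun_inj [::] GF (fun f => @decl_lits _ _ f dC)) => L1 s1 [_ h1].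
apply: srun_cat.
apply: (@srun_imp _ _ _ _ (fun L' => {subset L1 <= L'} /\ forall l, l \in E ++ F ->
   FImp (lit_form l) (FImp (FVar x) Z) \in L' /\
   FImp (lit_form l) (FImp (FNot (FVar x)) Z) \in L')); last first.
  have {}h1 l : l \in E ++ F -> FImp (lit_form l) Z \in L1 by move=> h; apply/h1/map_f.
  elim: (E ++ F) L1 {s1} h1 dC => [|l C IH] L1 h1 dC; first by apply: srun_nil.
  have dl : decl_form (declared P) (lit_form l) by apply/decl_lit/dC/mem_head.
  rewrite map_cons [flatten _]/=.
  apply: srun_cons => // [A|A|L2 s2 h2].
  - by in_seq.
  - by rewrite inE => /eqP->; apply/h1/mem_head.
  apply: srun_cons => // [A|A|L3 s3 h3].
  - by in_seq.
  - by rewrite inE => /eqP->; apply/s2/h1/mem_head.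
  apply: srun_imp (IH L3 _ _) => [L4 s4 [_ h4]|m hm|m hm].
  - split => [A /s2/s3/s4//|m]; rewrite inE => /orP[/eqP->|/h4//].
    by split; [apply/s4/s3|apply/s4].
  - by apply/s3/s2/h1; rewrite inE hm orbT.
  - by apply: dC; rewrite inE hm orbT.
move=> L2 s2 [_ h2].
apply: srun_cons => // [A|L3 s3 h3]; first by in_seq.
apply: srun_cons => // [A|L4 s4 h4]; first by in_seq.
have dx1 : decl_form (declared P) (FImp (FVar x) Z) by apply: decl_FImp.
have dx2 : decl_form (declared P) (FImp (FNot (FVar x)) Z) by apply: decl_FImp.
apply: srun_cat.
apply: srun_imp (srun_cases [::] dx1 _ _ _) => [L5 s5 [_ h5]|f|f|]; last first.
- exact/s4/s3/s2/s1.
- case/mapP => l; rewrite eE inE => /orP[/eqP->|hl] ->; first exact/s4.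
  by apply/s4/s3; apply: (h2 l _).1; rewrite mem_cat hl.
- by case/mapP => l; rewrite eE => /dE hl ->; apply: decl_lit.
apply: srun_cat.
apply: srun_imp (srun_cases [::] dx2 _ _ _) => [L6 s6 [_ h6]|f|f|]; last first.
- exact/s5/s4/s3/s2/s1.
- case/mapP => l; rewrite eF inE => /orP[/eqP->|hl] ->; first exact/s5.
  by apply/s5/s4/s3; apply: (h2 l _).2; rewrite mem_cat hl orbT.
- by case/mapP => l; rewrite eF => /dF hl ->; apply: decl_lit.
apply: srun_schema => // [A|A|L7 s7 h7].
- by in_seq.
- by rewrite !inE => /orP[] /eqP->; [apply: s6|].
by split => // A /s1/s2/s3/s4/s5/s6/s7.
Qed.

Lemma r2f_reduceP P GR GF C u : r2f_inv P GR GF ->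
  derived_clause GR (u :: C) -> u.1 \in univ P ->
  (forall l, l \in C -> l.1 \in exvars P -> u.1 \notin dep P l.1) -> neg u \notin C ->
  exists2 GF', run (frule_step S M) P GF (r2f TT (GR ++ M) (RReduce C u)) P GF'
    & r2f_inv P (C :: GR) GF'.
Proof.
move=> inv hC uu hdep nuC; have [dC' E hor] := r2f_prem inv (or_introl hC).
have dC : decl_clause (declared P) C by move=> l hl; apply: dC'; rewrite inE hl orbT.
set L := disj_form (prem (GR ++ M) (u :: C)).
have red : frule_step S M P GF (FReduce L u.1 (~~ u.2)) P [:: assign_const u.1 (~~ u.2) L].
  apply: FR_reduce => // x /(fvars_lits _).2/mapP[l]; rewrite E inE => /orP[/eqP->|hl] -> hx.
    (* The literal u itself does not block the reduction: its variable is universal, hence not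
       existential. *)
    by have := r2f_uniq inv; rewrite /declared cat_uniq => /and3P[_ /hasPn/(_ _ hx)]; rewrite uu.
  exact: hdep.
set GF1 := [:: assign_const u.1 (~~ u.2) L] ++ GF.
have inv1 : r2f_inv P GR GF1.
  by case: inv => h1 h2 h3; split => // D /h3 h; rewrite inE h orbT.
suff [GF' r i] : exists2 GF', run (frule_step S M) P GF1 (fder TT (r2f_reduce (GR ++ M) C u)) P GF'
    & r2f_inv P (C :: GR) GF'.
  by exists GF' => //; apply: RunCons red r.
apply: (run_line inv1 dC); rewrite /r2f_reduce; set Z := disj_form C.
have dZ : decl_form (declared P) Z by apply: decl_disj.
apply: srun_cat.
apply: srun_imp (srun_inj [::] GF1 (fun f => @decl_lits _ _ f dC)) => L1 s1 [_ h1].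
apply: srun_cons => // [A|L2 s2 h2]; first by rewrite !inE => /eqP->.
apply: srun_cons => // [A|L3 s3 h3]; first by rewrite !inE => /eqP->.
(* As [neg u] is excluded, u is the only literal of its variable, so no disjunct becomes true under
   the assignment. *)
have fal l : l \in u :: C -> l.1 == u.1 -> l = u.
  rewrite inE => /orP[/eqP//|hl] /eqP e1; apply/eqP; apply: contraNT nuC => ne.
  suff -> : neg u = l by [].
  by move: e1 ne; case: (l) (u) => [x b] [y c] /= ->; rewrite /neg xpair_eqE eqxx /=; case: b c => [] [].
apply: srun_imp (srun_cases [::] dZ _ _ _) => [L4 s4 [_ h4]|f|f|].
- by split => // A /s1/s2/s3/s4.
- case/mapP => l; rewrite E => hl ->; rewrite /falsified.
  by case: ifP => _; [case: (l.2); case: (u.2)|apply/decl_lit/dC'].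
- case/mapP => l; rewrite E => hl ->; rewrite /falsified.
  case: ifP => [/(fal _ hl) ->|ne].
    by case: (u.2); [apply/s3|].
  apply/s3/s2/h1; apply: map_f; move: hl; rewrite inE => /orP[/eqP e|//].
  by rewrite e eqxx in ne.
- by apply/s3/s2/s1; rewrite -assign_falsified mem_head.
Qed.

Lemma r2f_extendP P GR GF v al y z : r2f_inv P GR GF -> ext_ok P v al [:: y; z] ->
  exists2 GF', run (frule_step S M) P GF (r2f TT (GR ++ M) (RExtend v al y z))
      (add_exis P v (ext_deps P al [:: y; z])) GF'
    & r2f_inv (add_exis P v (ext_deps P al [:: y; z])) (ext_clauses v al y z ++ GR) GF'.
Proof.
move=> [i1 i2 i3] ok; have [fv hal hy] := ok.
set P' := add_exis _ _ _.
set Lx := FImp (conj_form al) (FIff (FVar v) (disj_form [:: neg y; neg z])).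
have ext : frule_step S M P GF (FExtend v al false [:: neg y; neg z]) P' [:: Lx].
  (* Dependency sets only look at variables, so negating both literals changes nothing. *)
  have -> : P' = add_exis P v (ext_deps P al [:: neg y; neg z]) by [].
  apply: FR_extend; split => // m; in_seq.
    by apply: (hy y); rewrite mem_head.
  by apply: (hy z); rewrite !inE eqxx orbT.
have dP x : x \in declared P -> x \in declared P' by rewrite declared_add_exis => ->; rewrite orbT.
have inv : r2f_inv P' GR (Lx :: GF).
  split; first exact: uniq_add_exis.
    by move=> C hC l hl; apply/dP/(i2 C hC).
  by move=> C /i3 h; rewrite inE h orbT.
have dv : v \in declared P' by rewrite declared_add_exis eqxx.
have dy : y.1 \in declared P' by apply/dP/hy; rewrite mem_head.
have dz : z.1 \in declared P' by apply/dP/hy; rewrite !inE eqxx orbT.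
have dal l : l \in al -> l.1 \in declared P'.
  by move=> /hal h; apply/dP; rewrite /declared mem_cat h.
have dna l : l \in [seq neg m | m <- al] -> l.1 \in declared P' by case/mapP => m /dal h ->.
have dvf : decl_form (declared P') (FVar v) by move=> x; in_seq.
have dyf : decl_form (declared P') (lit_form (neg y)) by apply: decl_lit.
have dzf : decl_form (declared P') (lit_form (neg z)) by apply: decl_lit.
have daf : decl_form (declared P') (conj_form al).
  by apply: decl_big_and => f /mapP[l /dal hl ->]; apply: decl_lit.
have Lx0 : Lx \in Lx :: GF by rewrite mem_head.
suff [GF' r i] : exists2 GF', run (frule_step S M) P' (Lx :: GF) (fder TT (r2f_extend v al y z)) P' GF'
    & r2f_inv P' (ext_clauses v al y z ++ GR) GF'.
  by exists GF' => //; apply: RunCons ext r.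
set na := [seq neg m | m <- al] in dna *.
have dC C : C \in ext_clauses v al y z -> decl_clause (declared P') C.
  rewrite !inE => /or3P[] /eqP-> l; rewrite mem_cat !inE => /orP[/dna//|];
    by [case/orP => /eqP-> | case/or3P => /eqP->].
have sna C D : C = na ++ D -> {subset na <= C} by move=> -> x hx; rewrite mem_cat hx.
have mna C D m : C = na ++ D -> m \in D -> m \in C by move=> -> hx; rewrite mem_cat hx orbT.
suff h : srun (schemas ++ [::]) (declared P') (Lx :: GF) (r2f_extend v al y z)
   (fun L' => {subset Lx :: GF <= L'} /\ forall C, C \in ext_clauses v al y z -> disj_form C \in L').
  have [GF' r [_ [sG hC]]] := fder_run M hTT h; exists GF' => //.
  case: inv => j1 j2 j3; split => // C; rewrite -catA mem_cat => /orP[].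
  - exact: dC.
  - exact: j2.
  - exact: hC.
  - by move/j3/sG.
rewrite /r2f_extend -/na.
set C1 := na ++ _; set C2 := na ++ _; set C3 := na ++ _.
have d1 : decl_clause (declared P') C1 by apply: dC; rewrite !inE eqxx ?orbT.
have d2 : decl_clause (declared P') C2 by apply: dC; rewrite !inE eqxx ?orbT.
have d3 : decl_clause (declared P') C3 by apply: dC; rewrite !inE eqxx ?orbT.
have dargs C A : decl_clause (declared P') C ->
  A \in [:: conj_form al; FVar v; lit_form (neg y); lit_form (neg z); disj_form C] ->
  decl_form (declared P') A.
  move=> h; rewrite !inE => /orP[/eqP->//|/or4P[] /eqP->//]; exact: decl_disj.
apply: srun_cat; apply: srun_cat.
apply: srun_imp (srun_ext_script _ d1 (sna _ _ erefl)) => L1 s1 [_ a1 _ b1].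
apply: srun_schema => // [A|A|L2 s2 h2]; first exact: dargs.
  rewrite !inE => /or4P[] /eqP-> //; first exact: s1.
    by apply: (b1 (v, true)); apply: (mna _ _ _ erefl); rewrite !inE eqxx.
  by apply: (b1 y); apply: (mna _ _ _ erefl); rewrite !inE eqxx orbT.
apply: srun_cat; apply: srun_cat.
apply: srun_imp (srun_ext_script _ d2 (sna _ _ erefl)) => L3 s3 [_ a3 _ b3].
apply: srun_schema => // [A|A|L4 s4 h4]; first exact: dargs.
  rewrite !inE => /or4P[] /eqP-> //; first exact/s3/s2/s1.
    by apply: (b3 (v, true)); apply: (mna _ _ _ erefl); rewrite !inE eqxx.
  by apply: (b3 z); apply: (mna _ _ _ erefl); rewrite !inE eqxx orbT.
apply: srun_cat.
apply: srun_imp (srun_ext_script _ d3 (sna _ _ erefl)) => L5 s5 [_ a5 c5 b5].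
apply: srun_schema => // [A|A|L6 s6 h6]; first exact: dargs.
  rewrite !inE => /orP[/eqP->//|/or4P[] /eqP-> //]; first exact/s5/s4/s3/s2/s1.
  - by apply: (b5 (v, false)); apply: (mna _ _ _ erefl); rewrite !inE eqxx.
  - by apply: c5; apply: (mna _ _ _ erefl); rewrite !inE eqxx ?orbT.
  - by apply: c5; apply: (mna _ _ _ erefl); rewrite !inE eqxx ?orbT.
split => [A /s1/s2/s3/s4/s5/s6//|C]; rewrite !inE => /or3P[] /eqP-> //.
- by apply/s6/s5/s4/s3.
- by apply/s6/s5.
Qed.

Lemma r2f_sim P GR GF d pi : GR = flatten [seq rconc t | t <- d] -> r2f_inv P GR GF ->
  refutes (rrule M) [::] P GR pi ->
  refutes (frule_step S M) FFalse P GF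
    (pctx (fun d s => r2f TT (flatten [seq rconc t | t <- d] ++ M) s) d pi).
Proof.
move=> E inv h; elim: h d GF E inv => {P GR pi} [P G hbot|P G s pi P' new hs _ IH] d GF E inv /=.
  by apply: RefDone; apply: (r2f_line inv (C := [::])); rewrite mem_cat hbot.
rewrite -E.
suff [GF' r [i En]] : exists2 GF', run (frule_step S M) P GF (r2f TT (G ++ M) s) P' GF'
    & r2f_inv P' (new ++ G) GF' /\ new = rconc s.
  by apply: refutes_run r _; apply: IH => //; rewrite /= -E -En.
case: hs inv => {s P' new E IH}.
- by move=> C hC inv; have [GF' r i] := r2f_axiom inv hC; exists GF'.
- by move=> C u h1 h2 h3 h4 inv; have [GF' r i] := r2f_reduceP inv h1 h2 h3 h4; exists GF'.
- by move=> E F x h1 h2 inv; have [GF' r i] := r2f_resolveP inv h1 h2; exists GF'.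
- by move=> v al y z ok na inv; have [GF' r i] := r2f_extendP inv ok; exists GF'.
move=> w P' hw [i1 i2 i3]; exists GF.
  by apply: (@run1 _ _ _ _ _ _ _ [::]); apply: FR_weaken.
split => //; split; [exact: weakens_uniq hw i1| |exact: i3].
by move=> C hC l hl; apply/(weakens_mono hw)/(i2 C hC).
Qed.

Lemma r2f_allP P pi : uniq (declared P) -> (forall C, C \in M -> decl_clause (declared P) C) ->
  refutes (rrule M) [::] P [::] pi ->
  refutes (frule_step S M) FFalse P [::] (r2f_all TT M pi).
Proof.
move=> uP dM h.
have [GF r hGF] : exists2 GF, run (frule_step S M) P [::] [seq FAxiom C | C <- M] P GF
    & forall C, C \in M -> disj_form C \in GF.
  suff ax N G : {subset N <= M} -> exists2 GF, run (frule_step S M) P G [seq FAxiom C | C <- N] P GF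
    & {subset G <= GF} /\ forall C, C \in N -> disj_form C \in GF.
    by have [//|GF r [_ h']] := ax M [::]; exists GF.
  elim: N G => [|C N IH] G sM; first by exists G; [exact: RunNil|split].
  have [|GF r [sG hGF]] := IH (disj_form C :: G); first by move=> D hD; apply: sM; rewrite inE hD orbT.
  exists GF.
    by apply: (@RunCons _ _ _ _ _ _ _ _ [:: disj_form C]) r; apply/FR_axiom/sM/mem_head.
  split => [A hA|D]; first by apply: sG; rewrite inE hA orbT.
  by rewrite inE => /orP[/eqP->|/hGF//]; apply/sG/mem_head.
apply: refutes_run r _; apply: r2f_sim h => //.
Qed.
End R2F.

(** * Polynomial time of the translation from R to F *)

Ltac pt_hyp := match goal with H : pt _ _ ?f |- pt _ _ _ =>
  first [is_var f | is_const f]; apply: (pt_app H) end.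
Ltac pt_user ::= pt_hyp.

Notation enc_script := (enc_seq (enc_pair enc_nat (enc_seq enc_form))).

Section PolyScripts.
Context (A : Type) (eA : A -> tree).

Lemma pt_inj fs : pt eA (enc_seq enc_form) fs -> pt eA enc_script (fun a => inj (fs a)).
Proof. by move=> h; rewrite /inj /injs; ptt. Qed.

Lemma pt_cases fs Z : pt eA (enc_seq enc_form) fs -> pt eA enc_form Z ->
  pt eA enc_script (fun a => cases (fs a) (Z a)).
Proof. by move=> hf hZ; rewrite /cases; ptt. Qed.

Lemma pt_andI fs W : pt eA (enc_seq enc_form) fs -> pt eA enc_form W ->
  pt eA enc_script (fun a => andI (fs a) (W a)).
Proof. by move=> hf hZ; rewrite /andI; ptt. Qed.

Lemma pt_lits C : pt eA (enc_seq enc_lit) C -> pt eA (enc_seq enc_form) (fun a => lits (C a)).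
Proof. by move=> h; rewrite /lits; apply: pt_map; [|apply: pt_lit_form]; ptt. Qed.

Lemma pt_disj_form C : pt eA (enc_seq enc_lit) C -> pt eA enc_form (fun a => disj_form (C a)).
Proof. by move=> h; apply: pt_big_or; apply: pt_lits. Qed.

Lemma pt_conj_form C : pt eA (enc_seq enc_lit) C -> pt eA enc_form (fun a => conj_form (C a)).
Proof. by move=> h; apply: pt_big_and; apply: pt_lits. Qed.

End PolyScripts.

Ltac pt_scripts := first [ pt_hyp
  | apply: pt_inj | apply: pt_cases | apply: pt_andI | apply: pt_lits
  | apply: pt_disj_form | apply: pt_conj_form | apply: pt_neg_lit | apply: pt_lit_form ].
Ltac pt_user ::= pt_scripts.

Section PolyR2F.
Context (A : Type) (eA : A -> tree).

Lemma pt_prem G C : pt eA (enc_seq (enc_seq enc_lit)) G -> pt eA (enc_seq enc_lit) C ->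
  pt eA (enc_seq enc_lit) (fun a => prem (G a) (C a)).
Proof. by move=> hG hC; rewrite /prem; apply: pt_head; ptt. Qed.

Lemma pt_fder TT s : pt eA enc_script s -> pt eA (enc_seq enc_fstep) (fun a => fder TT (s a)).
Proof.
move=> hs; rewrite /fder; apply: (pt_flatten_map hs).
apply: (@pt_select _ _ _ _ _ _ _ _ (fun T (q : A * sstep) => der T q.2.2)); first by ptt.
move=> T; rewrite /der; elim: T => [|[r tau] T IH] /=; first exact: pt_const.
apply: pt_cons => //; apply: pt_FFrege; first exact: pt_const.
elim: tau => [|f tau IHt] /=; first exact: pt_const.
by apply: pt_cons => //; apply: pt_inst; ptt.
Qed.

Lemma pt_falsified u l : pt eA enc_lit u -> pt eA enc_lit l ->
  pt eA enc_form (fun a => falsified (u a) (l a)).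
Proof. by move=> hu hl; rewrite /falsified; ptt. Qed.

Lemma pt_ext_script al C : pt eA (enc_seq enc_lit) al -> pt eA (enc_seq enc_lit) C ->
  pt eA enc_script (fun a => ext_script (al a) (C a)).
Proof.
move=> hal hC; rewrite /ext_script; apply: pt_cat; first by ptt.
apply: pt_cat; last by ptt.
by apply: pt_map; [|rewrite /contrap]; ptt.
Qed.

End PolyR2F.

Ltac pt_user ::= first
  [ pt_scripts | apply: pt_prem | apply: pt_fder | apply: pt_falsified | apply: pt_ext_script ].

Section PolyR2F.
Context (A : Type) (eA : A -> tree).
Notation enc_lits := (enc_seq enc_lit).

Lemma pt_r2f_extend v al y z : pt eA enc_nat v -> pt eA enc_lits al -> pt eA enc_lit y ->
  pt eA enc_lit z -> pt eA enc_script (fun a => r2f_extend (v a) (al a) (y a) (z a)).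
Proof. by move=> *; rewrite /r2f_extend; ptt. Qed.

Lemma pt_r2f_resolve G E F x : pt eA (enc_seq enc_lits) G -> pt eA enc_lits E ->
  pt eA enc_lits F -> pt eA enc_nat x ->
  pt eA enc_script (fun a => r2f_resolve (G a) (E a) (F a) (x a)).
Proof. by move=> *; rewrite /r2f_resolve; ptt. Qed.

Lemma pt_r2f_reduce G C u : pt eA (enc_seq enc_lits) G -> pt eA enc_lits C ->
  pt eA enc_lit u -> pt eA enc_script (fun a => r2f_reduce (G a) (C a) (u a)).
Proof. by move=> *; rewrite /r2f_reduce; ptt. Qed.

End PolyR2F.

Section PolyR2FStep.
Context (A : Type) (eA : A -> tree).
Notation enc_lits := (enc_seq enc_lit).

Lemma pt_r2f TT G s : pt eA (enc_seq enc_lits) G -> pt eA enc_rstep s ->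
  pt eA (enc_seq enc_fstep) (fun a => r2f TT (G a) (s a)).
Proof.
move=> hG hs; rewrite /r2f; apply: pt_rstep_case => //.
- by ptt.
- by apply: pt_cons; [ptt|apply: pt_fder; apply: pt_r2f_reduce; ptt].
- by apply: pt_fder; apply: pt_r2f_resolve; ptt.
- by apply: pt_cons; [ptt|apply: pt_fder; apply: pt_r2f_extend; ptt].
- by ptt.
Qed.

Lemma pt_rconc s : pt eA enc_rstep s -> pt eA (enc_seq enc_lits) (fun a => rconc (s a)).
Proof. by move=> hs; rewrite /rconc /ext_clauses; ptt. Qed.

End PolyR2FStep.

Lemma p_simulates_F_R (S : seq frule) : frege_system S -> p_simulates (F_system S) R_system.
Proof.
move=> /exists_templates[TT hTT].
have [f hf fE] : pt (enc_pair enc_dqbf (enc_seq enc_rstep)) (enc_pair enc_dqbf (enc_seq enc_fstep))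
    (fun q => (q.1, r2f_all TT (matrix q.1) q.2)).
  have hM : pt enc_dqbf (enc_seq (enc_seq enc_lit)) matrix.
    by exists rgt; [exact: PT_rgt|].
  apply: pt_pair; first by apply: pt_fst; ptt.
  rewrite /r2f_all; apply: pt_cat; first by ptt.
  apply: pt_pctx; first by ptt.
  cbv beta; apply: pt_r2f; last by ptt.
  by apply: pt_cat; [apply: pt_flatten_map; [|apply: pt_rconc]|]; ptt.
exists f; first exact: PT_polytime.
move=> Phi pi [wf h]; exists (r2f_all TT (matrix Phi) pi); last exact: (fE (Phi, pi)).
by split => //; apply: r2f_allP h => //; [case: wf => -[]|move=> C hC l hl; case: wf => _; apply; eassumption].
Qed.

(** * Completeness of resolution *)

Section Resolution.
Variable V : eqType.
Implicit Types (K : seq (seq (V * bool))) (C D E F N : seq (V * bool)) (rho : V -> bool).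

(** Later V is [form]: the propositional variables are the formulas themselves, and substitution
    acts on whole resolution derivations. *)
Inductive rd K : seq (V * bool) -> Prop :=
| RdHyp C : C \in K -> rd K C
| RdRes C D E F x : rd K C -> rd K D ->
    C =i (x, false) :: E -> D =i (x, true) :: F -> rd K (E ++ F).

Definition sat rho C : bool := has (fun l => rho l.1 == l.2) C.

Lemma rd_sound K rho C : all (sat rho) K -> rd K C -> sat rho C.
Proof.
move=> /allP hK; elim=> {C} [C /hK//|C D E F x _ IH1 _ IH2 eC eD].
rewrite /sat has_cat; apply/orP; case/hasP: IH1 => l; rewrite eC inE => /orP[/eqP-> /= /eqP hx|hl h].
  case/hasP: IH2 => m; rewrite eD inE => /orP[/eqP->|hm h]; first by rewrite /= hx.
  by right; apply/hasP; exists m.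
by left; apply/hasP; exists l.
Qed.

Lemma rd_mono K K' C : {subset K <= K'} -> rd K C -> rd K' C.
Proof.
move=> s; elim=> {C} [C /s h|C D E F x _ h1 _ h2 eC eD]; first exact: RdHyp.
exact: RdRes h1 h2 eC eD.
Qed.

(** Induction along a decision tree. N lists the literals made false so far, xs the variables still
    open; a falsifying valuation of N says that the branch is consistent. *)
Lemma rd_tree K (xs : seq V) N :
  (forall C l, C \in K -> l \in C -> l.1 \in xs \/ l.1 \in [seq m.1 | m <- N]) ->
  (exists rho, ~~ sat rho N) ->
  (forall rho, all (sat rho) K -> sat rho N) -> exists2 D, {subset D <= N} & rd K D.
Proof.
elim: xs N => [|x xs IH] N hat [rho0 h0] hent.
  (* All variables are decided. A falsified clause of K has only false literals, and N contains the
     false literal of each of its variables. *)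
  have /allPn[C hC nC] : ~~ all (sat rho0) K by apply/negP => h; case/negP: h0; apply: hent.
  exists C; last exact: RdHyp.
  move=> l hl; have [//|/mapP[m hm e]] := hat C l hC hl.
  have -> // : l = m.
  have nl : rho0 l.1 != l.2 by apply: contra nC => h; apply/hasP; exists l.
  have nm : rho0 m.1 != m.2 by apply: contra h0 => h; apply/hasP; exists m.
  move: e nl nm; case: (l) (m) => [y b] [y' b'] /= -> .
  by case: (rho0 y') b b' => [] [] [].
have [hx|hx] := boolP (x \in [seq m.1 | m <- N]).
  apply: IH => // [C l hC hl|]; last by exists rho0.
  by have := hat C l hC hl; rewrite inE => -[/orP[/eqP->|]|]; [right|left|right].
have ext b : exists2 D, {subset D <= (x, b) :: N} & rd K D.
  apply: IH => [C l hC hl||rho hK].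
  - have := hat C l hC hl; rewrite map_cons /= !inE => -[/orP[->|->]|->]; rewrite ?orbT; by [right|left|right].
  - exists (fun y => if y == x then ~~ b else rho0 y); rewrite /sat /= eqxx.
    apply/norP; split; first by case: b.
    apply: contra h0 => /hasP[m hm h]; apply/hasP; exists m => //.
    by move: h; case: (m.1 =P x) => // e; rewrite -e map_f in hx.
  - by rewrite /sat /=; apply/orP; right; apply: hent.
have [D1 s1 r1] := ext false; have [D2 s2 r2] := ext true.
(* A branch whose clause avoids x already gives a subclause of N; otherwise the two clauses are
   resolved on x. *)
have [h1|h1] := boolP ((x, false) \in D1); last first.
  exists D1 => // l hl; have := s1 l hl; rewrite inE => /orP[/eqP e|//].
  by rewrite -e hl in h1.
have [h2|h2] := boolP ((x, true) \in D2); last first.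
  exists D2 => // l hl; have := s2 l hl; rewrite inE => /orP[/eqP e|//].
  by rewrite -e hl in h2.
have splitE l0 D : l0 \in D -> D =i l0 :: [seq l <- D | l != l0].
  by move=> h l; rewrite inE mem_filter; case: eqP => // ->.
exists ([seq l <- D1 | l != (x, false)] ++ [seq l <- D2 | l != (x, true)]).
  move=> l; rewrite mem_cat !mem_filter => /orP[] /andP[ne].
    by move/s1; rewrite inE (negbTE ne).
  by move/s2; rewrite inE (negbTE ne).
exact: RdRes r1 r2 (splitE _ _ h1) (splitE _ _ h2).
Qed.

Lemma rd_complete K C : (exists rho, ~~ sat rho C) ->
  (forall rho, all (sat rho) K -> sat rho C) -> exists2 D, {subset D <= C} & rd K D.
Proof.
apply: (@rd_tree K [seq l.1 | l <- flatten K]) => D l hD hl; left.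
by apply/map_f/flattenP; exists D.
Qed.

End Resolution.

(** * Gate clauses of formulas *)

Definition sform : eqType := (form * bool)%type.
Definition sneg (s : sform) : sform := (s.1, ~~ s.2).

(* A compound formula stands for a gate [v = ~ (in1 /\ in2)], where [v] is the
   formula itself if [pol] holds and its negation otherwise. *)
Definition pol (X : form) : bool := match X with FAnd _ _ | FIff _ _ => false | _ => true end.
Definition in1 (X : form) : sform :=
  match X with
  | FNot B | FAnd B _ | FImp B _ => (B, true)
  | FOr B _ => (B, false)
  | FIff B C => (FImp B C, true)
  | _ => (X, true)
  end.
Definition in2 (X : form) : sform :=
  match X with
  | FNot B | FAnd _ B => (B, true)
  | FOr _ B | FImp _ B => (B, false)
  | FIff B C => (FImp C B, true)
  | _ => (X, true)
  end.
(** The inputs of the gate for an equivalence are two implications, which need not be subformulas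
    and so bring gates of their own, listed first. *)
Definition gates (X : form) : seq form :=
  match X with
  | FVar _ | FTrue | FFalse => [::]
  | FIff B C => [:: FImp B C; FImp C B; X]
  | _ => [:: X]
  end.

Definition gate_clauses (X : form) : seq (seq sform) :=
  [:: [:: (X, pol X); in1 X]; [:: (X, pol X); in2 X];
      [:: sneg (X, pol X); sneg (in1 X); sneg (in2 X)]].

Definition local_clauses (X : form) : seq (seq sform) :=
  match X with
  | FTrue => [:: [:: (FTrue, true)]]
  | FFalse => [:: [:: (FFalse, false)]]
  | _ => flatten [seq gate_clauses Y | Y <- gates X]
  end.

Definition def_clauses (T : form) : seq (seq sform) :=
  flatten [seq local_clauses X | X <- subs T].

Lemma def_clauses_sat r T : all (sat (feval r)) (def_clauses T).
Proof.
apply/allP => C /flattenP[Cs /mapP[X _ ->]].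
by apply/allP: C; case: X => [x|||B|B C|B C|B C|B C] //=; rewrite /sat /=;
  case: (feval r B) => //=; case: (feval r C).
Qed.

(** Valuations of formulas are arbitrary a priori; the gate clauses force the value of T to be the
    truth value. Hence the unit clause of a tautology follows from them. *)
Lemma def_clauses_eval rho T : all (sat rho) (def_clauses T) ->
  rho T = feval (fun x => rho (FVar x)) T.
Proof.
have cat A B C : all (sat rho) (flatten [seq local_clauses X | X <- A ++ B ++ C]) ->
    [/\ all (sat rho) (flatten [seq local_clauses X | X <- A]),
        all (sat rho) (flatten [seq local_clauses X | X <- B]) &
        all (sat rho) (flatten [seq local_clauses X | X <- C])].
  by rewrite !map_cat !flatten_cat !all_cat => /and3P.
rewrite /def_clauses; elim: T => [x|||B IHB|B IHB C IHC|B IHB C IHC|B IHB C IHC|B IHB C IHC] //.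
- by rewrite /= /sat /=; case: (rho _).
- by rewrite /= /sat /=; case: (rho _).
- rewrite [subs _]/= -[subs B ++ _]/(subs B ++ [::] ++ [:: FNot B]).
  by case/cat => /IHB /= <- _; rewrite /sat /=; case: (rho B); case: (rho (FNot B)).
1-3: by case/cat => /IHB /= <- /IHC /= <-; rewrite /sat /=; do 3 case: (rho _).
case/cat => /IHB /= <- /IHC /= <-; rewrite /sat /=.
by case: (rho B); case: (rho C); case: (rho (FImp B C)); case: (rho (FImp C B)); case: (rho (FIff B C)).
Qed.

Lemma rd_tautology T : (forall r, feval r T) ->
  exists2 D, rd (def_clauses T) D & D =i [:: (T, true)].
Proof.
move=> taut.
have [||D sD rD] := @rd_complete _ (def_clauses T) [:: (T, true)].
- by exists (fun=> false); rewrite /sat.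
- by move=> rho /def_clauses_eval e; rewrite /sat /= e taut.
exists D => // l; apply/idP/idP; first exact: sD.
(* Completeness yields only a subclause of the unit clause. It is not empty, because evaluation
   satisfies the gate clauses. *)
rewrite inE => /eqP->; have := rd_sound (def_clauses_sat xpred0 T) rD.
by case/hasP => m hm _; have := sD _ hm; rewrite inE => /eqP <-.
Qed.

Definition rule_form (R : frule) : form := foldr FImp (conclusion R) (premises R).

Lemma rd_rule R : sound_rule R ->
  exists2 D, rd (def_clauses (rule_form R) ++ [seq [:: (H, true)] | H <- premises R]) D
    & D =i [:: (conclusion R, true)].
Proof.
move=> sR; set K := _ ++ _.
have [|D rD eD] := @rd_tautology (rule_form R).
  move=> r; rewrite /rule_form; have := sR r.
  elim: (premises R) => [|H Hs IH] h /=; first exact: h.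
  apply/implyP => hH; apply: IH => hh; apply: h => H'; rewrite inE => /orP[/eqP->//|]; exact: hh.
have {}rD : rd K D by apply: rd_mono rD => C hC; rewrite mem_cat hC.
have : {subset [seq [:: (H, true)] | H <- premises R] <= K} by move=> C hC; rewrite mem_cat hC orbT.
have : {subset def_clauses (rule_form R) <= K} by move=> C hC; rewrite mem_cat hC.
move: K rD eD; rewrite /rule_form; elim: (premises R) D => [|H Hs IH] D K rD eD sK hK.
  by exists D.
set T := foldr _ _ Hs in IH; have eT : foldr FImp (conclusion R) (H :: Hs) = FImp H T by [].
rewrite eT in eD sK.
(* Modus ponens: this gate clause is resolved with the unit clauses of the implication and of H. *)
have g : [:: (FImp H T, false); (H, false); (T, true)] \in K.
  apply: sK; rewrite /def_clauses [subs _]/= !map_cat !flatten_cat !mem_cat.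
  by apply/orP; right; apply/orP; right; rewrite /= !inE eqxx !orbT.
have r1 : rd K ([:: (H, false); (T, true)] ++ [::]).
  exact: RdRes (RdHyp g) rD (fun _ => erefl) eD.
have r2 : rd K ([:: (T, true)] ++ [::]).
  by apply: RdRes r1 (RdHyp (hK _ _)) (fun _ => erefl) (fun _ => erefl); rewrite mem_head.
apply: IH r2 (fun _ => erefl) _ _ => C hC.
  by apply: sK; rewrite /def_clauses [subs _]/= !map_cat !flatten_cat !mem_cat hC orbT.
by apply: hK; rewrite inE hC orbT.
Qed.

(** * From F to R *)

HB.instance Definition _ := Equality.copy rstep (inj_type enc_rstep_inj).

Section WeakRuns.
Variable M : seq clause.

(* The translation emits the definition of a formula at each use; in a weak run
   a repeated step does nothing, and [undup_steps] drops it. *)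
Inductive wrun : seq rstep -> prefix -> seq clause -> seq rstep ->
    seq rstep -> prefix -> seq clause -> Prop :=
| WNil d P G : wrun d P G [::] d P G
| WSkip d P G s pi d' P' G' :
    s \in d -> wrun d P G pi d' P' G' -> wrun d P G (s :: pi) d' P' G'
| WStep d P G s P1 new pi d' P' G' :
    s \notin d -> rrule M P G s P1 new -> wrun (s :: d) P1 (new ++ G) pi d' P' G' ->
    wrun d P G (s :: pi) d' P' G'.

Definition undup_steps (pi : seq rstep) : seq rstep :=
  pctx (fun d s => if s \in d then [::] else [:: s]) [::] pi.

Lemma refutes_undup_steps P pi d' P' G' : wrun [::] P [::] pi d' P' G' -> [::] \in G' ->
  refutes (rrule M) [::] P [::] (undup_steps pi).
Proof.
move=> h hG; rewrite /undup_steps.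
suff sim d P0 G pi0 d2 P2 G2 : wrun d P0 G pi0 d2 P2 G2 -> [::] \in G2 ->
    (* The history passed by [pctx] contains the skipped steps again, so it agrees with d only as a
       set. *)
    forall e, e =i d ->
    refutes (rrule M) [::] P0 G (pctx (fun d s => if s \in d then [::] else [:: s]) e pi0).
  exact: (sim _ _ _ _ _ _ _ h hG).
elim=> {d P0 G pi0 d2 P2 G2 h hG} [d P0 G|d P0 G s pi0 d2 P2 G2 hs _ IH|
    d P0 G s P1 new pi0 d2 P2 G2 hs hr _ IH] hG e he /=.
- exact: RefDone.
- rewrite he hs; apply: IH => // t; rewrite inE he; by case: eqP => [->|].
- by rewrite he (negbTE hs); apply: RefStep hr _; apply: IH => // t; rewrite !inE he.
Qed.

Lemma wrun_cat d P G s1 d1 P1 G1 s2 d2 P2 G2 :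
  wrun d P G s1 d1 P1 G1 -> wrun d1 P1 G1 s2 d2 P2 G2 -> wrun d P G (s1 ++ s2) d2 P2 G2.
Proof.
elim=> // {d P G s1 d1 P1 G1} [d P G s pi d' P' G' hs _ IH h|d P G s P1 new pi d' P' G' hs hr _ IH h].
  by apply: WSkip hs (IH h).
by apply: WStep hs hr (IH h).
Qed.

End WeakRuns.

(** * Names of formulas and translation of the steps of F *)

Definition rres (E F : clause) (l : lit) : rstep :=
  if l.2 then RResolve E F l.1 else RResolve F E l.1.

Section Names.
(* The numbers [code _ (code t 1)] exceed those that occur in the encoding [t]. *)
Variable t : tree.

Definition name (X : form) : nat := code (enc_form X) (code t 1).
(** No formula is encoded by [Leaf], so this variable is not a name. *)
Definition zvar : nat := code Leaf (code t 1).
Definition tvar : nat := name FTrue.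

(** Variables keep their numbers, the two constants are the literals of [tvar], and a compound
    formula of negative polarity is the negative literal of its gate variable. *)
Definition flit (X : form) : lit :=
  match X with
  | FVar x => (x, true)
  | FTrue => (tvar, true)
  | FFalse => (tvar, false)
  | _ => (name X, pol X)
  end.

Definition slit (s : sform) : lit := if s.2 then flit s.1 else neg (flit s.1).

Definition gate_step (X : form) : rstep := RExtend (name X) [::] (slit (in1 X)) (slit (in2 X)).

Definition ensure (X : form) : seq rstep :=
  flatten [seq [seq gate_step Z | Z <- gates Y] | Y <- subs X].

(** An entry (E, (F, X)) stands for a resolution on the formula X with metavariables, from E with
    not X and F with X. *)
Definition rtemplate : Type := seq (seq sform * (seq sform * form)).

Definition inst_clause (sigma : seq form) (C : seq sform) : clause :=
  [seq slit (inst sigma s.1, s.2) | s <- C].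

Definition rsim (RT : frule * rtemplate) (sigma : seq form) : seq rstep :=
  ensure (inst sigma (rule_form RT.1)) ++
  [seq rres (inst_clause sigma k.1) (inst_clause sigma k.2.1) (flit (inst sigma k.2.2)) | k <- RT.2].

Definition rscript (RTs : seq (frule * rtemplate)) (s : seq sstep) : seq rstep :=
  flatten [seq rsim (nth (frule0, [::]) RTs k.1) k.2 | k <- s].

Definition pos_form (s : sform) : form := if s.2 then s.1 else FNot s.1.

(** Exchanges the literal of s in a clause for that of Z, using the unit clause of [pos_form s]
    implies Z and its gate clause. *)
Definition elim_lit (Z : form) (D : clause) (s : sform) (rest : seq sform) : seq rstep :=
  let z := flit Z in
  let l := flit (pos_form s) in
  ensure (FImp (pos_form s) Z) ++ [:: rres [:: neg l; z] [::] (flit (FImp (pos_form s) Z))] ++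
  (if s.2 then [::] else [:: rres [:: z] [:: flit s.1] l]) ++
  [:: rres [:: z] ([seq slit r | r <- rest] ++ D) (slit s)].

(** All literals are exchanged for Z, which is present from the second exchange on. From an empty
    clause no Z would arise; this is where the empty clause of a matrix fails. *)
Definition clause_to_unit (ss : seq sform) (Z : form) : seq rstep :=
  if ss is s :: ss' then
    elim_lit Z [::] s ss' ++ ctx (elim_lit Z [:: flit Z]) ss'
  else [::].

Definition sclause (C : clause) : seq sform := [seq (FVar l.1, l.2) | l <- C].

Definition proj (fs : seq form) : seq sstep :=
  let A := big_and fs in
  s_id A :: ctx (fun f s => if s is _ :: _ then [:: s_andL f (big_and s) A; s_andR f (big_and s) A]
                            else [::]) fs.

Definition neg_imp (A W : form) (l : lit) : sstep :=
  if l.2 then s_negpos A (FVar l.1) W else s_negneg A (FVar l.1) W.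

Definition ext_clause1 (v : nat) (al : seq lit) (Q : form) : seq sform :=
  sclause [seq neg l | l <- al] ++ [:: (FVar v, true); (Q, false)].
Definition ext_clause2 (v : nat) (al : seq lit) (Q : form) : seq sform :=
  sclause [seq neg l | l <- al] ++ [:: (FVar v, false); (Q, true)].

(** Q gets ordinary gates, without [al]; then v is introduced under [al] as the negation of (not Q
    and not Q). Its clauses become the units of both implications, joined by rule 24. *)
Definition f2r_extend (RTs : seq (frule * rtemplate)) (v : nat) (al : seq lit) (Q : form) : seq rstep :=
  let A := conj_form al in
  let V := FVar v in
  ensure Q ++ [:: RExtend v al (neg (flit Q)) (neg (flit Q))] ++
  rscript RTs (proj (lits al) ++ [seq neg_imp A (FImp Q V) l | l <- al] ++
               [seq neg_imp A (FImp V Q) l | l <- al] ++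
               [:: s_K V A Q; s_negK V A Q; s_K Q A V; s_negK Q A V]) ++
  clause_to_unit (ext_clause1 v al Q) (FImp A (FImp Q V)) ++
  clause_to_unit (ext_clause2 v al Q) (FImp A (FImp V Q)) ++
  rscript RTs [:: s_iffI A Q V].

Definition guard (u : nat) (b : bool) : form := if b then FNot (FVar u) else FVar u.

Definition congr (u : nat) (b : bool) (B : form) : sstep :=
  let E := guard u b in
  let a := assign_const u b in
  match B with
  | FVar x => if x == u then (if b then s_asg1 (FVar u) else s_asg0 (FVar u)) else s_refl E (FVar x)
  | FFalse => s_refl E FFalse
  | FTrue => s_refl E FTrue
  | FNot C => s_congN C (a C) E
  | FAnd C D => s_congA C (a C) D (a D) E
  | FOr C D => s_congO C (a C) D (a D) E
  | FImp C D => s_congI C (a C) D (a D) E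
  | FIff C D => s_congE C (a C) D (a D) E
  end.

(** For b = 1 the guard is a negation and has a gate variable as its name; one more resolution
    replaces it by the literal of u, since only u itself can be reduced. *)
Definition f2r_reduce (RTs : seq (frule * rtemplate)) (L : form) (u : nat) (b : bool) : seq rstep :=
  let E := guard u b in
  let L' := assign_const u b L in
  rscript RTs ([seq congr u b B | B <- subs L] ++ [:: s_trans L L' E]) ++
  ensure (FOr E L') ++ [:: rres [:: flit E; flit L'] [::] (flit (FOr E L'))] ++
  (if b then [:: rres [:: (u, false)] [:: flit L'] (flit E)] else [::]) ++
  [:: RReduce [:: flit L'] (u, ~~ b)].

(** The table lists [schemas] before the rules of the Frege system, hence the [drop]. *)
Definition f2r (RTs : seq (frule * rtemplate)) (s : fstep) : seq rstep :=
  match s with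
  | FFrege r sigma => rscript (drop (size schemas) RTs) [:: (r, sigma)]
  | FAxiom C => RAxiom C :: rscript RTs (inj (lits C)) ++ clause_to_unit (sclause C) (disj_form C)
  | FExtend v al isand Y => f2r_extend RTs v al (if isand then conj_form Y else disj_form Y)
  | FReduce L u b => f2r_reduce RTs L u b
  | FWeaken w => [:: RWeaken w]
  end.

Definition f2r_all (RTs : seq (frule * rtemplate)) (pi : seq fstep) : seq rstep :=
  undup_steps
    ([:: RWeaken (WeakExis zvar [::]); RExtend tvar [::] (zvar, true) (zvar, false);
         RResolve [:: (tvar, true)] [:: (tvar, true)] zvar] ++
     flatten [seq f2r RTs s | s <- pi] ++ [:: RResolve [::] [::] tvar]).

End Names.

Lemma slitE t s : slit t s = if s.2 then flit t s.1 else neg (flit t s.1).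
Proof. by []. Qed.

(** * States of the simulation and the invariant *)

Record state := State { done : seq rstep; rpre : prefix; rlines : seq clause }.

Definition runs (M : seq clause) (st : state) (s : seq rstep) (Q : state -> Prop) : Prop :=
  exists2 st', wrun M (done st) (rpre st) (rlines st) s (done st') (rpre st') (rlines st') & Q st'.

Lemma runs_cat M st s1 s2 Q : runs M st s1 (fun st' => runs M st' s2 Q) -> runs M st (s1 ++ s2) Q.
Proof. by case=> st1 h1 [st2 h2 hQ]; exists st2 => //; apply: wrun_cat h1 h2. Qed.

Lemma runs_nil M st (Q : state -> Prop) : Q st -> runs M st [::] Q.
Proof. by move=> h; exists st => //; apply: WNil. Qed.

Lemma runs_imp M st s (Q Q' : state -> Prop) :
  (forall st', Q st' -> Q' st') -> runs M st s Q -> runs M st s Q'.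
Proof. by move=> h [st' r hQ]; exists st' => //; apply: h. Qed.

Lemma runs_cons M st s1 s2 Q : runs M st [:: s1] (fun st' => runs M st' s2 Q) -> runs M st (s1 :: s2) Q.
Proof. by rewrite -cat1s; apply: runs_cat. Qed.

Definition ext_state (st st' : state) : Prop :=
  {subset done st <= done st'} /\ {subset rlines st <= rlines st'}.

Lemma ext_refl st : ext_state st st. Proof. by split. Qed.

Lemma ext_trans st1 st2 st3 : ext_state st1 st2 -> ext_state st2 st3 -> ext_state st1 st3.
Proof. by move=> [a b] [c d]; split => x; [move/a/c|move/b/d]. Qed.

Lemma derived_mono G G' C : {subset G <= G'} -> derived_clause G C -> derived_clause G' C.
Proof. by move=> s [D hD e]; exists D => //; apply: s. Qed.

Lemma derived_eq G C C' : C =i C' -> derived_clause G C -> derived_clause G C'.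
Proof. by move=> e [D hD e']; exists D => // x; rewrite e' e. Qed.

Lemma derived_mem G C : C \in G -> derived_clause G C.
Proof. by move=> h; exists C. Qed.

Definition wvar (w : weakening) : nat := match w with WeakUniv u => u | WeakExis x _ => x end.

Definition fdeps (P : prefix) (X : form) : seq nat := flatten [seq dep P x | x <- fvars X].

Lemma mem_fdeps P X u : reflect (exists2 x, x \in fvars X & u \in dep P x) (u \in fdeps P X).
Proof.
apply: (iffP flattenP) => [[s /mapP[x hx ->] h]|[x hx h]]; first by exists x.
by exists (dep P x) => //; apply: map_f.
Qed.

Lemma dep_add_exis P v D x : x != v -> dep (add_exis P v D) x = dep P x.
Proof. by move=> ne; rewrite /dep /= eq_sym (negbTE ne). Qed.

Lemma dep_add_exis_new P v D : fresh P v -> dep (add_exis P v D) v = D.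
Proof.
rewrite /fresh /declared mem_cat negb_or => /andP[h1 h2]; rewrite /dep /= (negbTE h1) eqxx /=.
suff -> : [seq xD <- exis P | xD.1 == v] = [::] by rewrite cats0.
apply/eqP; rewrite -size_eq0 size_filter -leqn0 leqNgt -has_count; apply: contra h2.
by case/hasP => xD hx /eqP <-; apply: map_f.
Qed.

Lemma dep_add_univ P u x : x != u -> dep (add_univ P u) x = dep P x.
Proof. by move=> ne; rewrite /dep /= inE (negbTE ne). Qed.

Lemma fresh_neq P v x : fresh P v -> x \in declared P -> x != v.
Proof. by rewrite /fresh => h hx; apply: contraNneq h => <-. Qed.

Lemma weakens_dep P w P' x : weakens P w P' -> x \in declared P -> dep P' x = dep P x.
Proof.
case=> [u hu|v D hv _] hx; first by rewrite dep_add_univ ?(fresh_neq hu).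
by rewrite dep_add_exis ?(fresh_neq hv).
Qed.

Lemma weakens_declared P w P' x : weakens P w P' -> (x \in declared P') = (x == wvar w) || (x \in declared P).
Proof. by case=> [u _|v D _ _]; rewrite ?declared_add_univ ?declared_add_exis. Qed.

Lemma weakens_fresh P w P' : weakens P w P' -> fresh P (wvar w).
Proof. by case. Qed.

Section Simulation.
Variables (t : tree) (M : seq clause).

Notation name := (name t).
Notation flit := (flit t).
Notation slit := (slit t).
Notation tvar := (tvar t).
Notation gate_step := (gate_step t).
Notation base := (code t 1).
Notation runs := (runs M).

Lemma name_inj : injective name.
Proof. by move=> X Y /code_inj2[/enc_form_inj]. Qed.

Lemma name_ge X : base <= name X.
Proof.
apply: leq_trans (code_ge _ _); rewrite -{1}(mul1n base) leq_mul2r expn_gt0.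
by rewrite orbT.
Qed.

Definition is_gate (X : form) : bool := X \in gates X.

Lemma flit_gate X : is_gate X -> flit X = (name X, pol X).
Proof. by case: X. Qed.

Lemma slit_gate X : is_gate X -> slit (X, pol X) = (name X, true).
Proof. by move=> h; rewrite slitE flit_gate //=; case: (pol X). Qed.

Lemma slit_sneg s : slit (sneg s) = neg (slit s).
Proof. by case: s => X []; rewrite slitE /= ?negK. Qed.

(** Variables of F lie below [code t 1] and names above it. [inv_done] justifies skipping a repeated
    step, [inv_gate] makes a name fresh as long as its gate is not done, and [inv_gdep] is what
    reductions rely on. *)
Record inv (PF : prefix) (GF : seq form) (st : state) : Prop := Inv {
  inv_univ : univ (rpre st) = univ PF;
  inv_decl : {subset declared PF <= declared (rpre st)};
  inv_dep : forall x, x \in declared PF -> {subset dep (rpre st) x <= dep PF x};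
  inv_new : forall x, x \in declared (rpre st) -> x \in declared PF \/ base <= x;
  inv_bnd : forall x, x \in declared PF -> x < base;
  inv_done : forall s, s \in done st -> {subset rconc s <= rlines st};
  inv_ext : forall v al y z, RExtend v al y z \in done st -> v \in declared (rpre st);
  inv_weak : forall w, RWeaken w \in done st -> wvar w \in declared (rpre st);
  inv_gate : forall X, is_gate X -> name X \in declared (rpre st) -> gate_step X \in done st;
  inv_gdep : forall X, is_gate X -> gate_step X \in done st ->
    decl_form (declared PF) X /\ {subset dep (rpre st) (name X) <= fdeps PF X};
  inv_t : [/\ tvar \in declared (rpre st), dep (rpre st) tvar = [::]
            & derived_clause (rlines st) [:: (tvar, true)]];
  inv_line : forall L, L \in GF ->
    decl_form (declared PF) L /\ derived_clause (rlines st) [:: flit L] }.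

Definition pure (s : rstep) : bool :=
  match s with RExtend _ _ _ _ | RWeaken _ => false | _ => true end.

Lemma runs_pure PF GF st s : inv PF GF st -> pure s ->
  rrule M (rpre st) (rlines st) s (rpre st) (rconc s) ->
  runs st [:: s] (fun st' => [/\ inv PF GF st', ext_state st st' & {subset rconc s <= rlines st'}]).
Proof.
move=> i ps hr; have [hs|hs] := boolP (s \in done st).
  by exists st; [apply: WSkip hs (WNil _ _ _ _)|by split; [|exact: ext_refl|exact: (inv_done i hs)]].
exists (State (s :: done st) (rpre st) (rconc s ++ rlines st)); first by apply: WStep hs hr (WNil _ _ _ _).
have sub : {subset rlines st <= rconc s ++ rlines st} by move=> x hx; rewrite mem_cat hx orbT.
split; [|split => //= x hx; by rewrite inE hx orbT|by move=> x hx; rewrite mem_cat hx].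
case: i => i1 i2 i3 i4 i5 i6 i7 i8 i9 i10 [i11 i11' i11''] i12; split => //=.
- by move=> s'; rewrite inE => /orP[/eqP-> x hx|/i6 h x /h/sub//]; rewrite mem_cat hx.
- move=> v al y z; rewrite inE => /orP[/eqP e|]; [by rewrite -e in ps|exact: i7].
- move=> w; rewrite inE => /orP[/eqP e|]; [by rewrite -e in ps|exact: i8].
- by move=> X gX /(i9 X gX); rewrite inE => ->; rewrite orbT.
- move=> X gX; rewrite inE => /orP[/eqP e|]; [by rewrite -e in ps|exact: i10].
- by split => //; apply: derived_mono sub i11''.
- by move=> L /i12[h1 h2]; split => //; apply: derived_mono sub h2.
Qed.

Lemma runs_rres PF GF st E F l : inv PF GF st ->
  derived_clause (rlines st) (neg l :: E) -> derived_clause (rlines st) (l :: F) ->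
  runs st [:: rres E F l] (fun st' => [/\ inv PF GF st', ext_state st st'
    & derived_clause (rlines st') (E ++ F)]).
Proof.
move=> i hE hF; rewrite /rres; case: l hE hF => x [] hE hF /=.
  apply: runs_imp (runs_pure i (s := RResolve E F x) isT (RR_resolve _ _ hE hF)) => st' [i' e h].
  by split => //; exists (E ++ F) => //; apply: h; rewrite mem_head.
apply: runs_imp (runs_pure i (s := RResolve F E x) isT (RR_resolve _ _ hF hE)) => st' [i' e h].
split => //; exists (F ++ E); first by apply: h; rewrite mem_head.
by move=> y; rewrite !mem_cat orbC.
Qed.

Lemma gate_in_decl V X : decl_form V X -> decl_form V (in1 X).1 /\ decl_form V (in2 X).1.
Proof.
have sw A B : decl_form V (FImp A B) -> decl_form V (FImp B A).
  by move=> /decl_fvars_cat[h1 h2]; apply/decl_fvars_cat.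
by case: X => [x|||B|B C|B C|B C|B C] //= h; try (by split => // x hx; apply: h; rewrite mem_cat hx ?orbT);
  split => //; apply: sw.
Qed.

Lemma runs_gate PF GF st X : inv PF GF st -> is_gate X -> decl_form (declared PF) X ->
  (slit (in1 X)).1 \in declared (rpre st) -> (slit (in2 X)).1 \in declared (rpre st) ->
  {subset dep (rpre st) (slit (in1 X)).1 <= fdeps PF X} ->
  {subset dep (rpre st) (slit (in2 X)).1 <= fdeps PF X} ->
  runs st [:: gate_step X] (fun st' => [/\ inv PF GF st', ext_state st st' & gate_step X \in done st']).
Proof.
move=> i gX dX d1 d2 s1 s2; have [hs|hs] := boolP (gate_step X \in done st).
  by exists st; [apply: WSkip hs (WNil _ _ _ _)|by split; [|exact: ext_refl|]].
(* Only the gate step of X itself can have declared this name. *)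
have fr : fresh (rpre st) (name X) by rewrite /fresh; apply: contra hs; apply: (inv_gate i gX).
have ok : ext_ok (rpre st) (name X) [::] [:: slit (in1 X); slit (in2 X)].
  by split => // y; in_seq.
set D := ext_deps (rpre st) [::] [:: slit (in1 X); slit (in2 X)].
exists (State (gate_step X :: done st) (add_exis (rpre st) (name X) D)
          (rconc (gate_step X) ++ rlines st)); first by apply: WStep hs (RR_extend _ _ ok) (WNil _ _ _ _).
have sub : {subset rlines st <= rconc (gate_step X) ++ rlines st} by move=> x hx; rewrite mem_cat hx orbT.
have sub0 : {subset rconc (gate_step X) <= rconc (gate_step X) ++ rlines st}.
  by move=> x hx; rewrite mem_cat hx.
have sD : {subset D <= fdeps PF X}.
  move=> u; rewrite mem_undup mem_filter => /andP[_ /flattenP[s]].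
  by rewrite !inE => /orP[] /eqP->; [apply: s1|apply: s2].
case: i => i1 i2 i3 i4 i5 i6 i7 i8 i9 i10 [i11 i11' i11''] i12.
split; [|by split => //= x hx; rewrite inE hx orbT|by rewrite mem_head].
have dmono x : x \in declared (rpre st) -> x \in declared (add_exis (rpre st) (name X) D).
  by rewrite declared_add_exis => ->; rewrite orbT.
split => //=.
- by move=> x /i2/dmono.
- by move=> x hx; rewrite dep_add_exis ?(fresh_neq fr) ?i2 //; apply: i3.
- by move=> x; rewrite declared_add_exis => /orP[/eqP->|/i4//]; right; apply: name_ge.
- by move=> s'; rewrite inE => /orP[/eqP->|/i6 h x /h/sub//]; exact: sub0.
- move=> v al y z; rewrite inE => /orP[/eqP[-> _ _ _]|/i7/dmono//].
  by rewrite declared_add_exis eqxx.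
- by move=> w; rewrite inE => /orP[/eqP//|/i8/dmono].
- move=> Y gY; rewrite declared_add_exis inE => /orP[/eqP/name_inj->|/(i9 _ gY) ->].
    by rewrite eqxx.
  by rewrite orbT.
- move=> Y gY; rewrite inE => /orP[/eqP[/name_inj-> _ _]|hY].
    by rewrite dep_add_exis_new.
  have [h1 h2] := i10 Y gY hY; split => //; rewrite dep_add_exis //.
  by apply: fresh_neq fr _; apply: i7 hY.
- split; [exact: dmono|by rewrite dep_add_exis // (fresh_neq fr)|exact: derived_mono sub i11''].
- by move=> L /i12[h1 h2]; split => //; apply: derived_mono sub h2.
Qed.

Lemma flit_ok PF GF st X : inv PF GF st -> decl_form (declared PF) X ->
  (is_gate X -> gate_step X \in done st) ->
  (flit X).1 \in declared (rpre st) /\ {subset dep (rpre st) (flit X).1 <= fdeps PF X}.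
Proof.
move=> i dX hX; have [gX|gX] := boolP (is_gate X).
  rewrite flit_gate //=; split; last by case: (inv_gdep i gX (hX gX)).
  exact: (inv_ext i (hX gX)).
have [h1 h2 _] := inv_t i.
case: X gX dX {hX} => [x|||B|B C|B C|B C|B C]; rewrite /is_gate ?inE ?eqxx ?orbT //= => _ dX.
- have hx : x \in declared PF by apply: dX; rewrite mem_head.
  split; first exact: (inv_decl i hx).
  by move=> u /(inv_dep i hx) hu; apply/mem_fdeps; exists x; rewrite ?mem_head.
- by rewrite h2.
- by rewrite h2.
Qed.

Definition ensured (st : state) (X : form) : Prop :=
  forall Y Z, Y \in subs X -> Z \in gates Y -> gate_step Z \in done st.

Lemma ensured_ext st st' X : ext_state st st' -> ensured st X -> ensured st' X.
Proof. by move=> [e _] h Y Z hY hZ; apply: e; apply: h hY hZ. Qed.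

Lemma mem_subs X : X \in subs X.
Proof. by case: X => *; rewrite /= ?mem_cat !inE eqxx ?orbT. Qed.

Lemma ensured_gate st X : ensured st X -> is_gate X -> gate_step X \in done st.
Proof. by move=> h g; apply: h (mem_subs X) g. Qed.

Lemma fdeps_sub PF A B : {subset fvars A <= fvars B} -> {subset fdeps PF A <= fdeps PF B}.
Proof. by move=> s u /mem_fdeps[x /s hx hu]; apply/mem_fdeps; exists x. Qed.

Lemma slit1 s : (slit s).1 = (flit s.1).1.
Proof. by rewrite slitE; case: (s.2). Qed.

Lemma in_fvars X : {subset fvars (in1 X).1 <= fvars X} /\ {subset fvars (in2 X).1 <= fvars X}.
Proof. exact: (@gate_in_decl (fvars X) X). Qed.

Lemma runs_gate_of_inputs PF GF st X : inv PF GF st -> is_gate X -> decl_form (declared PF) X ->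
  (is_gate (in1 X).1 -> gate_step (in1 X).1 \in done st) ->
  (is_gate (in2 X).1 -> gate_step (in2 X).1 \in done st) ->
  runs st [:: gate_step X] (fun st' => [/\ inv PF GF st', ext_state st st' & gate_step X \in done st']).
Proof.
move=> i gX dX h1 h2; have [d1 d2] := gate_in_decl dX; have [f1 f2] := in_fvars X.
have [a1 b1] := flit_ok i d1 h1; have [a2 b2] := flit_ok i d2 h2.
apply: runs_gate => //; rewrite slit1 //.
  by move=> u /b1; apply: fdeps_sub.
by move=> u /b2; apply: fdeps_sub.
Qed.

Definition ensures PF GF (X : form) : Prop := forall st, inv PF GF st ->
  runs st (ensure t X) (fun st' => [/\ inv PF GF st', ext_state st st' & ensured st' X]).

Lemma ensures_node PF GF X B C : subs X = subs B ++ subs C ++ [:: X] ->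
  ensures PF GF B -> ensures PF GF C ->
  (forall st, inv PF GF st -> ensured st B -> ensured st C ->
     runs st [seq gate_step Z | Z <- gates X] (fun st' =>
       [/\ inv PF GF st', ext_state st st' & forall Z, Z \in gates X -> gate_step Z \in done st'])) ->
  ensures PF GF X.
Proof.
move=> E hB hC hX st i; rewrite /ensure E !map_cat !flatten_cat.
apply: runs_cat; apply: runs_imp (hB _ i) => st1 [i1 e1 n1].
apply: runs_cat; apply: runs_imp (hC _ i1) => st2 [i2 e2 n2].
have {}n1 := ensured_ext e2 n1; rewrite /= cats0.
apply: runs_imp (hX _ i2 n1 n2) => st3 [i3 e3 h3]; split => //.
  exact: ext_trans e1 (ext_trans e2 e3).
move=> Y Z; rewrite E !mem_cat inE => /or3P[hY hZ|hY hZ|/eqP->]; last exact: h3.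
  by apply: e3.1; apply: n1 hY hZ.
by apply: e3.1; apply: n2 hY hZ.
Qed.

Lemma runs_ensure PF GF X : decl_form (declared PF) X -> ensures PF GF X.
Proof.
have leaf Y : subs Y = [:: Y] -> gates Y = [::] -> ensures PF GF Y.
  move=> e1 e2 st i; rewrite /ensure e1 /= e2; apply: runs_nil; split; [by []|exact: ext_refl|] => U Z.
  by rewrite e1 inE => /eqP->; rewrite e2.
have one st Y : gates Y = [:: Y] -> decl_form (declared PF) Y -> inv PF GF st ->
    (is_gate (in1 Y).1 -> gate_step (in1 Y).1 \in done st) ->
    (is_gate (in2 Y).1 -> gate_step (in2 Y).1 \in done st) ->
    runs st [seq gate_step Z | Z <- gates Y] (fun st' =>
       [/\ inv PF GF st', ext_state st st' & forall Z, Z \in gates Y -> gate_step Z \in done st']).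
  move=> e dY i h1 h2; rewrite e.
  have gY : is_gate Y by rewrite /is_gate e mem_head.
  apply: runs_imp (runs_gate_of_inputs i gY dY h1 h2) => st' [i' e' h']; split => // Z.
  by in_seq.
elim: X => [x|||B IHB|B IHB C IHC|B IHB C IHC|B IHB C IHC|B IHB C IHC] dX; try exact: leaf.
- move=> st i; rewrite /ensure [subs _]/= map_cat flatten_cat.
  apply: runs_cat; apply: runs_imp (IHB dX _ i) => st1 [i1 e1 n1].
  rewrite [flatten _]/=.
  apply: runs_imp (one st1 (FNot B) erefl dX i1 (ensured_gate n1) (ensured_gate n1)) => st2 [i2 e2 h2].
  split => //; first exact: ext_trans e1 e2.
  move=> Y Z; rewrite mem_cat => /orP[hY hZ|]; first by apply: e2.1; apply: n1 hY hZ.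
  by rewrite inE => /eqP->; apply: h2.
1-3: move: (dX) => /decl_fvars_cat[dB dC]; apply: ensures_node (IHB dB) (IHC dC) _ => // st i nB nC;
  by apply: one => //; apply: ensured_gate.
(* For an equivalence the gates of the two implications come first, as they are its inputs. *)
move: (dX) => /decl_fvars_cat[dB dC]; apply: ensures_node (IHB dB) (IHC dC) _ => // st i nB nC.
have dBC := decl_FImp dB dC; have dCB := decl_FImp dC dB.
apply: runs_cons; apply: runs_imp (one st (FImp B C) erefl dBC i (ensured_gate nB) (ensured_gate nC)) => st1 [i1 e1 h1].
have nB1 := ensured_ext e1 nB; have nC1 := ensured_ext e1 nC.
apply: runs_cons; apply: runs_imp (one st1 (FImp C B) erefl dCB i1 (ensured_gate nC1) (ensured_gate nB1)) => st2 [i2 e2 h2].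
have g1 : gate_step (FImp B C) \in done st2 by apply/e2.1/h1/mem_head.
have g2 : gate_step (FImp C B) \in done st2 by apply/h2/mem_head.
have gX : is_gate (FIff B C) by rewrite /is_gate !inE eqxx !orbT.
apply: runs_imp (runs_gate_of_inputs i2 gX dX (fun _ => g1) (fun _ => g2)) => st3 [i3 e3 h3]; split => //.
  exact: ext_trans e1 (ext_trans e2 e3).
by move=> Z; rewrite !inE => /or3P[] /eqP-> //; [apply: e3.1|apply: e3.1].
Qed.

Lemma gate_derived PF GF st X C : inv PF GF st -> is_gate X -> gate_step X \in done st ->
  C \in gate_clauses X -> [seq slit s | s <- C] \in rlines st.
Proof.
move=> i gX hX hC; apply: (inv_done i hX); move: hC.
by rewrite !inE => /or3P[] /eqP->; rewrite !map_cons ?slit_sneg slit_gate // eqxx ?orbT.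
Qed.

Lemma ensured_local PF GF st T X C : inv PF GF st -> ensured st T -> X \in subs T ->
  C \in local_clauses X -> derived_clause (rlines st) [seq slit s | s <- C].
Proof.
move=> i eT hX; have g : C \in flatten [seq gate_clauses Y | Y <- gates X] ->
    derived_clause (rlines st) [seq slit s | s <- C].
  case/flattenP => Cs /mapP[Y hY ->] hC; apply: derived_mem.
  apply: (gate_derived i _ (eT _ _ hX hY) hC).
  move: hY; case: (X) => [x|||B|B D|B D|B D|B D]; rewrite ?inE //; try (by move/eqP->; rewrite /is_gate mem_head).
  by case/or3P => /eqP->; rewrite /is_gate !inE eqxx ?orbT.
have [_ _ ht] := inv_t i.
by case: X hX g => [x|||B|B D|B D|B D|B D] hX g; try exact: g; in_seq.
Qed.

Lemma map_eq_mem (A B : eqType) (f : A -> B) s1 s2 : s1 =i s2 -> [seq f x | x <- s1] =i [seq f x | x <- s2].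
Proof. by move=> e y; apply/mapP/mapP => -[x hx ->]; exists x; rewrite ?e // -e. Qed.

End Simulation.

(** * Resolution templates for schematic rules *)

Definition template_for (K : seq (seq sform)) (ts : rtemplate) (D : seq sform) : Prop :=
  forall t M PF GF st sigma, inv t PF GF st ->
    (forall C, C \in K -> derived_clause (rlines st) (inst_clause t sigma C)) ->
    runs M st [seq rres (inst_clause t sigma k.1) (inst_clause t sigma k.2.1) (flit t (inst sigma k.2.2)) | k <- ts]
      (fun st' => [/\ inv t PF GF st', ext_state st st' & derived_clause (rlines st') (inst_clause t sigma D)]).

(** Instantiation may merge literals, but it respects equality of clauses as sets, which is all that
    a resolution step asks of its premises. *)
Lemma rd_template K D : rd K D -> exists ts, template_for K ts D.
Proof.
elim=> {D} [C hC|C D E F X _ [ts1 h1] _ [ts2 h2] eC eD].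
  exists [::] => t M PF GF st sigma i hK; apply: runs_nil; split => //; [exact: ext_refl|exact: hK].
exists (ts1 ++ ts2 ++ [:: (E, (F, X))]) => t M PF GF st sigma i hK; rewrite !map_cat.
apply: runs_cat; apply: runs_imp (h1 t M PF GF st sigma i hK) => st1 [i1 e1 d1].
apply: runs_cat; apply: runs_imp (h2 t M PF GF st1 sigma i1 _) => [st2 [i2 e2 d2]|B /hK]; last first.
  exact: derived_mono e1.2.
have dC := derived_eq (map_eq_mem (fun s : sform => slit t (inst sigma s.1, s.2)) eC) (derived_mono e2.2 d1).
have dD := derived_eq (map_eq_mem (fun s : sform => slit t (inst sigma s.1, s.2)) eD) d2.
apply: runs_imp (@runs_rres t M PF GF st2 (inst_clause t sigma E) (inst_clause t sigma F)
  (flit t (inst sigma X)) i2 dC dD) => st3 [i3 e3 d3]; split => //.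
  exact: ext_trans e1 (ext_trans e2 e3).
by rewrite /inst_clause map_cat.
Qed.

Definition simulates_rule (RT : frule * rtemplate) : Prop :=
  forall t M PF GF st sigma, inv t PF GF st ->
    decl_form (declared PF) (inst sigma (rule_form RT.1)) ->
    (forall H, H \in premises RT.1 -> derived_clause (rlines st) [:: flit t (inst sigma H)]) ->
    runs M st (rsim t RT sigma) (fun st' =>
      [/\ inv t PF GF st', ext_state st st'
        & derived_clause (rlines st') [:: flit t (inst sigma (conclusion RT.1))]]).

Lemma subs_inst sigma T X : X \in subs T -> (forall x, X <> FVar x) -> inst sigma X \in subs (inst sigma T).
Proof.
rewrite /inst => hX nv; elim: T hX => [x|||B IHB|B IHB C IHC|B IHB C IHC|B IHB C IHC|B IHB C IHC] /=;
  rewrite ?mem_cat !inE.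
- by move/eqP/nv.
- by move/eqP->.
- by move/eqP->.
- by case/orP => [/IHB ->//|/eqP->]; rewrite /= eqxx orbT.
all: by case/or3P => [/IHB ->//|/IHC ->|/eqP->]; rewrite /= ?eqxx ?orbT.
Qed.

(** Gates are determined by the main connective, so their clauses commute with substitution. A
    metavariable has no local clauses. *)
Lemma inst_local t sigma X C : C \in local_clauses X ->
  exists2 C', C' \in local_clauses (inst sigma X) & inst_clause t sigma C = [seq slit t s | s <- C'].
Proof.
pose i (s : sform) : sform := (inst sigma s.1, s.2).
have e D : inst_clause t sigma D = [seq slit t s | s <- [seq i s | s <- D]] by rewrite -map_comp.
move=> hC; exists [seq i s | s <- C]; last exact: e.
have im E Cs : {in Cs, forall D, [seq i s | s <- D] \in E} -> C \in Cs -> [seq i s | s <- C] \in E by move=> h; apply: h.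
move: hC; case: X => [x|||B|B D|B D|B D|B D] //; apply: (im) => D'; rewrite ?[local_clauses _]/= !inE;
  do ?[case/orP]; move/eqP->; rewrite /i /= ?eqxx ?orbT //.
Qed.

Lemma exists_rtemplate R : sound_rule R -> exists ts, simulates_rule (R, ts).
Proof.
move=> /rd_rule[D rD eD]; have [ts hts] := rd_template rD.
exists ts => t M PF GF st sigma i dT hH; rewrite /rsim /=.
apply: runs_cat; apply: runs_imp (runs_ensure M dT i) => st1 [i1 e1 n1].
apply: runs_imp (hts t M PF GF st1 sigma i1 _) => [st2 [i2 e2 d2]|C].
  split => //; first exact: ext_trans e1 e2.
  exact: derived_eq (map_eq_mem _ eD) d2.
rewrite mem_cat => /orP[|/mapP[H /hH h ->]]; last exact: derived_mono e1.2 h.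
case/flattenP => Cs /mapP[X hX ->] hC.
have [C' hC' ->] := inst_local t sigma hC.
apply: ensured_local i1 n1 _ hC'; apply: subs_inst => // x e.
by rewrite e in hC.
Qed.

Definition resolution_templates S (RTs : seq (frule * rtemplate)) : Prop :=
  forall k, k < size (schemas ++ S) ->
  (nth (frule0, [::]) RTs k).1 = nth frule0 (schemas ++ S) k /\
  simulates_rule (nth (frule0, [::]) RTs k).

Lemma exists_rtemplates S : frege_system S -> exists RTs, resolution_templates S RTs.
Proof.
move=> [snd _]; apply: (@finite_choice _ _ (fun k RT =>
  RT.1 = nth frule0 (schemas ++ S) k /\ simulates_rule RT)) => k lt_k.
have [ts hts] : exists ts, simulates_rule (nth frule0 (schemas ++ S) k, ts).
  apply: exists_rtemplate; rewrite nth_cat; case: ltnP => h; first exact: schemas_sound.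
  by apply: snd; move: lt_k; rewrite size_cat; lia.
by exists (nth frule0 (schemas ++ S) k, ts).
Qed.

Lemma decl_rule_form V sigma R : decl_form V (inst sigma (conclusion R)) ->
  (forall H, H \in premises R -> decl_form V (inst sigma H)) ->
  decl_form V (inst sigma (rule_form R)).
Proof.
rewrite /rule_form => hc; elim: (premises R) => //= H Hs IH h; apply: decl_FImp.
  by apply: h; rewrite mem_head.
by apply: IH => H' hH'; apply: h; rewrite inE hH' orbT.
Qed.

Lemma slit_lit t l : slit t (FVar l.1, l.2) = l.
Proof. by case: l => x []. Qed.

Lemma map_slit_sclause t C : [seq slit t s | s <- sclause C] = C.
Proof. by rewrite -map_comp -[RHS]map_id; apply: eq_map => l /=; apply: slit_lit. Qed.

Lemma pos_form_lit l : pos_form (FVar l.1, l.2) = lit_form l.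
Proof. by []. Qed.

(** * Correctness of the translation from F to R *)

Section F2R.
Variables (S : seq frule) (RTs : seq (frule * rtemplate)) (M : seq clause) (t : tree).
Hypothesis hRT : resolution_templates S RTs.

Notation flit := (flit t).
Notation slit := (slit t).
Notation inv := (inv t).
Notation runs := (runs M).
Notation base := (code t 1).
Notation holds st f := (derived_clause (rlines st) [:: flit f]).

Lemma runs_rscript PF GF st (L : seq form) s (Q : seq form -> Prop) : inv PF GF st ->
  (forall f, f \in L -> holds st f) ->
  srun (schemas ++ S) (declared PF) L s Q ->
  runs st (rscript t RTs s) (fun st' => [/\ inv PF GF st', ext_state st st' &
    exists2 L', (forall f, f \in L' -> holds st' f) & Q L']).
Proof.
move=> i hL [ok hQ].
suff h : runs st (rscript t RTs s) (fun st' => [/\ inv PF GF st', ext_state st st' &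
    forall f, f \in sout (schemas ++ S) L s -> holds st' f]).
  by apply: runs_imp h => st' [i' e' h']; split => //; exists (sout (schemas ++ S) L s) => //; apply: hQ.
elim: s L st i hL ok {Q hQ} => [|k s IH] L st i hL ok.
  by apply: runs_nil; split => //; exact: ext_refl.
move: ok => /= [lt_k dk pk ok].
have [eR sim] := hRT lt_k; apply: runs_cat.
apply: runs_imp (sim t M PF GF st k.2 i _ _) => [st1 [i1 e1 d1]||]; last first.
- by rewrite eR => H /pk/hL.
- exact: fvars_inst.
apply: runs_imp (IH _ st1 i1 _ ok) => [st2 [i2 e2 d2]|f].
  by split => //; exact: ext_trans e1 e2.
rewrite inE => /orP[/eqP->|/hL h]; last exact: derived_mono e1.2 h.
by move: d1; rewrite eR.
Qed.

Lemma runs_elim_lit PF GF st Z D s rest : inv PF GF st ->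
  decl_form (declared PF) Z -> decl_form (declared PF) s.1 ->
  derived_clause (rlines st) (slit s :: [seq slit r | r <- rest] ++ D) ->
  holds st (FImp (pos_form s) Z) ->
  runs st (elim_lit t Z D s rest) (fun st' => [/\ inv PF GF st', ext_state st st' &
    derived_clause (rlines st') (flit Z :: [seq slit r | r <- rest] ++ D)]).
Proof.
move=> i dZ ds hC hZ; rewrite /elim_lit.
have dP : decl_form (declared PF) (pos_form s) by rewrite /pos_form; case: (s.2).
have dI := decl_FImp dP dZ.
apply: runs_cat; apply: runs_imp (runs_ensure M dI i) => st1 [i1 e1 n1].
have mX : [:: sneg (FImp (pos_form s) Z, true); sneg (pos_form s, true); sneg (Z, false)]
    \in gate_clauses (FImp (pos_form s) Z) by rewrite !inE eqxx !orbT.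
have c1 : derived_clause (rlines st1)
    (neg (flit (FImp (pos_form s) Z)) :: [:: neg (flit (pos_form s)); flit Z]).
  apply: derived_mem.
  have gI : is_gate (FImp (pos_form s) Z) by exact: mem_head.
  by have := gate_derived i1 gI (ensured_gate n1 gI) mX.
apply: runs_cat; apply: runs_imp (runs_rres M i1 c1 (derived_mono e1.2 hZ)) => st2 [i2 e2 d2].
have e12 := ext_trans e1 e2; rewrite cats0 in d2.
set s3 := (if s.2 then _ else _).
have r3 : runs st2 s3 (fun st' => [/\ inv PF GF st', ext_state st2 st' &
    derived_clause (rlines st') (neg (slit s) :: [:: flit Z])]).
  (* For a negative s the clause speaks of the name of [FNot s.1]; the gate clause of that negation
     leads back to the literal of [s.1]. *)
  rewrite /s3 slitE; move: n1 d2; rewrite /pos_form; case: (s.2) => n1 d2.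
    by apply: runs_nil; split => //; exact: ext_refl.
  have gn : gate_step t (FNot s.1) \in done st2.
    apply: e2.1; apply: (n1 (FNot s.1)); last exact: mem_head.
    by rewrite [subs _]/= !mem_cat mem_head orbT.
  have c2 : derived_clause (rlines st2) (flit (FNot s.1) :: [:: flit s.1]).
    apply: derived_mem.
    have gN : is_gate (FNot s.1) by exact: mem_head.
    by have := gate_derived i2 gN gn (mem_head _ _).
  apply: runs_imp (runs_rres M i2 (E := [:: flit Z]) d2 c2) => st3 [i3 e3 d3]; split => //.
  by apply: derived_eq d3 => l; rewrite negK !inE orbC.
apply: runs_cat; apply: runs_imp r3 => st3 [i3 e3 d3].
have e13 := ext_trans e12 e3.
apply: runs_imp (runs_rres M i3 d3 (derived_mono e13.2 hC)) => st4 [i4 e4 d4]; split => //.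
exact: ext_trans e13 e4.
Qed.

Lemma runs_clause_to_unit PF GF st (ss : seq sform) Z : inv PF GF st -> decl_form (declared PF) Z ->
  (forall s, s \in ss -> decl_form (declared PF) s.1) -> ss != [::] ->
  derived_clause (rlines st) [seq slit s | s <- ss] ->
  (forall s, s \in ss -> holds st (FImp (pos_form s) Z)) ->
  runs st (clause_to_unit t ss Z) (fun st' => [/\ inv PF GF st', ext_state st st' & holds st' Z]).
Proof.
case: ss => // s ss i dZ ds _ hC hZ; rewrite /clause_to_unit.
have hC' : derived_clause (rlines st) (slit s :: [seq slit r | r <- ss] ++ [::]) by rewrite cats0.
apply: runs_cat.
apply: runs_imp (runs_elim_lit i dZ (ds _ (mem_head _ _)) hC' (hZ _ (mem_head _ _))) => st1 [i1 e1 d1].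
have {}d1 : derived_clause (rlines st1) ([seq slit r | r <- ss] ++ [:: flit Z]).
  by apply: derived_eq d1 => l; rewrite cats0 mem_cat !inE orbC.
have {}hZ r : r \in ss -> holds st1 (FImp (pos_form r) Z).
  by move=> hr; apply: derived_mono e1.2 (hZ _ _); rewrite inE hr orbT.
have {}ds r : r \in ss -> decl_form (declared PF) r.1 by move=> hr; apply: ds; rewrite inE hr orbT.
suff h : runs st1 (ctx (elim_lit t Z [:: flit Z]) ss)
    (fun st' => [/\ inv PF GF st', ext_state st1 st' & holds st' Z]).
  by apply: runs_imp h => st2 [i2 e2 d2]; split => //; exact: ext_trans e1 e2.
elim: ss st1 i1 d1 hZ ds {st i hC hC' e1} => [|r ss IH] st i d hZ ds.
  by apply: runs_nil; split => //; exact: ext_refl.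
apply: runs_cat.
apply: runs_imp (runs_elim_lit i dZ (ds _ (mem_head _ _)) d (hZ _ (mem_head _ _))) => st1 [i1 e1 d1].
have {}d1 : derived_clause (rlines st1) ([seq slit r | r <- ss] ++ [:: flit Z]).
  by apply: derived_eq d1 => l; rewrite !(mem_cat, inE); case: (l == _); rewrite ?orbT.
apply: runs_imp (IH _ i1 d1 _ _) => [st2 [i2 e2 d2]|r' hr'|r' hr'].
- by split => //; exact: ext_trans e1 e2.
- by apply: derived_mono e1.2 (hZ _ _); rewrite inE hr' orbT.
- by apply: ds; rewrite inE hr' orbT.
Qed.

Lemma f2r_frege PF GF st r sigma : inv PF GF st -> r < size S ->
  let R := nth frule0 S r in
  (forall A, A \in premises R -> inst sigma A \in GF) ->
  {subset fvars (inst sigma (conclusion R)) <= declared PF} ->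
  runs st (f2r t RTs (FFrege r sigma)) (fun st' =>
    inv PF (inst sigma (conclusion R) :: GF) st').
Proof.
move=> i lt_r R hp dc.
have lt_k : size schemas + r < size (schemas ++ S) by rewrite size_cat ltn_add2l.
have [eR sim] := hRT lt_k; rewrite nth_cat ltnNge leq_addr /= addKn -/R in eR.
rewrite /= /rscript /= cats0 nth_drop.
apply: runs_imp (sim t M PF GF st sigma i _ _) => [st1 [i1 e1 d1]||].
- case: i1 => *; split => // L; rewrite inE => /orP[/eqP->|]; last by auto.
  by split => //; rewrite -eR.
- by rewrite eR; apply: decl_rule_form => // H /hp/(inv_line i)[].
- by rewrite eR => H /hp/(inv_line i)[].
Qed.

Lemma inv_add PF GF st L : inv PF GF st -> decl_form (declared PF) L -> holds st L ->
  inv PF (L :: GF) st.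
Proof.
move=> i dL hL; case: i => *; split => // L'; rewrite inE => /orP[/eqP->|]; last by auto.
by split.
Qed.

Lemma f2r_axiomP PF GF st C : inv PF GF st -> C \in M -> C != [::] -> decl_clause (declared PF) C ->
  runs st (f2r t RTs (FAxiom C)) (fun st' => inv PF (disj_form C :: GF) st').
Proof.
move=> i hC nC dC; apply: runs_cons.
apply: runs_imp (runs_pure (M := M) i (s := RAxiom C) isT (RR_axiom _ _ (derived_mem hC))) => st1 [i1 e1 h1].
have c1 : derived_clause (rlines st1) [seq slit s | s <- sclause C].
  by rewrite map_slit_sclause; apply/derived_mem/h1/mem_head.
apply: runs_cat.
apply: runs_imp (runs_rscript i1 (L := [::]) _ (srun_inj S [::] (fun f => @decl_lits _ _ f dC))) => // st2 [i2 e2 [L' hL' [_ hQ]]].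
apply: runs_imp (runs_clause_to_unit i2 (decl_disj dC) _ _ (derived_mono e2.2 c1) _) => [st3 [i3 e3 d3]|s|
   |s]; last 1 first.
- by case/mapP => l hl ->; apply: hL'; rewrite pos_form_lit; apply: hQ; apply: map_f.
- by apply: inv_add => //; apply: decl_disj.
- by case/mapP => l /dC hl -> x; in_seq.
- by case: (C) nC.
Qed.

(* The variable [v] may have a smaller dependency set in R than in F. *)
Lemma inv_add_var PF GF st s (v : nat) PF' P' new :
  inv PF GF st -> fresh PF v -> v < base -> s \notin done st ->
  (forall X, s <> gate_step t X) ->
  (forall v' al y z, s = RExtend v' al y z -> v' = v) -> (forall w, s = RWeaken w -> wvar w = v) ->
  univ P' = univ PF' ->
  (forall x, (x \in declared PF') = (x == v) || (x \in declared PF)) ->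
  (forall x, (x \in declared P') = (x == v) || (x \in declared (rpre st))) ->
  (forall x, x \in declared PF -> dep PF' x = dep PF x) ->
  (forall x, x \in declared (rpre st) -> dep P' x = dep (rpre st) x) ->
  {subset dep P' v <= dep PF' v} -> {subset rconc s <= new} ->
  inv PF' GF (State (s :: done st) P' (new ++ rlines st)).
Proof.
move=> [i1 i2 i3 i4 i5 i6 i7 i8 i9 i10 [i11 i11' i11''] i12] fv bv ns ng hE hW u1 d1 d2 p1 p2 pv sn.
have sub : {subset rlines st <= new ++ rlines st} by move=> x hx; rewrite mem_cat hx orbT.
have dF x : x \in declared PF -> x \in declared PF' by rewrite d1 => ->; rewrite orbT.
have dR x : x \in declared (rpre st) -> x \in declared P' by rewrite d2 => ->; rewrite orbT.
have nv X : name t X != v by have := name_ge t X; case: eqP => // ->; lia.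
split => //=.
- by move=> x; rewrite d1 => /orP[/eqP->|/i2/dR//]; rewrite d2 eqxx.
- move=> x; rewrite d1 => /orP[/eqP->//|hx]; rewrite p1 // p2 ?i2 //; exact: i3.
- move=> x; rewrite d2 => /orP[/eqP->|/i4[/dF|]]; [by left; rewrite d1 eqxx|by left|by right].
- by move=> x; rewrite d1 => /orP[/eqP->//|/i5].
- by move=> s'; rewrite inE => /orP[/eqP-> x /sn hx|/i6 h x /h/sub//]; rewrite mem_cat hx.
- by move=> v' al y z; rewrite inE => /orP[/eqP/esym/hE->|/i7/dR//]; rewrite d2 eqxx.
- by move=> w; rewrite inE => /orP[/eqP/esym/hW->|/i8/dR//]; rewrite d2 eqxx.
- move=> X gX; rewrite d2 (negbTE (nv X)) => /(i9 _ gX) h; by rewrite inE h orbT.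
- move=> X gX; rewrite inE => /orP[/eqP/esym/ng//|hX]; have [h1 h2] := i10 X gX hX.
  split; first by move=> x /h1/dF.
  have -> : fdeps PF' X = fdeps PF X by congr flatten; apply/eq_in_map => x /h1; apply: p1.
  by rewrite p2 //; apply: i7 hX.
- by split; [exact: dR|rewrite p2|exact: derived_mono sub i11''].
- move=> L /i12[h1 h2]; split; first by move=> x /h1/dF.
  exact: derived_mono sub h2.
Qed.

(** What R declares beyond F are names and [zvar], all at least [code t 1]. *)
Lemma inv_fresh PF GF st v : inv PF GF st -> fresh PF v -> v < base -> fresh (rpre st) v.
Proof. by move=> i fv bv; apply/negP => /(inv_new i)[h|]; [rewrite /fresh h in fv|lia]. Qed.

Lemma f2r_weaken PF GF st w PF' : inv PF GF st -> wvar w < base -> weakens PF w PF' ->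
  runs st (f2r t RTs (FWeaken w)) (fun st' => inv PF' GF st').
Proof.
move=> i bw hw; have fv := weakens_fresh hw; have fr := inv_fresh i fv bw.
have ns : RWeaken w \notin done st by apply: contra fr; apply: inv_weak i _.
have [P' hP'] : exists P', weakens (rpre st) w P' /\ univ P' = univ PF'.
  case: hw fv fr {bw ns} => [u _|x D _ sD] fv fr.
    by exists (add_univ (rpre st) u); split; [exact: WUniv|rewrite /= (inv_univ i)].
  by exists (add_exis (rpre st) x D); split; [apply: WExis => //; rewrite (inv_univ i)|rewrite /= (inv_univ i)].
case: hP' => hP' eu.
exists (State (RWeaken w :: done st) P' ([::] ++ rlines st)).
  by apply: WStep ns (RR_weaken _ _ hP') (WNil _ _ _ _).
apply: (inv_add_var i fv bw) => //.
- by move=> w' [->].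
- by move=> x; apply: weakens_declared hw.
- by move=> x; apply: weakens_declared hP'.
- by move=> x; apply: (weakens_dep hw).
- by move=> x; apply: (weakens_dep hP').
case: hw hP' fv fr {bw ns eu} => [u _|x D _ _] hP' fv fr; inversion hP'; subst => /=.
  by move=> y; rewrite /dep /= !inE !eqxx.
by move=> y; rewrite !dep_add_exis_new.
Qed.

Section ExtScripts.
Variable V : seq nat.
Notation srun := (srun (schemas ++ S) V).
Notation decl := (decl_form V).

Lemma srun_proj L (fs : seq form) : (forall f, f \in fs -> decl f) ->
  srun L (proj fs) (fun L' => {subset L <= L'} /\ forall f, f \in fs -> FImp (big_and fs) f \in L').
Proof.
move=> dfs; rewrite /proj; set A := big_and fs; have dA : decl A by apply: decl_big_and.
apply: srun_cons => // [B|L1 s1 h1]; first by in_seq.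
apply: (@srun_imp _ _ _ _ (fun L' => forall f, f \in fs -> FImp A f \in L')).
  by move=> L' sL h; split => // B /s1/sL.
have hA : fs != [::] -> FImp A (big_and fs) \in L1 by [].
move: A dA hA {h1} => A dA hA; elim: fs L1 dfs hA {s1} => [|f [|g s] IH] L1 dfs hA.
- by apply: srun_nil.
- by apply: srun_nil => L' sL f'; rewrite inE => /eqP->; apply: sL; apply: hA.
have df : decl f by apply: dfs; rewrite mem_head.
have ds f' : f' \in g :: s -> decl f' by move=> h; apply: dfs; rewrite inE h orbT.
have dB : decl (big_and (g :: s)) by apply: decl_big_and.
have args B : B \in [:: f; big_and (g :: s); A] -> decl B.
  by in_seq.
set h := fun f : form => _.
rewrite -[ctx h _]/([:: s_andL f (big_and (g :: s)) A; s_andR f (big_and (g :: s)) A] ++ ctx h (g :: s)).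
apply: srun_cons => // [B|L2 s2 h2]; first by rewrite inE => /eqP->; apply: hA.
apply: srun_cons => // [B|L3 s3 h3]; first by rewrite inE => /eqP->; apply/s2/hA.
apply: srun_imp (IH L3 ds (fun _ => h3)) => L' sL hf f'; rewrite inE => /orP[/eqP->|/hf//].
by apply/sL/s3.
Qed.

Lemma srun_neg_imps L A W (al : seq lit) : decl A -> decl W -> decl_clause V al ->
  (forall l, l \in al -> FImp A (lit_form l) \in L) ->
  srun L [seq neg_imp A W l | l <- al] (fun L' => {subset L <= L'} /\
    forall l, l \in al -> FImp (lit_form (neg l)) (FImp A W) \in L').
Proof.
move=> dA dW; elim: al L => [|l al IH] L dal hL; first by apply: srun_nil.
have dl : decl (FVar l.1) by move=> x; rewrite inE => /eqP->; apply/dal/mem_head.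
have hl : FImp A (lit_form l) \in L by apply/hL/mem_head.
rewrite map_cons; apply: (@srun_cons _ _ L (neg_imp A W l) _ _ _ _ _ _).
- by rewrite /neg_imp; case: ifP.
- by rewrite /neg_imp => B; case: ifP; rewrite !inE => _ /or3P[] /eqP->.
- rewrite /neg_imp => B; case: l hl {dl hL dal} => x [] /=; rewrite inE => hl /eqP->; exact: hl.
move=> L1 s1 h1; have dal' : decl_clause V al by move=> m hm; apply: dal; rewrite inE hm orbT.
have h' n : n \in al -> FImp A (lit_form n) \in L1 by move=> hn; apply/s1/hL; rewrite inE hn orbT.
apply: srun_imp (IH L1 dal' h') => L' sL [_ h2]; split => [B /s1/sL//|n].
rewrite inE => /orP[/eqP->|/h2//]; apply: sL; move: h1; rewrite /neg_imp.
by case: (l) => x [].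
Qed.

(** Substitution of equals under the guard, by induction on B; a variable equal to u is settled by
    rules 26 and 27, and everything else unchanged by reflexivity. *)
Lemma srun_congr L u b B : u \in V -> decl B ->
  srun L [seq congr u b C | C <- subs B] (fun L' => {subset L <= L'} /\
    FOr (guard u b) (FIff B (assign_const u b B)) \in L').
Proof.
move=> uV; have dE : decl (guard u b) by rewrite /guard; case: b => x; in_seq.
have du : decl (FVar u) by move=> x; in_seq.
have da C : decl C -> decl (assign_const u b C).
  have bin A B' : (decl A -> decl (assign_const u b A)) -> (decl B' -> decl (assign_const u b B')) ->
      {subset fvars A ++ fvars B' <= V} ->
      {subset fvars (assign_const u b A) ++ fvars (assign_const u b B') <= V}.
    by move=> hA hB /decl_fvars_cat[/hA h1 /hB h2]; apply/decl_fvars_cat.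
  elim: C => [x|||C IHC|C IHC D IHD|C IHC D IHD|C IHC D IHD|C IHC D IHD] //; try exact: bin.
  by rewrite /assign_const /=; case: ifP => // _; case: (b).
(* The four binary connectives differ only in the number k of their congruence rule. *)
have bin C D k X : decl C -> decl D ->
    (forall L, srun L [seq congr u b C' | C' <- subs C] (fun L' => {subset L <= L'} /\
      FOr (guard u b) (FIff C (assign_const u b C)) \in L')) ->
    (forall L, srun L [seq congr u b C' | C' <- subs D] (fun L' => {subset L <= L'} /\
      FOr (guard u b) (FIff D (assign_const u b D)) \in L')) ->
    k < size schemas -> congr u b X = (k, [:: C; assign_const u b C; D; assign_const u b D; guard u b]) ->
    (forall H, H \in premises (nth frule0 schemas k) ->
       H \in [:: FOr (FVar 4) (FIff (FVar 0) (FVar 1)); FOr (FVar 4) (FIff (FVar 2) (FVar 3))]) ->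
    sconc schemas (congr u b X) = FOr (guard u b) (FIff X (assign_const u b X)) ->
    forall L, srun L [seq congr u b C' | C' <- subs C ++ subs D ++ [:: X]]
      (fun L' => {subset L <= L'} /\ FOr (guard u b) (FIff X (assign_const u b X)) \in L').
  move=> dC dD hC hD lt_k e hp hs L0; rewrite !map_cat.
  apply: srun_cat; apply: srun_imp (hC L0) => L1 s1 [_ h1].
  apply: srun_cat; apply: srun_imp (hD L1) => L2 s2 [_ h2].
  rewrite map_cons; apply: srun_schema; rewrite ?e //.
  - move=> A; rewrite !inE => /orP[/eqP->//|/or4P[] /eqP->//]; exact: da.
  - move=> A /hp; rewrite !inE => /orP[] /eqP->; [exact/s2|exact: h2].
  by move=> L3 s3; rewrite -e hs => h3; split => // A /s1/s2/s3.
elim: B L => [x|||C IHC|C IHC D IHD|C IHC D IHD|C IHC D IHD|C IHC D IHD] L dB.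
- rewrite /= /assign_const /=; case: eqP => [->|_].
    by rewrite /guard; case: (b); (apply: srun_schema => // A; rewrite inE => /eqP->).
  by apply: srun_schema => // A; in_seq.
- by apply: srun_schema => // A; in_seq.
- by apply: srun_schema => // A; in_seq.
- rewrite [subs _]/= map_cat; apply: srun_cat; apply: srun_imp (IHC L dB) => L1 s1 [_ h1].
  apply: srun_schema => // [A|A|L2 s2 h2].
  + by rewrite !inE => /orP[/eqP->//|/or4P[] /eqP->//]; apply: da.
  + by in_seq.
  + by split => // A /s1/s2.
all: move: dB => /decl_fvars_cat[dC dD].
- by apply: (bin C D 29 (FAnd C D)) => // L0; [apply: IHC|apply: IHD].
- by apply: (bin C D 30 (FOr C D)) => // L0; [apply: IHC|apply: IHD].
- by apply: (bin C D 31 (FImp C D)) => // L0; [apply: IHC|apply: IHD].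
by apply: (bin C D 32 (FIff C D)) => // L0; [apply: IHC|apply: IHD].
Qed.
End ExtScripts.

Lemma f2r_extendP PF GF st v al isand Y : inv PF GF st -> v < base -> ext_ok PF v al Y ->
  let Q := if isand then conj_form Y else disj_form Y in
  runs st (f2r t RTs (FExtend v al isand Y)) (fun st' =>
    inv (add_exis PF v (ext_deps PF al Y))
      (FImp (conj_form al) (FIff (FVar v) Q) :: GF) st').
Proof.
move=> i bv [fv hal hY] Q; rewrite [f2r _ _ _]/(f2r_extend t RTs v al Q) /f2r_extend.
set PF' := add_exis _ _ _; set A := conj_form al; set V := FVar v.
have sQ : decl_form [seq y.1 | y <- Y] Q by rewrite /Q; case: (isand); case: (fvars_lits Y).
have dQ : decl_form (declared PF) Q by move=> x /sQ/mapP[y /hY h ->].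
apply: runs_cat; apply: runs_imp (runs_ensure M dQ i) => st1 [i1 e1 n1].
have [q1 q2] := flit_ok i1 dQ (ensured_gate n1).
set q := neg (flit Q); set s := RExtend v al q q.
have fr := inv_fresh i1 fv bv.
have ns : s \notin done st1 by apply: contra fr; apply: inv_ext i1 _ _ _ _.
have ok : ext_ok (rpre st1) v al [:: q; q].
  split => // [l /hal|y]; first by rewrite (inv_univ i1).
  by in_seq.
set D := ext_deps (rpre st1) al [:: q; q].
pose st2 := State (s :: done st1) (add_exis (rpre st1) v D) (rconc s ++ rlines st1).
have r2 : wrun M (done st1) (rpre st1) (rlines st1) [:: s] (done st2) (rpre st2) (rlines st2).
  by apply: WStep ns (RR_extend _ _ ok) (WNil _ _ _ _).
(* Universal variables depend on themselves in both prefixes, so the same set is subtracted on both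
   sides; the name of Q depends at most on what Y depends on. *)
have sD : {subset D <= ext_deps PF al Y}.
  move=> u; rewrite !mem_undup !mem_filter => /andP[nal hu]; apply/andP; split.
    apply: contra nal => /flattenP[ds /mapP[l hl ->] hd]; apply/flattenP.
    exists (dep (rpre st1) l.1); first by apply/mapP; exists l.
    by move: hd; rewrite /dep (inv_univ i1) (hal l hl).
  have {}hu : u \in dep (rpre st1) (flit Q).1.
    by case/flattenP: hu => ds; in_seq.
  have /mem_fdeps[x /sQ/mapP[y hy ->] hd] := q2 _ hu.
  by apply/flattenP; exists (dep PF y.1) => //; apply/mapP; exists y.
have i2 : inv PF' GF st2.
  apply: (inv_add_var i1 fv bv ns) => //.
  - by move=> X [e _ _]; have := name_ge t X; rewrite -e; lia.
  - by move=> v' al' y z [->].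
  - exact: inv_univ i1.
  - by move=> x; rewrite declared_add_exis.
  - by move=> x; rewrite declared_add_exis.
  - by move=> x hx; rewrite dep_add_exis ?(fresh_neq fv).
  - by move=> x hx; rewrite dep_add_exis ?(fresh_neq fr).
  - by rewrite !dep_add_exis_new.
apply: runs_cat; exists st2 => //.
have dF B : decl_form (declared PF) B -> decl_form (declared PF') B.
  by move=> h x /h hx; rewrite declared_add_exis hx orbT.
have dV : decl_form (declared PF') V by move=> x; rewrite inE declared_add_exis => ->.
have dQ' := dF _ dQ.
have dal : decl_clause (declared PF') al.
  by move=> l /hal hl; rewrite declared_add_exis /declared mem_cat hl orbT.
have dA : decl_form (declared PF') A by apply: decl_big_and => f; apply: decl_lits.
have dW1 := decl_FImp dQ' dV; have dW2 := decl_FImp dV dQ'.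
have dZ1 := decl_FImp dA dW1; have dZ2 := decl_FImp dA dW2.
set scr := proj (lits al) ++ _.
have hscr : srun (schemas ++ S) (declared PF') [::] scr (fun L' =>
   [/\ forall l, l \in al -> FImp (lit_form (neg l)) (FImp A (FImp Q V)) \in L',
       forall l, l \in al -> FImp (lit_form (neg l)) (FImp A (FImp V Q)) \in L' &
       [/\ FImp V (FImp A (FImp Q V)) \in L', FImp (FNot Q) (FImp A (FImp Q V)) \in L',
           FImp Q (FImp A (FImp V Q)) \in L' & FImp (FNot V) (FImp A (FImp V Q)) \in L']]).
  apply: srun_cat; apply: srun_imp (srun_proj [::] (fun f => @decl_lits _ _ f dal)) => L1 s1 [_ h1].
  have {}h1 l : l \in al -> FImp A (lit_form l) \in L1 by move=> hl; apply: h1; apply: map_f.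
  apply: srun_cat; apply: srun_imp (srun_neg_imps dA dW1 dal h1) => L2 s2 [_ h2].
  have {}h1 l : l \in al -> FImp A (lit_form l) \in L2 by move=> hl; apply/s2/h1.
  apply: srun_cat; apply: srun_imp (srun_neg_imps dA dW2 dal h1) => L3 s3 [_ h3].
  apply: srun_cons => // [B|L4 s4 h4]; first by in_seq.
  apply: srun_cons => // [B|L5 s5 h5]; first by in_seq.
  apply: srun_cons => // [B|L6 s6 h6]; first by in_seq.
  apply: srun_schema => // [B|L7 s7 h7]; first by in_seq.
  split => [l /h2/s3/s4/s5/s6/s7//|l /h3/s4/s5/s6/s7//|].
  by split; [apply/s7/s6/s5|apply/s7/s6|apply/s7|].
apply: runs_cat; apply: runs_imp (runs_rscript i2 (L := [::]) _ hscr) => // st3 [i3 e3 [L' hL' [a1 a2 [k1 k2 k3 k4]]]].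
have rc C : C \in rconc s -> derived_clause (rlines st3) C.
  by move=> hC; apply/derived_mem/e3.2; rewrite mem_cat hC.
have c1 : derived_clause (rlines st3) [seq slit r | r <- ext_clause1 v al Q].
  by rewrite map_cat map_slit_sclause; apply: rc; rewrite mem_head.
have c2 : derived_clause (rlines st3) [seq slit r | r <- ext_clause2 v al Q].
  rewrite map_cat map_slit_sclause.
  (* Both inputs of the extension are the same literal q, so the third clause contains [neg q], the
     literal of Q, twice. *)
  apply: (@derived_eq _ ([seq neg l | l <- al] ++ [:: (v, false); neg q; neg q])).
    by move=> l; rewrite /q negK !mem_cat !inE orbb.
  by apply: rc; rewrite !inE eqxx !orbT.
have dcl s' : s' \in sclause [seq neg l | l <- al] -> decl_form (declared PF') s'.1.
  by case/mapP => l /mapP[m /dal hm ->] -> x; in_seq.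
apply: runs_cat; apply: runs_imp (runs_clause_to_unit i3 dZ1 _ _ c1 _) => [st4 [i4 e4 d4]|s'||s']; last 1 first.
- rewrite mem_cat => /orP[/mapP[l /mapP[m hm ->] ->]|]; first exact/hL'/a1.
  by rewrite !inE => /orP[] /eqP->; apply: hL'.
- have {}c2 := derived_mono e4.2 c2.
  apply: runs_cat; apply: runs_imp (runs_clause_to_unit i4 dZ2 _ _ c2 _) => [st5 [i5 e5 d5]|s'||s']; last 1 first.
  + rewrite mem_cat => /orP[/mapP[l /mapP[m hm ->] ->]|].
      by apply: derived_mono e4.2 _; apply/hL'/a2.
    by rewrite !inE => /orP[] /eqP->; apply: derived_mono e4.2 _; apply: hL'.
  + have hL f : f \in [:: FImp A (FImp Q V); FImp A (FImp V Q)] -> holds st5 f.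
      rewrite !inE => /orP[] /eqP->; last exact: d5.
      exact: derived_mono e5.2 d4.
    have hf : srun (schemas ++ S) (declared PF') [:: FImp A (FImp Q V); FImp A (FImp V Q)]
        [:: s_iffI A Q V] (fun L' => FImp A (FIff V Q) \in L').
      apply: srun_schema => // B; first by in_seq.
      by rewrite !inE => /orP[] /eqP->; rewrite ?eqxx ?orbT.
    apply: runs_imp (runs_rscript i5 hL hf) => st6 [i6 _ [L6 h6 m6]].
    by apply: inv_add => //; apply: h6.
  + rewrite mem_cat => /orP[/dcl//|]; rewrite !inE => /orP[] /eqP-> //.
  + by rewrite /ext_clause2; case: (sclause _).
- rewrite mem_cat => /orP[/dcl//|]; rewrite !inE => /orP[] /eqP-> //.
- by rewrite /ext_clause1; case: (sclause _).
Qed.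

Lemma fvars_assign u b L x : x \in fvars (assign_const u b L) -> x \in fvars L /\ x != u.
Proof.
elim: L => [y|||C IHC|C IHC D IHD|C IHC D IHD|C IHC D IHD|C IHC D IHD] //;
  try by rewrite /= !mem_cat => /orP[/IHC|/IHD] [-> ->]; rewrite ?orbT.
by rewrite /assign_const /=; case: eqP => [_|/eqP ne]; [case: (b)|rewrite !inE => /eqP->; rewrite eqxx].
Qed.

(** Names start at [code t 1], so a literal below is that of a variable. This rules out that the
    name of L[u := c] is a literal of u. *)
Lemma flit_small X : (flit X).1 < base -> X = FVar (flit X).1.
Proof.
have h Y : name t Y < base -> False by have := name_ge t Y; lia.
by case: X => [x|||B|B C|B C|B C|B C] //= /h.
Qed.

Lemma f2r_reduceP PF GF st L u b : inv PF GF st -> L \in GF -> u \in univ PF ->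
  (forall x, x \in fvars L -> x \in exvars PF -> u \notin dep PF x) ->
  runs st (f2r t RTs (FReduce L u b)) (fun st' => inv PF (assign_const u b L :: GF) st').
Proof.
move=> i hL uu hdep; rewrite [f2r _ _ _]/(f2r_reduce t RTs L u b) /f2r_reduce.
set E := guard u b; set L' := assign_const u b L.
have [dL hoL] := inv_line i hL.
have uV : u \in declared PF by rewrite /declared mem_cat uu.
have dE : decl_form (declared PF) E by rewrite /E /guard; case: b {L' E hdep} => x; in_seq.
have dL' : decl_form (declared PF) L' by move=> x /fvars_assign[/dL].
have dO : decl_form (declared PF) (FOr E L') by apply/decl_fvars_cat.
have hs : srun (schemas ++ S) (declared PF) [:: L] ([seq congr u b B | B <- subs L] ++ [:: s_trans L L' E])
    (fun G => FOr E L' \in G).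
  apply: srun_cat; apply: srun_imp (srun_congr [:: L] b uV dL) => L1 s1 [_ h1].
  apply: srun_schema => // A.
    by in_seq.
  by rewrite !inE => /orP[] /eqP->; [apply: s1; rewrite mem_head|].
apply: runs_cat; apply: runs_imp (runs_rscript i (L := [:: L]) _ hs) => [st1 [i1 e1 [G1 h1 /h1 d1]]|f]; last first.
  by in_seq.
apply: runs_cat; apply: runs_imp (runs_ensure M dO i1) => st2 [i2 e2 n2].
have gO : is_gate (FOr E L') by exact: mem_head.
have mO : [:: sneg (FOr E L', true); sneg (E, false); sneg (L', false)] \in gate_clauses (FOr E L').
  by rewrite !inE eqxx !orbT.
have c2 : derived_clause (rlines st2) (neg (flit (FOr E L')) :: [:: flit E; flit L']).
  by apply: derived_mem; have := gate_derived i2 gO (ensured_gate n2 gO) mO.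
apply: runs_cat; apply: runs_imp (runs_rres M i2 c2 (derived_mono e2.2 d1)) => st3 [i3 e3 d3].
rewrite cats0 in d3.
set sb := (if b then _ else _).
have rb : runs st3 sb (fun st' => [/\ inv PF GF st', ext_state st3 st' &
    derived_clause (rlines st') ((u, ~~ b) :: [:: flit L'])]).
  move: n2 d3; rewrite /sb /E /guard; case: (b) => n2 d3; last first.
    by apply: runs_nil; split => //; exact: ext_refl.
  have gN : is_gate (FNot (FVar u)) by exact: mem_head.
  have hN : gate_step t (FNot (FVar u)) \in done st3.
    by apply: e3.1; apply: (n2 (FNot (FVar u))) => //; rewrite /= !inE eqxx orbT.
  have mN : [:: sneg (FNot (FVar u), true); sneg (FVar u, true); sneg (FVar u, true)] \in gate_clauses (FNot (FVar u)).
    by rewrite !inE eqxx !orbT.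
  have c3 : derived_clause (rlines st3) (neg (flit (FNot (FVar u))) :: [:: (u, false)]).
    apply: derived_eq (derived_mem (gate_derived i3 gN hN mN)) => l.
    by rewrite !inE orbb.
  exact: runs_rres i3 c3 d3.
apply: runs_cat; apply: runs_imp rb => st4 [i4 e4 d4].
have nL' : ensured t st4 L'.
  apply: ensured_ext (ext_trans e3 e4) _ => Y Z hY; apply: n2.
  by rewrite /= !mem_cat hY orbT.
have [f1 f2] := flit_ok i4 dL' (ensured_gate nL').
have red : rrule M (rpre st4) (rlines st4) (RReduce [:: flit L'] (u, ~~ b)) (rpre st4) [:: [:: flit L']].
  apply: RR_reduce => //=; first by rewrite (inv_univ i4).
    (* The name of L' depends only on variables of L other than u: a universal one depends on itself
       alone, and an existential one is covered by the side condition in F. *)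
    move=> l; rewrite inE => /eqP-> _; apply/negP => /f2/mem_fdeps[x hx hu].
    have [xL ne] := fvars_assign hx; have := dL' x hx; rewrite /declared mem_cat => /orP[xu|xe].
      by move: hu; rewrite /dep xu inE eq_sym (negbTE ne).
    by have := hdep x xL xe; rewrite hu.
  apply/negP; rewrite inE => /eqP e.
  have eu : (flit L').1 = u by rewrite -e.
  have := flit_small (X := L'); rewrite eu => /(_ (inv_bnd i uV)) e'.
  have : u \in fvars L' by rewrite e' mem_head.
  by case/fvars_assign => _; rewrite eqxx.
apply: runs_imp (runs_pure i4 (s := RReduce _ _) isT red) => st5 [i5 e5 h5].
by apply: inv_add => //; apply/derived_mem/h5/mem_head.
Qed.

(** Variables that the refutation in F will introduce must not collide with names; their numbers
    occur in the input and are thus small, see [enc_fstep_bnd]. *)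
Definition fstep_bnd (s : fstep) : bool :=
  match s with FExtend v _ _ _ => v < base | FWeaken w => wvar w < base | _ => true end.

Lemma f2r_sim PF GF pi st : refutes (frule_step S M) FFalse PF GF pi -> inv PF GF st ->
  [::] \notin M -> (forall C, C \in M -> decl_clause (declared PF) C) ->
  all fstep_bnd pi ->
  runs st (flatten [seq f2r t RTs s | s <- pi]) (fun st' => exists2 PF', inv PF' [:: FFalse] st' & True).
Proof.
move=> h i nM; elim: h st i => {PF GF pi} [PF GF hbot|PF GF s pi PF' new hs _ IH] st i dM.
  move=> _; apply: runs_nil; exists PF => //; case: i => *; split => // L.
  by rewrite inE => /eqP->; auto.
rewrite [all _ _]/= => /andP[bs bpi]; apply: runs_cat.
have mono : {subset declared PF <= declared PF'}.
  case: hs => [r sg lt_r R _ _|C _|v al isand Y _|L u b _ _ _|w P' hw] x hx //.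
    by rewrite declared_add_exis hx orbT.
  exact: (weakens_mono hw).
have r : runs st (f2r t RTs s) (inv PF' (new ++ GF)).
  case: hs bs i {IH mono} => {s PF' new}.
  - by move=> r sigma lt_r R hp hc _ i; exact: (f2r_frege i lt_r hp hc).
  - by move=> C hC _ i; apply: f2r_axiomP => //; [apply: contraNneq nM => <-|exact: dM].
  - by move=> v al isand Y ok bv i; apply: f2r_extendP.
  - by move=> L u b hL uu hd _ i; apply: f2r_reduceP.
  - by move=> w P' hw bw i; exact: (f2r_weaken i bw hw).
apply: runs_imp r => st1 i1; apply: IH => // C hC l hl; exact/mono/(dM C hC).
Qed.

Lemma f2r_allP P pi : uniq (declared P) -> [::] \notin M ->
  (forall C, C \in M -> decl_clause (declared P) C) ->
  (forall x, x \in declared P -> x < base) -> all fstep_bnd pi ->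
  refutes (frule_step S M) FFalse P [::] pi ->
  refutes (rrule M) [::] P [::] (f2r_all t RTs pi).
Proof.
move=> uP nM dM bP bpi h.
have zge : base <= zvar t.
  by apply: leq_trans (code_ge _ _); rewrite -{1}(mul1n base) leq_mul2r expn_gt0 orbT.
have tge := name_ge t FTrue; rewrite -/(tvar t) in tge.
have zt : zvar t != tvar t by apply/eqP => /code_inj2[].
have zX X : zvar t != name t X by apply/eqP => /code_inj2[]; case: X.
have fz : fresh P (zvar t) by apply/negP => /bP; lia.
pose P1 := add_exis P (zvar t) [::].
have ft : fresh P1 (tvar t).
  rewrite /fresh declared_add_exis negb_or eq_sym zt /=; apply/negP => /bP; lia.
have ok : ext_ok P1 (tvar t) [::] [:: (zvar t, true); (zvar t, false)].
  by split => // y; rewrite !inE => /orP[] /eqP->; rewrite declared_add_exis eqxx.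
pose s1 := RWeaken (WeakExis (zvar t) [::]).
pose s2 := RExtend (tvar t) [::] (zvar t, true) (zvar t, false).
pose s3 := RResolve [:: (tvar t, true)] [:: (tvar t, true)] (zvar t).
pose D := ext_deps P1 [::] [:: (zvar t, true); (zvar t, false)].
(* [tvar] inherits no dependencies because [zvar] has none; so constants never block a reduction. *)
have D0 : D = [::] by rewrite /D /ext_deps /deps /= dep_add_exis_new.
pose st := State [:: s3; s2; s1] (add_exis P1 (tvar t) D) (rconc s3 ++ rconc s2 ++ [::] ++ [::]).
have r : wrun M [::] P [::] [:: s1; s2; s3] (done st) (rpre st) (rlines st).
  apply: WStep (RR_weaken _ _ _) _ => //; first exact: WExis.
  apply: WStep (RR_extend _ _ ok) _ => //.
  apply: WStep (RR_resolve _ _ _ _) (WNil _ _ _ _) => //.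
    by exists [:: (tvar t, true); (zvar t, false)]; [rewrite !inE eqxx ?orbT|move=> l; rewrite !inE orbC].
  by exists [:: (tvar t, true); (zvar t, true)]; [rewrite !inE eqxx ?orbT|move=> l; rewrite !inE orbC].
have dst x : (x \in declared (rpre st)) = [|| x == tvar t, x == zvar t | x \in declared P].
  by rewrite !declared_add_exis.
have dp x : x \in declared P -> dep (rpre st) x = dep P x.
  move=> hx; have bx := bP x hx.
  by rewrite !dep_add_exis //; apply/eqP; lia.
have i : inv P [::] st.
  split => //.
  - by move=> x hx; rewrite dst hx !orbT.
  - by move=> x hx; rewrite dp.
  - by move=> x; rewrite dst => /or3P[/eqP->|/eqP->|]; [right|right|left].
  - by move=> s; rewrite !inE => /or3P[] /eqP-> C hC; rewrite !mem_cat hC ?orbT.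
  - by move=> v al y z; rewrite !inE => /or3P[/eqP//|/eqP[-> _ _ _]|/eqP//]; rewrite dst eqxx.
  - by move=> w; rewrite !inE => /or3P[/eqP//|/eqP//|/eqP[->]]; rewrite dst eqxx orbT.
  - move=> X gX; rewrite dst eq_sym => /or3P[/eqP/(@name_inj t) e|/eqP e|/bP].
    + by rewrite -e in gX.
    + by have := zX X; rewrite e eqxx.
    + by have := name_ge t X; lia.
  - move=> X gX; rewrite !inE => /or3P[/eqP//|/eqP[/(@name_inj t) e _ _]|/eqP//].
    by rewrite e in gX.
  - split; first by rewrite dst eqxx.
      by rewrite dep_add_exis_new.
    by exists [:: (tvar t, true); (tvar t, true)]; [rewrite mem_head|move=> l; rewrite !inE orbb].
have [st1 r1 [PF1 i1 _]] := f2r_sim h i nM dM bpi.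
have [_ h1] := inv_line i1 (mem_head _ _); have [_ _ h2] := inv_t i1.
have [st2 r2 [_ _ sub]] := runs_pure (M := M) i1 (s := RResolve [::] [::] (tvar t)) isT (RR_resolve _ _ h1 h2).
have hbot : [::] \in rlines st2 by apply: sub; rewrite mem_head.
exact: (refutes_undup_steps (wrun_cat r (wrun_cat r1 r2)) hbot).
Qed.
End F2R.

(** * Polynomial time of the translation from F to R *)

Notation enc_sform := (enc_pair enc_form enc_bool).

Section PolyNames.
Context (A : Type) (eA : A -> tree).

Lemma pt_name t X : pt eA id t -> pt eA enc_form X -> pt eA enc_nat (fun a => name (t a) (X a)).
Proof.
move=> ht hX; apply: (@pt_code _ _ (fun a => code (t a) 1)) => [a||]; first exact: code_gt0.
  by apply: pt_code => //; exact: pt_const.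
exact: pt_enc hX.
Qed.

Lemma pt_zvar t : pt eA id t -> pt eA enc_nat (fun a => zvar (t a)).
Proof.
move=> ht; apply: (@pt_code _ _ (fun a => code (t a) 1) (fun=> Leaf)) => [a||]; first exact: code_gt0.
  by apply: pt_code => //; exact: pt_const.
exact: pt_const.
Qed.

Lemma pt_pol X : pt eA enc_form X -> pt eA enc_bool (fun a => pol (X a)).
Proof. by move=> hX; rewrite /pol; apply: pt_form_case => //; exact: pt_const. Qed.

End PolyNames.

Ltac pt_names := first [ pt_hyp | apply: pt_name | apply: pt_pol | apply: pt_lits
  | apply: pt_disj_form | apply: pt_conj_form | apply: pt_neg_lit | apply: pt_lit_form
  | apply: pt_inj ].
Ltac pt_user ::= pt_names.

Section PolyGates.
Context (A : Type) (eA : A -> tree).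

Lemma pt_flit t X : pt eA id t -> pt eA enc_form X -> pt eA enc_lit (fun a => flit (t a) (X a)).
Proof. by move=> ht hX; rewrite /flit /tvar; apply: pt_form_case; ptt. Qed.

Lemma pt_slit t s : pt eA id t -> pt eA enc_sform s -> pt eA enc_lit (fun a => slit (t a) (s a)).
Proof. by move=> ht hs; rewrite /slit; apply: pt_if; [|apply: pt_flit|apply: pt_neg_lit; apply: pt_flit]; ptt. Qed.

Lemma pt_in1 X : pt eA enc_form X -> pt eA enc_sform (fun a => in1 (X a)).
Proof. by move=> hX; rewrite /in1; apply: pt_form_case; ptt. Qed.

Lemma pt_in2 X : pt eA enc_form X -> pt eA enc_sform (fun a => in2 (X a)).
Proof. by move=> hX; rewrite /in2; apply: pt_form_case; ptt. Qed.

Lemma pt_gates X : pt eA enc_form X -> pt eA (enc_seq enc_form) (fun a => gates (X a)).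
Proof. by move=> hX; rewrite /gates; apply: pt_form_case; ptt. Qed.

Lemma pt_pos_form s : pt eA enc_sform s -> pt eA enc_form (fun a => pos_form (s a)).
Proof. by move=> hs; rewrite /pos_form; ptt. Qed.

Lemma pt_rres E F l : pt eA (enc_seq enc_lit) E -> pt eA (enc_seq enc_lit) F -> pt eA enc_lit l ->
  pt eA enc_rstep (fun a => rres (E a) (F a) (l a)).
Proof. by move=> hE hF hl; rewrite /rres; ptt. Qed.

Lemma pt_inst_clause t sigma C : pt eA id t -> pt eA (enc_seq enc_form) sigma ->
  pt eA (enc_seq enc_lit) (fun a => inst_clause (t a) (sigma a) C).
Proof.
move=> ht hs; rewrite /inst_clause; elim: C => [|s C IH] /=; first exact: pt_const.
apply: pt_cons => //; apply: pt_slit => //; apply: pt_pair; last exact: pt_const.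
exact: pt_inst.
Qed.

End PolyGates.

Ltac pt_user ::= first
  [ pt_names | apply: pt_flit | apply: pt_slit | apply: pt_in1 | apply: pt_in2
  | apply: pt_gates | apply: pt_pos_form | apply: pt_rres ].

Section PolyEnsure.
Context (A : Type) (eA : A -> tree).

Lemma pt_gate_step t X : pt eA id t -> pt eA enc_form X ->
  pt eA enc_rstep (fun a => gate_step (t a) (X a)).
Proof. by move=> ht hX; rewrite /gate_step; apply: pt_RExtend; ptt. Qed.
End PolyEnsure.

Section PolyEnsure.
Context (A : Type) (eA : A -> tree).

Lemma pt_ensure t X : pt eA id t -> pt eA enc_form X ->
  pt eA (enc_seq enc_rstep) (fun a => ensure (t a) (X a)).
Proof.
move=> ht hX; rewrite /ensure; apply: pt_flatten_map; first exact: pt_subs.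
by cbv beta; apply: pt_map; [|apply: pt_gate_step]; ptt.
Qed.

Lemma pt_rsim t RT sigma : pt eA id t -> pt eA (enc_seq enc_form) sigma ->
  pt eA (enc_seq enc_rstep) (fun a => rsim (t a) RT (sigma a)).
Proof.
move=> ht hs; rewrite /rsim; apply: pt_cat; first by apply: pt_ensure => //; apply: pt_inst.
elim: (RT.2) => [|k ks IH] /=; first exact: pt_const.
apply: pt_cons => //; apply: pt_rres; [exact: pt_inst_clause|exact: pt_inst_clause|].
by apply: pt_flit => //; apply: pt_inst.
Qed.
End PolyEnsure.

Section PolyScript.
Context (A : Type) (eA : A -> tree).

Lemma pt_rscript t RTs s : pt eA id t -> pt eA enc_script s ->
  pt eA (enc_seq enc_rstep) (fun a => rscript (t a) RTs (s a)).
Proof.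
move=> ht hs; rewrite /rscript; apply: (pt_flatten_map hs).
apply: (@pt_select _ _ _ _ _ _ _ _ (fun RT (q : A * sstep) => rsim (t q.1) RT q.2.2)).
  by ptt.
by move=> RT; apply: pt_rsim; ptt.
Qed.

Lemma pt_elim_lit t Z D s rest : pt eA id t -> pt eA enc_form Z -> pt eA (enc_seq enc_lit) D ->
  pt eA enc_sform s -> pt eA (enc_seq enc_sform) rest ->
  pt eA (enc_seq enc_rstep) (fun a => elim_lit (t a) (Z a) (D a) (s a) (rest a)).
Proof.
move=> ht hZ hD hs hr; rewrite /elim_lit.
apply: pt_cat; first by apply: pt_ensure; ptt.
by ptt.
Qed.
End PolyScript.

Section PolyF2R.
Context (A : Type) (eA : A -> tree).

Lemma pt_clause_to_unit t ss Z : pt eA id t -> pt eA (enc_seq enc_sform) ss -> pt eA enc_form Z ->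
  pt eA (enc_seq enc_rstep) (fun a => clause_to_unit (t a) (ss a) (Z a)).
Proof.
move=> ht hs hZ; rewrite /clause_to_unit; apply: (pt_seq_case hs); first exact: pt_const.
apply: pt_cat; first by apply: pt_elim_lit; ptt.
by apply: pt_ctx; [ptt|apply: pt_elim_lit; ptt].
Qed.

Lemma pt_sclause C : pt eA (enc_seq enc_lit) C -> pt eA (enc_seq enc_sform) (fun a => sclause (C a)).
Proof. by move=> hC; rewrite /sclause; ptt. Qed.

Lemma pt_proj fs : pt eA (enc_seq enc_form) fs -> pt eA enc_script (fun a => proj (fs a)).
Proof. by move=> h; rewrite /proj; ptt. Qed.

Lemma pt_neg_imps P W al : pt eA enc_form P -> pt eA enc_form W -> pt eA (enc_seq enc_lit) al ->
  pt eA enc_script (fun a => [seq neg_imp (P a) (W a) l | l <- al a]).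
Proof. by move=> hP hW hal; rewrite /neg_imp; apply: (pt_map hal); ptt. Qed.

Lemma pt_congrs u b Bs : pt eA enc_nat u -> pt eA enc_bool b -> pt eA (enc_seq enc_form) Bs ->
  pt eA enc_script (fun a => [seq congr (u a) (b a) B | B <- Bs a]).
Proof.
move=> hu hb hB; apply: (pt_map hB); rewrite /congr /guard.
by apply: pt_form_case; ptt.
Qed.
End PolyF2R.

Section PolyF2R.
Context (A : Type) (eA : A -> tree) (RTs : seq (frule * rtemplate)).

Lemma pt_f2r_extend t v al Q : pt eA id t -> pt eA enc_nat v -> pt eA (enc_seq enc_lit) al ->
  pt eA enc_form Q -> pt eA (enc_seq enc_rstep) (fun a => f2r_extend (t a) RTs (v a) (al a) (Q a)).
Proof.
move=> ht hv hal hQ; rewrite /f2r_extend.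
have hA : pt eA enc_form (fun a => conj_form (al a)) by apply: pt_conj_form.
have hV : pt eA enc_form (fun a => FVar (v a)) by apply: pt_FVar.
have h1 := pt_FImp hQ hV; have h2 := pt_FImp hV hQ.
have hn : pt eA (enc_seq enc_sform) (fun a => sclause [seq neg l | l <- al a]).
  by apply: pt_sclause; ptt.
apply: pt_cat; first exact: pt_ensure.
apply: pt_cat; first by ptt.
apply: pt_cat.
  apply: pt_rscript => //; apply: pt_cat; first by apply: pt_proj; apply: pt_lits.
  apply: pt_cat; first exact: pt_neg_imps.
  by apply: pt_cat; [exact: pt_neg_imps|ptt].
apply: pt_cat.
  apply: pt_clause_to_unit => //; last exact: pt_FImp.
  by apply: pt_cat => //; ptt.
apply: pt_cat.
  apply: pt_clause_to_unit => //; last exact: pt_FImp.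
  by apply: pt_cat => //; ptt.
by apply: pt_rscript => //; ptt.
Qed.

Lemma pt_f2r_reduce t L u b : pt eA id t -> pt eA enc_form L -> pt eA enc_nat u ->
  pt eA enc_bool b -> pt eA (enc_seq enc_rstep) (fun a => f2r_reduce (t a) RTs (L a) (u a) (b a)).
Proof.
move=> ht hL hu hb; rewrite /f2r_reduce.
have hE : pt eA enc_form (fun a => guard (u a) (b a)) by rewrite /guard; ptt.
have hL' : pt eA enc_form (fun a => assign_const (u a) (b a) (L a)) by apply: pt_assign_const.
have hO := pt_FOr hE hL'.
apply: pt_cat.
  apply: pt_rscript => //; apply: pt_cat; first by apply: pt_congrs => //; apply: pt_subs.
  by apply: pt_cons; [apply: pt_pair; [exact: pt_const|]|exact: pt_const]; do 2 apply: pt_cons => //; ptt.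
apply: pt_cat; first exact: pt_ensure.
apply: pt_cat.
  apply: pt_cons; last exact: pt_const.
  apply: pt_rres; [|exact: pt_const|exact: pt_flit].
  by apply: pt_cons; [exact: pt_flit|apply: pt_cons; [exact: pt_flit|exact: pt_const]].
apply: pt_cat.
  apply: pt_if => //; last exact: pt_const.
  apply: pt_cons; last exact: pt_const.
  apply: pt_rres; [by ptt| |exact: pt_flit].
  by apply: pt_cons; [exact: pt_flit|exact: pt_const].
apply: pt_cons; last exact: pt_const.
apply: pt_RReduce; last by ptt.
by apply: pt_cons; [exact: pt_flit|exact: pt_const].
Qed.
End PolyF2R.

Section PolyF2R.
Context (A : Type) (eA : A -> tree) (RTs : seq (frule * rtemplate)).

Lemma pt_f2r t s : pt eA id t -> pt eA enc_fstep s ->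
  pt eA (enc_seq enc_rstep) (fun a => f2r (t a) RTs (s a)).
Proof.
move=> ht hs; rewrite /f2r; apply: (pt_fstep_case hs).
- by apply: pt_rscript; ptt.
- apply: pt_cons; first by ptt.
  apply: pt_cat; first by apply: pt_rscript; ptt.
  by apply: pt_clause_to_unit; [ptt|apply: pt_sclause; ptt|ptt].
- by apply: pt_f2r_extend; ptt.
- by apply: pt_f2r_reduce; ptt.
- by ptt.
Qed.
End PolyF2R.

Lemma leq_enc_seq (A : eqType) (e : A -> tree) s x : x \in s -> tsize (e x) <= tsize (enc_seq e s).
Proof. by elim: s => //= y s IH; rewrite inE => /orP[/eqP->|/IH]; lia. Qed.

Lemma ltn_code_base x t : tsize (enc_nat x) <= tsize t -> x < code t 1.
Proof.
move=> h; apply: leq_trans (code_ge t 1); rewrite muln1.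
by apply: leq_trans (ltn_enc_nat x) _; rewrite leq_exp2l.
Qed.

Lemma declared_bnd Phi x t : x \in declared (pre Phi) -> tsize (enc_dqbf Phi) <= tsize t -> x < code t 1.
Proof.
move=> hx h; apply: ltn_code_base; apply: leq_trans h; rewrite /enc_dqbf /enc_prefix [tsize (Node _ _)]/=.
move: hx; rewrite mem_cat => /orP[hx|/mapP[xD hD ->]].
  have h : tsize (enc_nat x) <= tsize (enc_seq enc_nat (univ (pre Phi))) := leq_enc_seq _ hx.
  by lia.
have h : tsize (enc_pair enc_nat (enc_seq enc_nat) xD)
    <= tsize (enc_seq (enc_pair enc_nat (enc_seq enc_nat)) (exis (pre Phi))) := leq_enc_seq _ hD.
by move: h; rewrite [tsize (enc_pair _ _ _)]/=; lia.
Qed.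

Lemma enc_fstep_bnd t s : tsize (enc_fstep s) <= tsize t -> fstep_bnd t s.
Proof.
case: s => //= [v al b Y|w] h; apply: ltn_code_base; apply: leq_trans h; rewrite /=; first by lia.
by case: w => [u|x D] /=; lia.
Qed.

Lemma p_simulates_R_F (S : seq frule) : frege_system S -> p_simulates R_system (F_system S).
Proof.
move=> /exists_rtemplates[RTs hRT].
pose enc_in := enc_pair enc_dqbf (enc_seq enc_fstep).
(* The tree that names are built over is the whole input, so they exceed the variables of the
   formula and those of its refutation. *)
pose g (q : dqbf * seq fstep) := if [::] \in matrix q.1 then [:: RAxiom [::]]
  else f2r_all (enc_in q) RTs q.2.
have [f hf fE] : pt enc_in (enc_pair enc_dqbf (enc_seq enc_rstep)) (fun q => (q.1, g q)).
  have hM : pt enc_dqbf (enc_seq (enc_seq enc_lit)) matrix by exists rgt; [exact: PT_rgt|].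
  have ht : pt enc_in id enc_in by exact: (pt_enc (pt_id enc_in)).
  have hpi : pt enc_in (enc_seq enc_fstep) snd by exact: (pt_snd (pt_id enc_in)).
  have hPhi : pt enc_in enc_dqbf fst by exact: (pt_fst (pt_id enc_in)).
  have hz : pt enc_in enc_nat (fun q => zvar (enc_in q)) by apply: pt_zvar.
  have hT : pt enc_in enc_nat (fun q => tvar (enc_in q)) by apply: pt_name => //; exact: pt_const.
  apply: pt_pair => //.
  rewrite /g; apply: pt_if; last 1 first.
  - rewrite /f2r_all /undup_steps; apply: (@pt_pctx _ _ _ _ _ _ _
      (fun _ d s => if s \in d then [::] else [:: s])).
      apply: pt_cat; first by ptt.
      apply: pt_cat; first apply: (@pt_flatten_map _ _ _ _ _ _ _ (fun q s => f2r (enc_in q) RTs s) hpi).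
        by apply: pt_f2r; [exact: (pt_app ht (pt_fst (pt_id _)))|exact: (pt_snd (pt_id _))].
      by ptt.
    by apply: pt_if; [apply: (pt_mem enc_rstep_inj)| |]; ptt.
  - apply: (pt_mem (enc_seq_inj enc_lit_inj)); first exact: pt_const.
    exact: (pt_app hM hPhi).
  - exact: pt_const.
exists f; first exact: PT_polytime.
move=> Phi pi [wf h]; exists (g (Phi, pi)); last exact: (fE (Phi, pi)).
split => //; rewrite /g; case: ifP => [h0|/negbT h0].
  apply: RefStep (RR_axiom _ _ (derived_mem h0)) _; apply: RefDone; exact: mem_head.
have [[uP _] dM] := wf.
apply: (f2r_allP hRT uP h0) h => [C hC l hl|x hx|].
- exact: dM hC hl.
- by apply: declared_bnd hx _; rewrite /= leqW // leq_addr.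
apply/(all_nthP (FAxiom [::])) => k hk; apply: enc_fstep_bnd.
apply: (@leq_trans (tsize (enc_seq enc_fstep pi))); last by rewrite /=; lia.
move: hk; clear; elim: pi k => //= s pi IH [|k] hk /=; first by lia.
by have := IH k hk; lia.
Qed.

Theorem theorem3 (S : seq frule) (hS : frege_system S) :
  p_equivalent R_system (F_system S).
Proof. by split; [exact: p_simulates_R_F|exact: p_simulates_F_R]. Qed.
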